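(* Let $\beta>0$ and let $n\ge1$ be an integer. For $\lambda\in\mathbb R$ let $\alpha_\lambda(u)$ be the strong solution of $$d\alpha_\lambda = \lambda\tfrac{\beta}{4}e^{\frac{\beta}{4}u}\, du + \Re[(e^{-i\alpha_\lambda(u)}-1)(dZ-i n\, du)],\qquad \lim_{u\to-\infty}\alpha_\lambda(u)=0,$$ and set $\mathbf q(\lambda)=[q_1(\lambda),\dots,q_n(\lambda)]^T$ with $q_k(\lambda)=E[e^{ik\alpha_\lambda(0)}]$. Then $\mathbf q$ satisfies the ODE $$\frac{\beta}{4} \lambda\, \mathbf{q}'(\lambda) = \Big(i \frac{\beta}{4}\lambda \mathbf{B}_n +\mathbf{A}_n\Big) \mathbf{q}(\lambda)+\frac{n+1}{2} \mathbf{e}_n, \qquad \mathbf{q}(0)=\mathbf{f}_n.$$ The functions $\lambda\mapsto q_k(\lambda)$ can be extended to $\mathbb C$ as entire functions so that this ODE holds for all $\lambda\in\mathbb C$. With this extension, for all $\lambda\in\mathbb C$, $$\mathbf{q}(\lambda)=\sum_{j=0}^\infty \mathbf{s}_j \lambda^j,$$ where $\mathbf s_j\in\mathbb C^n$ are defined recursively by $$\mathbf{s}_0=-\frac{n+1}{2}\mathbf{A}_n^{-1}\mathbf{e}_n, \qquad \mathbf{s}_k=i \left(k \mathbf{I}-\tfrac{4}{\beta} \mathbf{A}_n\right)^{-1} \mathbf{B}_n \mathbf{s}_{k-1}, \qquad k\ge 1.$$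
   Context: $Z$ is a two-sided complex Brownian motion with independent standard real and imaginary parts. $\mathbf A_n$ is the tridiagonal and $\mathbf B_n$ the diagonal $n\times n$ matrix with nonzero entries $[\mathbf{A}_n]_{k,k}=-k^2$, $[\mathbf{A}_n]_{k,k-1}=\frac12 k(k+n)$, $[\mathbf{A}_n]_{k,k+1}=\frac12 k(k-n)$, $[\mathbf{B}_n]_{k,k}=k$. The vectors are $\mathbf e_n=[1,0,\dots,0]^T\in\mathbb R^n$ and $\mathbf f_n=[1,1,\dots,1]^T\in\mathbb R^n$. *)

(* Defs.v *)
From HB Require Import structures.
From mathcomp Require Import all_boot all_order all_algebra.
From mathcomp Require Import complex.
From mathcomp Require Import all_classical all_reals all_analysis.

Set Implicit Arguments.
Unset Strict Implicit.
Unset Printing Implicit Defensive.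

Import Order.TTheory GRing.Theory Num.Theory.
Import numFieldNormedType.Exports.

Local Open Scope classical_set_scope.
Local Open Scope ring_scope.
Local Open Scope complex_scope.

Section Complex.
Context {R : realType}.

Definition cis (x : R) : R[i] := cos x +i* sin x.

(* Differentiation of a complex-valued function of a real variable. *)
Definition cderivable (f : R -> R[i]) (x : R) : Prop :=
  derivable (fun y => complex.Re (f y)) x 1 /\
  derivable (fun y => complex.Im (f y)) x 1.

Definition cderive (f : R -> R[i]) (x : R) : R[i] :=
  derive1 (fun y => complex.Re (f y)) x +i* derive1 (fun y => complex.Im (f y)) x.

(* R[i]^o is R[i] as a normed space over itself, so that the derivative in the
   direction 1 is the complex derivative. *)
Definition entire (f : R[i] -> R[i]) : Prop :=
  forall z : R[i], derivable (f : R[i]^o -> R[i]^o) z 1.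

Definition holo_derive (f : R[i] -> R[i]) (z : R[i]) : R[i] :=
  'D_(1 : R[i]^o) (f : R[i]^o -> R[i]^o) z.

Definition cexpectation d (T : measurableType d) (P : probability T R)
    (X : T -> R[i]) : R[i] :=
  fine 'E_P[fun w => complex.Re (X w)] +i* fine 'E_P[fun w => complex.Im (X w)].

End Complex.

Section Stochastic.
Context {R : realType} {d : measure_display} {T : measurableType d}.
Variable P : probability T R.

Definition sigma_measurable (F : set (set T)) (X : T -> R) : Prop :=
  forall U : set R, measurable U -> F (X @^-1` U).

Definition increment (B : R -> T -> R) (s t : R) (w : T) : R := B t w - B s w.

(* Time ranges over all of R; B 0 = 0 only normalizes the process. *)
Definition two_sided_BM (B : R -> T -> R) : Prop :=
  [/\ forall u, measurable_fun setT (B u),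
      {ae P, forall w, B 0 w = 0},
      {ae P, forall w, continuous (fun u => B u w)},
      forall s t : R, s < t -> forall U : set R, measurable U ->
        P (increment B s t @^-1` U) = normal_prob 0 (Num.sqrt (t - s)) U
    & forall (N : nat) (tau : nat -> R) (U : nat -> set R),
        (forall j, (j < N)%N -> tau j < tau j.+1) ->
        (forall j, measurable (U j)) ->
        P (\bigcap_(j in `I_N) (increment B (tau j) (tau j.+1) @^-1` U j))
        = (\prod_(j < N) P (increment B (tau j) (tau j.+1) @^-1` U j))%E ].

Definition process_sigma (B : R -> T -> R) : set (set T) :=
  <<s [set A | exists (u : R) (U : set R), measurable U /\ A = B u @^-1` U] >>.

Definition independent_processes (X Y : R -> T -> R) : Prop :=
  forall A B : set T, process_sigma X A -> process_sigma Y B ->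
    P (A `&` B) = (P A * P B)%E.

Definition two_sided_complex_BM (Z : R -> T -> R[i]) : Prop :=
  let X u w := complex.Re (Z u w) in
  let Y u w := complex.Im (Z u w) in
  [/\ two_sided_BM X, two_sided_BM Y & independent_processes X Y].

(* For a two-sided Brownian motion the filtration must be generated by the
   increments before time t rather than by the values (as Z 0 = 0, the value
   Z t at t < 0 is a future increment). It is augmented by the null events. *)
Definition noise_filtration (Z : R -> T -> R[i]) (t : R) : set (set T) :=
  <<s [set A | exists r s : R, exists2 U : set R,
          [/\ r <= s, s <= t & measurable U] &
          A = (fun w => complex.Re (Z s w - Z r w)) @^-1` U \/
          A = (fun w => complex.Im (Z s w - Z r w)) @^-1` U]
      `|` [set A | measurable A /\ P A = 0%E] >>.

(* The process sum_j coef_j 1_[grid_j, grid_(j+1)) on [s, t]. *)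
Record simple_process (F : R -> set (set T)) (s t : R) := SimpleProcess {
  sp_size : nat;
  sp_grid : nat -> R;
  sp_coef : nat -> T -> R;
  sp_grid_start : sp_grid 0%N = s;
  sp_grid_end : sp_grid sp_size = t;
  sp_grid_incr : forall j, (j < sp_size)%N -> sp_grid j < sp_grid j.+1;
  sp_coef_meas : forall j, (j < sp_size)%N ->
    sigma_measurable (F (sp_grid j)) (sp_coef j);
  sp_coef_bounded : exists M : R, forall j w, (j < sp_size)%N ->
    `|sp_coef j w| <= M }.

Definition sp_val F s t (h : simple_process F s t) (u : R) (w : T) : R :=
  \sum_(j < sp_size h)
    sp_coef h j w * \1_(`[sp_grid h j, sp_grid h j.+1[) u.

Definition sp_integral F s t (h : simple_process F s t) (W : R -> T -> R)
    (w : T) : R :=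
  \sum_(j < sp_size h)
    sp_coef h j w * increment W (sp_grid h j) (sp_grid h j.+1) w.

Definition ito_integrand (F : R -> set (set T)) (s t : R) (H : R -> T -> R)
    : Prop :=
  [/\ measurable_fun (`[s, t] `*` setT) (fun p : R * T => H p.1 p.2),
      forall u, s <= u <= t -> sigma_measurable (F u) (H u)
    & (\int[P]_w \int[lebesgue_measure]_(u in `[s, t]) ((H u w) ^+ 2)%:E
       < +oo)%E ].

(* I is (a version of) the Ito integral of H against W over [s, t]: the L^2
   limit of the integrals of simple processes that approximate H in
   L^2(P x du). By the Ito isometry, I does not depend on the approximating
   sequence, up to almost sure equality. *)
Definition is_ito_integral (F : R -> set (set T)) (W : R -> T -> R) (s t : R)
    (H : R -> T -> R) (I : T -> R) : Prop :=
  [/\ ito_integrand F s t H, measurable_fun setT I &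
      exists h : nat -> simple_process F s t,
        (fun m => \int[P]_w \int[lebesgue_measure]_(u in `[s, t])
           ((sp_val (h m) u w - H u w) ^+ 2)%:E)%E @ \oo --> 0%E /\
        (fun m => 'E_P[fun w => ((sp_integral (h m) W w - I w) ^+ 2)%R])%E
          @ \oo --> 0%E ].

(* I = int_s^t Re (H dZ) = int_s^t Re H d(Re Z) - int_s^t Im H d(Im Z). *)
Definition is_Re_ito_integral (Z : R -> T -> R[i]) (s t : R)
    (H : R -> T -> R[i]) (I : T -> R) : Prop :=
  let F := noise_filtration Z in
  exists I1 I2 : T -> R,
    [/\ is_ito_integral F (fun u w => complex.Re (Z u w)) s t
          (fun u w => complex.Re (H u w)) I1,
        is_ito_integral F (fun u w => complex.Im (Z u w)) s t
          (fun u w => complex.Im (H u w)) I2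
      & forall w, I w = I1 w - I2 w ].

(* a is a strong solution (adapted to the filtration of the driving Z) of
     da = lambda (beta/4) e^(beta u/4) du + Re [(e^(-i a) - 1) (dZ - i n du)]
   on the whole line, with a(u) -> 0 as u -> -oo. *)
Definition is_strong_solution (Z : R -> T -> R[i]) (beta : R) (n : nat)
    (lambda : R) (a : R -> T -> R) : Prop :=
  [/\ forall u, sigma_measurable (noise_filtration Z u) (a u),
      {ae P, forall w, continuous (fun u => a u w)},
      forall s t : R, s < t -> exists I : T -> R,
        is_Re_ito_integral Z s t (fun u w => cis (- a u w) - 1) I /\
        {ae P, forall w, a t w - a s w =
          \int[lebesgue_measure]_(u in `[s, t])
             (lambda * (beta / 4) * expR (beta / 4 * u)
              + complex.Re ((cis (- a u w) - 1) * - (0 +i* n%:R)))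
          + I w}
    & {ae P, forall w, a u w @[u --> -oo] --> 0} ].

End Stochastic.

(* The ordinal i : 'I_n stands for the index k = i + 1 in {1, ..., n}. *)
Section Matrices.
Context {F : fieldType}.

Definition matA (n : nat) : 'M[F]_n :=
  \matrix_(i < n, j < n)
    let k : F := i.+1%:R in
    if j == i :> nat then - k ^+ 2
    else if j.+1 == i :> nat then 2^-1 * k * (k + n%:R)
    else if j == i.+1 :> nat then 2^-1 * k * (k - n%:R)
    else 0.

Definition matB (n : nat) : 'M[F]_n := diag_mx (\row_(i < n) i.+1%:R).

Definition vece (n : nat) : 'cV[F]_n := \col_(i < n) (i == 0%N :> nat)%:R.

Definition vecf (n : nat) : 'cV[F]_n := const_mx 1.

End Matrices.

Fixpoint svec {R : realType} (beta : R) (n : nat) (j : nat) : 'cV[R[i]]_n :=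
  if j is j'.+1 then
    (0 +i* 1) *: (invmx ((j'.+1%:R)%:M - (4 / beta)%:C *: matA n)
                  *m matB n *m svec beta n j')
  else - ((n.+1%:R / 2) *: (invmx (matA n) *m vece n)).

Definition qvec {R : realType} {d : measure_display} {T : measurableType d}
    (P : probability T R) (n : nat) (alpha : R -> R -> T -> R) (lambda : R)
    : 'cV[R[i]]_n :=
  \col_(k < n) cexpectation P (fun w => cis (k.+1%:R * alpha lambda 0 w)).

(* Main.v *)
(* Proof idea. Write a = alpha_lambda and mu(t) = lambda (beta/4) exp(beta t/4). One Euler step of length h
   for exp(i k a) has expected error O(h^(3/2)), because the increments of Z are independent of the past and
   the Ito isometry controls the replacement of the integrand by its value at the left end point. Hence
   y_k(t) = E exp(i k a(t)) is differentiable and y' = (i mu B + A) y + (n+1)/2 e; the equation closes at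
   k = n because A_(n,n+1) would be 0.
   With the weights w_k = C(2n, n+k)/k the matrix A is -diag(k^2) plus an antisymmetric part. This gives the
   invertibility of A and of j - c A for c >= 0, j >= 1, with the bound j |v| <= |(j - c A) v|, so that
   |s_j| <= C n^j/j! and the series Q is entire; it also shows that the difference of two solutions of the
   linear equation has energy decaying at least like exp(-2 t). Both y(t) and Q(lambda exp(beta t/4)) are
   bounded solutions near -oo, hence they coincide, and t = 0 gives q = Q. *)
Require Import Defs.
From HB Require Import structures.
From mathcomp Require Import all_boot all_order all_algebra.
From mathcomp Require Import complex ring lra.
From mathcomp Require Import all_classical all_reals all_analysis measurable_realfun.
Import Order.TTheory GRing.Theory Num.Theory.
Import numFieldNormedType.Exports.
Local Open Scope classical_set_scope.
Local Open Scope ring_scope.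
Local Open Scope complex_scope.

Set Implicit Arguments.
Unset Strict Implicit.
Unset Printing Implicit Defensive.

(** The Ito integrals are given only as L^2 limits of simple ones. For an integral I of H against W
    over [s, t] the proof uses two facts, both comparing I with H_s (W_t - W_s): a mean square
    bound, and E[zeta (I - H_s (W_t - W_s))] = 0 for bounded zeta known at time s. The second fact
    is decisive. The part of the increment left over by the Euler step has L^2 norm of order h only,
    so its product with the first derivative would spoil an error o(h), but that product has
    expectation zero. The other errors are quadratic in the leftover, pair it with a factor of order
    h^(1/2), are cubic in the Gaussian part, or come from the drift, of order h^(3/2) in L^1. All
    constants are uniform in s on half-lines (-oo, T0]. So the expansion, which only looks forward
    in time, can also be applied at a point to the left of s, which yields a two-sided derivative.
    The equation in lambda is singular at 0. The substitution lambda exp(beta t/4) moves the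
    singular point to t = -oo, where boundedness singles out the entire solution. *)

(** * Integrability classes and real-valued expectation *)

Section RealExpectation.
Context {R : realType} {d : measure_display} {T : measurableType d}.
Variable P : probability T R.
Implicit Types (f g : T -> R) (c M : R).

Definition L1 (f : T -> R) : Prop := P.-integrable setT (EFin \o f).
Definition L2 (f : T -> R) : Prop := measurable_fun setT f /\ L1 (fun w => f w ^+ 2).
(** Real-valued, with default 0 when the integral is infinite; integrability is therefore carried
    separately by [L1]. *)
Definition Ex (f : T -> R) : R := Rintegral P setT f.

Lemma L1_measurable f : L1 f -> measurable_fun setT f.
Proof. by move=> /integrableP[/measurable_EFinP]. Qed.

Lemma L1_le f g : measurable_fun setT f -> L1 g -> (forall w, `|f w| <= g w) -> L1 f.
Proof.
move=> mf ig fg; apply: (le_integrable _ _ _ ig) => //.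
  exact/measurable_EFinP.
by move=> w _; rewrite /= lee_fin (le_trans (fg w))// ler_norm.
Qed.

Lemma L1_cst c : L1 (fun=> c).
Proof. exact: finite_measure_integrable_cst. Qed.

Lemma L1_bounded f M : measurable_fun setT f -> (forall w, `|f w| <= M) -> L1 f.
Proof. by move=> mf fM; apply: (L1_le mf (L1_cst M)). Qed.

Lemma L1D f g : L1 f -> L1 g -> L1 (fun w => f w + g w).
Proof. by move=> fi gi; apply: (integrableD measurableT fi gi). Qed.

Lemma L1B f g : L1 f -> L1 g -> L1 (fun w => f w - g w).
Proof. by move=> fi gi; apply: (integrableB measurableT fi gi). Qed.

Lemma L1Z c f : L1 f -> L1 (fun w => c * f w).
Proof. by move=> fi; apply: (integrableZl measurableT c fi). Qed.

Lemma L1_abs f : L1 f -> L1 (fun w => `|f w|).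
Proof. by move=> fi; apply: (integrable_abse fi). Qed.

Lemma L1_bM f g M : measurable_fun setT f -> (forall w, `|f w| <= M) -> L1 g ->
  L1 (fun w => f w * g w).
Proof.
move=> mf fM ig; apply: (@L1_le _ (fun w => M * `|g w|)).
- exact: measurable_funM (L1_measurable ig).
- exact/L1Z/L1_abs.
- by move=> w; rewrite normrM ler_wpM2r.
Qed.

Lemma L1_L2M f g : L2 f -> L2 g -> L1 (fun w => f w * g w).
Proof.
move=> [mf if2] [mg ig2]; apply: (@L1_le _ (fun w => f w ^+ 2 + g w ^+ 2)).
- exact: measurable_funM.
- exact: L1D.
- move=> w; rewrite normrM -[f w ^+ 2]real_normK ?num_real//.
  rewrite -[g w ^+ 2]real_normK ?num_real//.
  by have := sqr_ge0 (`|f w| - `|g w|); nra.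
Qed.

Lemma L2_bounded f M : measurable_fun setT f -> (forall w, `|f w| <= M) -> L2 f.
Proof.
move=> mf fM; split => //; apply: (@L1_bounded _ (M ^+ 2)).
  exact: measurable_funX.
by move=> w; rewrite normrX lerXn2r ?nnegrE// (le_trans _ (fM w)).
Qed.

Lemma L2_cst c : L2 (fun=> c).
Proof. exact: (@L2_bounded _ `|c|). Qed.

Lemma L2_L1 f : L2 f -> L1 f.
Proof.
move=> f2; have := L1_L2M f2 (L2_cst 1).
by under eq_fun do rewrite mulr1.
Qed.

Lemma L2Z c f : L2 f -> L2 (fun w => c * f w).
Proof.
move=> [mf if2]; split; first exact: measurable_funM.
by under eq_fun do rewrite exprMn; exact: L1Z.
Qed.

Lemma L2D f g : L2 f -> L2 g -> L2 (fun w => f w + g w).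
Proof.
move=> f2 g2; split; first exact: measurable_funD f2.1 g2.1.
under eq_fun do rewrite sqrrD -mulr_natl.
apply: L1D g2.2; apply: L1D f2.2 _; apply: L1Z; exact: L1_L2M.
Qed.

Lemma L2B f g : L2 f -> L2 g -> L2 (fun w => f w - g w).
Proof.
move=> f2 g2; under eq_fun do rewrite -mulN1r; apply: L2D f2 _; exact: L2Z.
Qed.

Lemma L2_bM f g M : measurable_fun setT f -> (forall w, `|f w| <= M) -> L2 g ->
  L2 (fun w => f w * g w).
Proof.
move=> mf fM [mg ig2]; split; first exact: measurable_funM.
under eq_fun do rewrite exprMn; apply: (@L1_bM _ _ (M ^+ 2)) => //.
  exact: measurable_funX.
by move=> w; rewrite normrX lerXn2r ?nnegrE// (le_trans _ (fM w)).
Qed.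

Lemma ExD f g : L1 f -> L1 g -> Ex (fun w => f w + g w) = Ex f + Ex g.
Proof. by move=> fi gi; rewrite /Ex RintegralD. Qed.

Lemma ExB f g : L1 f -> L1 g -> Ex (fun w => f w - g w) = Ex f - Ex g.
Proof. by move=> fi gi; rewrite /Ex RintegralB. Qed.

Lemma ExZ c f : L1 f -> Ex (fun w => c * f w) = c * Ex f.
Proof. by move=> fi; rewrite /Ex RintegralZl. Qed.

Lemma Ex_cst c : Ex (fun=> c) = c.
Proof.
by rewrite /Ex /Rintegral; have := expectation_cst P c; rewrite unlock => ->.
Qed.

Lemma Ex_le f g : L1 f -> L1 g -> (forall w, f w <= g w) -> Ex f <= Ex g.
Proof. by move=> fi gi fg; apply: le_Rintegral. Qed.

Lemma Ex_ge0 f : (forall w, 0 <= f w) -> 0 <= Ex f.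
Proof. by move=> f0; apply: Rintegral_ge0. Qed.

Lemma Ex_abs f : L1 f -> `|Ex f| <= Ex (fun w => `|f w|).
Proof. by move=> fi; apply: le_normr_Rintegral. Qed.

Lemma Ex_abs_le f g : L1 f -> L1 g -> (forall w, `|f w| <= g w) -> `|Ex f| <= Ex g.
Proof.
move=> fi gi fg; apply: (le_trans (Ex_abs fi)); apply: Ex_le => //.
exact: L1_abs.
Qed.

Lemma Ex_EFin f : L1 f -> (\int[P]_w (f w)%:E)%E = (Ex f)%:E.
Proof. by move=> fi; rewrite /Ex /Rintegral fineK//; exact: integrable_fin_num. Qed.

Lemma Ex_ae f g : measurable_fun setT f -> measurable_fun setT g ->
  {ae P, forall w, f w = g w} -> Ex f = Ex g.
Proof.
move=> mf mg fg; rewrite /Ex /Rintegral; congr fine.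
apply: ae_eq_integral => //; [exact/measurable_EFinP|exact/measurable_EFinP|].
by apply: filterS fg => w -> _.
Qed.

(** [P] need not be complete, so measurability of [g] cannot be inferred from almost sure equality
    with [f]. *)
Lemma L1_ae f g : measurable_fun setT g ->
  {ae P, forall w, f w = g w} -> L1 f -> L1 g.
Proof.
move=> mg fg fi; have mf := L1_measurable fi.
apply/integrableP; split; first exact/measurable_EFinP.
have /integrableP[_] := fi; rewrite (ae_eq_integral (fun w => `|(g w)%:E|%E))//.
- by apply: measurableT_comp => //; exact/measurable_EFinP.
- by apply: measurableT_comp => //; exact/measurable_EFinP.
- by apply: filterS fg => w /= -> _.
Qed.

Lemma L1_ge0 f : measurable_fun setT f -> (forall w, 0 <= f w) ->
  (\int[P]_w (f w)%:E < +oo)%E -> L1 f.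
Proof.
move=> mf f0 fi; apply/integrableP; split; first exact/measurable_EFinP.
by under eq_integral do rewrite gee0_abs ?lee_fin//.
Qed.

End RealExpectation.

(** * Global Taylor bounds for sine and cosine *)

Section TrigonometricTaylor.
Context {R : realType}.
Implicit Types x y z th : R.

Lemma le_of_derive_bound (f df : R -> R) (M x : R) : 0 <= x -> f 0 = 0 ->
  (forall c : R, is_derive c 1 f (df c)) -> (forall c, 0 <= c <= x -> `|df c| <= M) ->
  `|f x| <= M * x.
Proof.
move=> x0 f0 fd dfM.
have cf : {within `[0, x], continuous f}.
  apply: continuous_subspaceT => c; apply: differentiable_continuous.
  by apply/derivable1_diffP; have /@ex_derive := fd c.
have [c] := MVT_segment x0 (fun c _ => fd c) cf.
rewrite in_itv /= => c0x; rewrite f0 !subr0 => ->.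
by rewrite normrM (ger0_norm x0) ler_wpM2r// dfM.
Qed.

Lemma normr_sin_le x : `|sin x| <= `|x|.
Proof.
have pos y : 0 <= y -> `|sin y| <= y.
  move=> y0; have := @le_of_derive_bound sin cos 1 y y0 (sin0 R) (fun c => is_derive_sin c).
  by rewrite mul1r; apply => c _; exact: cos_max.
have [x0|x0] := leP 0 x; first by rewrite (ger0_norm x0) pos.
by rewrite -normrN -sinN (ltr0_norm x0) pos// oppr_ge0 ltW.
Qed.

Lemma cos_half_angle x : cos x = 1 - 2 * sin (x / 2) ^+ 2.
Proof.
have -> : cos x = cos ((x / 2) *+ 2) by congr cos; rewrite -mulr_natr divfK.
by rewrite cos_mulr2n cos2sin2; ring.
Qed.

Lemma cos_sub1_le x : `|cos x - 1| <= x ^+ 2 / 2.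
Proof.
have -> : cos x - 1 = - (2 * sin (x / 2) ^+ 2) by rewrite cos_half_angle; ring.
rewrite normrN ger0_norm; last by rewrite mulr_ge0// sqr_ge0.
have : sin (x / 2) ^+ 2 <= (x / 2) ^+ 2.
  by rewrite -[sin _ ^+ 2]real_normK ?num_real// -[(x / 2) ^+ 2]real_normK ?num_real// lerXn2r ?nnegrE// normr_sin_le.
have -> : (x / 2) ^+ 2 = x ^+ 2 / 4 by field.
by lra.
Qed.

Lemma sin_subx_cube x : `|sin x - x| <= `|x| ^+ 3.
Proof.
have pos y : 0 <= y -> `|sin y - y| <= y ^+ 3.
  move=> y0; pose f z := sin z - z.
  have fd (c : R) : is_derive c 1 f (cos c - 1) by rewrite /f; exact: is_deriveB.
  have f0 : f 0 = 0 by rewrite /f sin0 subrr.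
  rewrite exprSr.
  apply: (@le_of_derive_bound f (fun c => cos c - 1) (y ^+ 2) y y0 f0 fd) => c /andP[c0 cy].
  apply: le_trans (cos_sub1_le c) _.
  have : c ^+ 2 <= y ^+ 2 by rewrite lerXn2r ?nnegrE.
  by have := sqr_ge0 c; lra.
have [x0|x0] := leP 0 x; first by rewrite (ger0_norm x0) pos.
have -> : sin x - x = - (sin (- x) - (- x)) by rewrite sinN; ring.
by rewrite normrN (ltr0_norm x0) pos// oppr_ge0 ltW.
Qed.

(** Bounds valid for every real x are needed because Gaussian increments are unbounded. The cubic
    bound serves for |x| <= 1, and |sin x| <= |x| beyond. *)
Lemma sin_subx_square x : `|sin x - x| <= 2 * x ^+ 2.
Proof.
rewrite -[x ^+ 2]real_normK ?num_real//; have xn := normr_ge0 x.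
have [x1|x1] := leP `|x| 1.
  apply: (le_trans (sin_subx_cube x)); rewrite exprS.
  have : `|x| * `|x| ^+ 2 <= 1 * `|x| ^+ 2 by rewrite ler_wpM2r// sqr_ge0.
  by have := sqr_ge0 `|x|; lra.
apply: (le_trans (ler_normB _ _)); have := normr_sin_le x; rewrite expr2.
have : `|x| * 1 <= `|x| * `|x| by rewrite ler_wpM2l// ltW.
by lra.
Qed.

Lemma cos_taylor2 x : `|cos x - 1 + x ^+ 2 / 2| <= `|x| ^+ 3.
Proof.
have [x2|x2] := leP `|x| 2.
  (* By the half-angle formula this is a difference of two squares, whose factor sin (x/2) - x/2 is
     cubic. *)
  have -> : cos x - 1 + x ^+ 2 / 2 = - (2 * (sin (x / 2) - x / 2) * (sin (x / 2) + x / 2)).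
    by rewrite cos_half_angle; field.
  rewrite normrN !normrM (ger0_norm (_ : 0 <= 2 :> R))//.
  have h1 := sin_subx_cube (x / 2).
  have h2 : `|sin (x / 2) + x / 2| <= `|x|.
    apply: (le_trans (ler_normD _ _)); have := normr_sin_le (x / 2).
    by rewrite normrM [`|2^-1|]ger0_norm//; lra.
  move: h1; rewrite normrM [`|2^-1|]ger0_norm// => h1.
  apply: (@le_trans _ _ (2 * (`|x| / 2) ^+ 3 * `|x|)).
    by apply: ler_pM => //; rewrite ler_pM2l.
  have -> : 2 * (`|x| / 2) ^+ 3 * `|x| = `|x| ^+ 3 * (`|x| / 4) by field.
  by rewrite ler_piMr ?exprn_ge0//; lra.
apply: (le_trans (ler_normD _ _)).
have : `|cos x - 1| <= 2.
  by apply: (le_trans (ler_normB _ _)); rewrite normr1; have := cos_max x; lra.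
rewrite [`|x ^+ 2 / 2|]ger0_norm ?divr_ge0 ?sqr_ge0// -[x ^+ 2]real_normK ?num_real// exprS.
have : 2 * 2 <= `|x| * `|x| by apply: ler_pM => //; exact: ltW.
have : 2 * `|x| ^+ 2 <= `|x| * `|x| ^+ 2 by rewrite ler_wpM2r ?sqr_ge0// ltW.
by rewrite expr2; lra.
Qed.

Let cos_sub1_lin x : `|cos x - 1| <= `|x|.
Proof.
have [x2|x2] := leP `|x| 2.
  apply: le_trans (cos_sub1_le x) _; rewrite -[x ^+ 2]real_normK ?num_real// expr2.
  have : `|x| * `|x| <= 2 * `|x| by rewrite ler_wpM2r.
  by lra.
by apply: (le_trans (ler_normB _ _)); rewrite normr1; have := cos_max x; lra.
Qed.

Let norm_comb x y a b : `|x| <= 1 -> `|y| <= 1 -> `|x * a - y * b| <= `|a| + `|b|.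
Proof.
move=> x1 y1; apply: (le_trans (ler_normB _ _)); rewrite !normrM.
by apply: lerD; rewrite ler_piMl.
Qed.

Lemma sin_lipschitz y z : `|sin (y + z) - sin y| <= 2 * `|z|.
Proof.
have -> : sin (y + z) - sin y = sin y * (cos z - 1) - (- cos y) * sin z.
  by rewrite sinD; ring.
apply: le_trans (norm_comb _ _ _ _) _; rewrite ?normrN ?cos_max ?sin_max//.
by have := cos_sub1_lin z; have := normr_sin_le z; lra.
Qed.

Lemma cos_lipschitz y z : `|cos (y + z) - cos y| <= 2 * `|z|.
Proof.
have -> : cos (y + z) - cos y = cos y * (cos z - 1) - sin y * sin z.
  by rewrite cosD; ring.
apply: le_trans (norm_comb _ _ _ _) _; rewrite ?cos_max ?sin_max//.
by have := cos_sub1_lin z; have := normr_sin_le z; lra.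
Qed.

(** These are the inputs of [euler_remainder_le]: a second-order expansion around the Euler point, a
    Lipschitz bound for the derivative, and a third-order expansion around the starting point. One
    crude constant serves all of them. *)
Lemma wave_taylor (k th : R) : 0 <= k -> exists2 B : R, 1 <= B &
  [/\ k <= B /\ k ^+ 2 <= B,
  forall y r, `|cos (k * (y + r) + th) - cos (k * y + th) - - k * sin (k * y + th) * r| <= B * r ^+ 2,
  forall y x, `|- k * sin (k * (y + x) + th) - - k * sin (k * y + th)| <= B * `|x| &
  forall y x, `|cos (k * (y + x) + th) - cos (k * y + th) - - k * sin (k * y + th) * x
      - - k ^+ 2 * cos (k * y + th) * (x ^+ 2 / 2)| <= B * `|x| ^+ 3].
Proof.
move=> k0; pose B := 3 * (1 + k + k ^+ 2 + k ^+ 3).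
have k2 := sqr_ge0 k; have k3 : 0 <= k ^+ 3 by exact: exprn_ge0.
exists B; first by rewrite /B; lra.
have kD y r : k * (y + r) + th = (k * y + th) + k * r by ring.
split; first by rewrite /B; split; lra.
- move=> y r; rewrite kD; set u := k * y + th; set z := k * r.
  have -> : cos (u + z) - cos u - - k * sin u * r = cos u * (cos z - 1) - sin u * (sin z - z).
    by rewrite cosD /z; ring.
  apply: le_trans (norm_comb _ _ _ _) _; rewrite ?cos_max ?sin_max//.
  have := cos_sub1_le z; have := sin_subx_square z.
  have -> : z ^+ 2 = k ^+ 2 * r ^+ 2 by rewrite /z; ring.
  have r2 := sqr_ge0 r.
  have : 0 <= (B - 3 * k ^+ 2) * r ^+ 2 by rewrite mulr_ge0// /B; lra.
  have : 0 <= k ^+ 2 * r ^+ 2 by rewrite mulr_ge0.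
  by lra.
- move=> y x; rewrite kD -mulrBr normrM normrN (ger0_norm k0).
  apply: (@le_trans _ _ (k * (2 * (k * `|x|)))).
    rewrite ler_wpM2l//; apply: (le_trans (sin_lipschitz _ _)).
    by rewrite normrM (ger0_norm k0).
  have -> : k * (2 * (k * `|x|)) = 2 * k ^+ 2 * `|x| by ring.
  by rewrite ler_wpM2r// /B; lra.
- move=> y x; rewrite kD; set u := k * y + th; set z := k * x.
  have -> : cos (u + z) - cos u - - k * sin u * x - - k ^+ 2 * cos u * (x ^+ 2 / 2) =
      cos u * (cos z - 1 + z ^+ 2 / 2) - sin u * (sin z - z).
    by rewrite cosD /z; field.
  apply: le_trans (norm_comb _ _ _ _) _; rewrite ?cos_max ?sin_max//.
  have := cos_taylor2 z; have := sin_subx_cube z.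
  have -> : `|z| ^+ 3 = k ^+ 3 * `|x| ^+ 3 by rewrite /z normrM (ger0_norm k0) exprMn.
  have : 0 <= (B - 2 * k ^+ 3) * `|x| ^+ 3 by rewrite mulr_ge0// /B; lra.
  by lra.
Qed.

End TrigonometricTaylor.

(** * Moments of a centred Gaussian variable *)

Section GaussianMoments.
Context {R : realType}.

(** The change of variables holds with the Radon-Nikodym derivative, which equals the Gaussian
    density almost everywhere because both have the same integral over every measurable set. *)
Lemma ge0_integral_normal_prob (m s : R) (f : R -> \bar R) :
  measurable_fun setT f -> (forall x, 0 <= f x)%E ->
  (\int[normal_prob m s]_x f x = \int[lebesgue_measure]_x (f x * (normal_pdf m s x)%:E))%E.
Proof.
move=> mf f0; have dom := normal_prob_dominates m s.
rewrite -(Radon_Nikodym_SigmaFinite.change_of_variables dom)//.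
have mRN := measurable_int _ (Radon_Nikodym_SigmaFinite.f_integrable dom).
have mpdf : measurable_fun [set: R] (fun x => (normal_pdf m s x)%:E).
  by apply/measurable_EFinP; exact: measurable_normal_pdf.
apply: ae_eq_integral => //.
- exact: emeasurable_funM.
- exact: emeasurable_funM.
- apply: ae_eqe_mul2l; apply: integral_ae_eq => //.
  + exact: Radon_Nikodym_SigmaFinite.f_integrable.
  + by move=> A _ mA; rewrite -(Radon_Nikodym_SigmaFinite.f_integral dom).
Qed.

(* Jensen, 1 + t E X <= E exp(t X), evaluated at a small multiple t of m; likewise in [second_moment_eq]
   with exp((1 - u^2) X^2 / (2 s^2)), whose expectation is 1 / u. *)
Lemma first_moment_eq0 (m s : R) : 0 <= s ->
  (forall t : R, 1 + t * m <= expR (t ^+ 2 * s)) -> m = 0.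
Proof.
move=> s0 H; pose c := (4 * (1 + s) * (1 + m ^+ 2))^-1.
have m20 := sqr_ge0 m.
have c0 : 0 < c by rewrite invr_gt0; nra.
have cD : c * (4 * (1 + s) * (1 + m ^+ 2)) = 1 by rewrite mulVf//; nra.
have cs : c * s <= 1 / 4.
  have : c * s <= c * ((1 + s) * (1 + m ^+ 2)) by rewrite ler_pM2l//; nra.
  lra.
have cm : c * m ^+ 2 <= 1 / 4.
  have : c * m ^+ 2 <= c * ((1 + s) * (1 + m ^+ 2)) by rewrite ler_pM2l//; nra.
  lra.
have cs0 : 0 <= c * s by rewrite mulr_ge0// ltW.
have cm0 : 0 <= c * m ^+ 2 by rewrite mulr_ge0// ltW.
have y1 : (c * m) ^+ 2 * s <= 1 / 16.
  have -> : (c * m) ^+ 2 * s = (c * m ^+ 2) * (c * s) by ring.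
  by apply: (@le_trans _ _ (1 / 4 * (1 / 4))); [exact: ler_pM|lra].
have y0 : 0 <= (c * m) ^+ 2 * s by rewrite mulr_ge0// sqr_ge0.
have := H (c * m); set y := _ ^+ 2 * s in y0 y1 * => Hc.
have := expR_ge1Dx (- y); rewrite expRN => e1.
have e2 : expR y * (1 - y) <= 1.
  by rewrite -ler_pdivlMl ?expR_gt0// mulr1.
have e3 : (1 + c * m * m) * (1 - y) <= 1.
  by apply: le_trans e2; rewrite ler_wpM2r//; lra.
have e4 : c * m ^+ 2 * (1 - c * s - c * s * (c * m ^+ 2)) <= 0.
  have -> : c * m ^+ 2 * (1 - c * s - c * s * (c * m ^+ 2)) = (1 + c * m * m) * (1 - y) - 1.
    by rewrite /y; ring.
  by rewrite subr_le0.
have e5 : 0 < 1 - c * s - c * s * (c * m ^+ 2).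
  have : c * s * (c * m ^+ 2) <= 1 / 4 * (1 / 4) by exact: ler_pM.
  lra.
have e6 : c * m ^+ 2 <= 0 by rewrite -(pmulr_lle0 _ e5).
apply/eqP; rewrite -sqrf_eq0; apply/eqP/le_anti; rewrite m20 andbT.
by rewrite -(pmulr_rle0 _ c0).
Qed.

Lemma second_moment_eq (m : R) : 0 <= m ->
  (forall u : R, 0 < u -> 1 + (1 - u ^+ 2) * m <= u^-1) -> 2 * m = 1.
Proof.
move=> m0 H.
(* The hypothesis is an equality at u = 1. After factoring out 1 - u, points u < 1 give m u (1 + u)
   <= 1 and points u > 1 give the reverse. An explicit u on the suitable side replaces the limit u
   -> 1. *)
have Hu (u : R) : 0 < u -> (1 - u) * (m * u * (1 + u) - 1) <= 0.
  move=> u0; have := H u u0; rewrite -(ler_pM2l u0) mulfV ?gt_eqF// => Hu.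
  have -> : (1 - u) * (m * u * (1 + u) - 1) = u * (1 + (1 - u ^+ 2) * m) - 1 by ring.
  by rewrite subr_le0.
apply/eqP; rewrite eq_le !leNgt; apply/andP; split; apply/negP => h.
- pose v := (2 * m)^-1.
  have v0 : 0 < v by rewrite invr_gt0; lra.
  have vm : v * (2 * m) = 1 by rewrite mulVf//; lra.
  have v1 : v < 1 by rewrite invf_lt1; lra.
  have := Hu ((1 + v) / 2) ltac:(lra); set u := (1 + v) / 2 => H1.
  have u1 : 0 < 1 - u by rewrite /u; lra.
  move: H1; rewrite pmulr_rle0// => H1.
  have u2 : v <= u ^+ 2.
    by rewrite /u; have := sqr_ge0 (1 - v); rewrite !expr2; nra.
  have : m * u * (1 + u) > 2 * m * u ^+ 2.
    rewrite -subr_gt0 (_ : _ - _ = m * u * (1 - u)); last by ring.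
    by rewrite !mulr_gt0//; [lra|rewrite /u; lra].
  have : 2 * m * v <= 2 * m * u ^+ 2 by rewrite ler_pM2l//; lra.
  lra.
- pose D := 1 + 2 * m; have D0 : 0 < D by rewrite /D; lra.
  pose u := 2 / D.
  have uD : u * D = 2 by rewrite /u divfK// gt_eqF.
  have u1 : 1 < u by rewrite /u ltr_pdivlMr// /D; lra.
  have := Hu u ltac:(lra); rewrite nmulr_rle0; last by lra.
  have u2 : 2 * m * u ^+ 2 <= 1.
    have : 2 * m * (u * D) ^+ 2 <= D ^+ 2.
      by rewrite uD /D; have := sqr_ge0 (1 - 2 * m); rewrite !expr2; lra.
    by rewrite exprMn mulrA -ler_pdivlMr ?exprn_gt0// divff// gt_eqF// exprn_gt0.
  have : m * u * (1 - u) <= 0.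
    by apply: mulr_ge0_le0; [apply: mulr_ge0; lra|lra].
  move=> h1; rewrite subr_ge0 => h2.
  have h3 : 2 * m * u ^+ 2 = 1 by apply/le_anti; rewrite u2 /=; nra.
  have : (1 - 2 * m) ^+ 2 = 0.
    have : 2 * m * (u * D) ^+ 2 = D ^+ 2 by rewrite exprMn mulrA h3 mul1r.
    by rewrite uD /D => h4; rewrite !expr2 in h4 *; lra.
  by move/eqP; rewrite sqrf_eq0; lra.
Qed.

Context {d : measure_display} {T : measurableType d}.
Variables (P : probability T R) (X : T -> R) (s : R).
Hypotheses (s0 : 0 < s) (mX : measurable_fun setT X).
Hypothesis lawX : forall U : set R, measurable U -> P (X @^-1` U) = normal_prob 0 s U.

Let ge0_expectation_normal (f : R -> R) : measurable_fun setT f -> (forall x, 0 <= f x) ->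
  (\int[P]_w (f (X w))%:E = \int[lebesgue_measure]_x (f x * normal_pdf 0 s x)%:E)%E.
Proof.
move=> mf f0; have mX' : @measurable_fun _ _ T (measurableTypeR R) setT X by exact: mX.
pose X' : {mfun T >-> measurableTypeR R} := @mfun_Sub _ _ T (measurableTypeR R) X (mem_set mX').
have mfE : measurable_fun setT (EFin \o f) by exact/measurable_EFinP.
transitivity (\int[distribution P X']_x (f x)%:E)%E.
  by rewrite ge0_integral_distribution// => x; rewrite lee_fin.
rewrite -(@eq_measure_integral _ _ _ _ (distribution P X') (normal_prob 0 s)); last first.
  by move=> A mA _; exact/esym/lawX.
by rewrite ge0_integral_normal_prob// => x; rewrite lee_fin.
Qed.

Let normal_pdfE0 (m r x : R) : 0 < r -> normal_pdf m r x = normal_peak r * expR (- (x - m) ^+ 2 / (r ^+ 2 *+ 2)).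
Proof. by move=> r0; rewrite normal_pdfE ?gt_eqF. Qed.

(** Completing the square: exp(t x) times the density is a constant multiple of the density with
    mean t s^2. *)
Lemma normal_exp_moment (t : R) : L1 P (fun w => expR (t * X w)) /\
  Ex P (fun w => expR (t * X w)) = expR (t ^+ 2 * (s ^+ 2 / 2)).
Proof.
have mf : measurable_fun setT (fun x : R => expR (t * x)).
  by apply: measurableT_comp => //; exact: measurable_funM.
have E : (\int[P]_w (expR (t * X w))%:E = (expR (t ^+ 2 * (s ^+ 2 / 2)))%:E)%E.
  rewrite (ge0_expectation_normal mf); last by move=> x; exact: expR_ge0.
  transitivity (\int[lebesgue_measure]_x ((expR (t ^+ 2 * (s ^+ 2 / 2)))%:E * (normal_pdf (t * s ^+ 2) s x)%:E))%E.
    apply: eq_integral => x _; rewrite -EFinM; congr EFin.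
    rewrite !normal_pdfE0// mulrCA [RHS]mulrCA -!expRD; congr (_ * expR _).
    by field; rewrite gt_eqF.
  rewrite ge0_integralZl//.
  - by rewrite integral_normal_pdf mule1.
  - by apply/measurable_EFinP; exact: measurable_normal_pdf.
  - by move=> x _; rewrite lee_fin normal_pdf_ge0.
have i1 : L1 P (fun w => expR (t * X w)).
  apply: L1_ge0 => [|w|]; [|exact: expR_ge0|by rewrite E ltry].
  exact: (measurableT_comp mf mX).
by split => //; apply: EFin_inj; rewrite -Ex_EFin.
Qed.

(** The exponential factor changes the standard deviation from s to s/u; the quotient of the two
    normalising constants is 1/u. *)
Lemma normal_exp_square_moment (u : R) : 0 < u ->
  L1 P (fun w => expR ((1 - u ^+ 2) * (X w ^+ 2 / (s ^+ 2 *+ 2)))) /\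
  Ex P (fun w => expR ((1 - u ^+ 2) * (X w ^+ 2 / (s ^+ 2 *+ 2)))) = u^-1.
Proof.
move=> u0.
have mf : measurable_fun setT (fun x : R => expR ((1 - u ^+ 2) * (x ^+ 2 / (s ^+ 2 *+ 2)))).
  apply: measurableT_comp => //; apply: measurable_funM => //.
  by apply: measurable_funM => //; exact: measurable_funX.
have peakE : normal_peak s = u^-1 * normal_peak (s / u).
  rewrite /normal_peak.
  have -> : (s / u) ^+ 2 * pi *+ 2 = (s ^+ 2 * pi *+ 2) * u^-1 ^+ 2.
    by field; rewrite gt_eqF.
  rewrite sqrtrM; last by rewrite mulrn_wge0// mulr_ge0 ?sqr_ge0// pi_ge0.
  rewrite sqrtr_sqr gtr0_norm ?invr_gt0// invfM invrK mulrCA mulVf ?mulr1//.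
  by rewrite gt_eqF.
have E : (\int[P]_w (expR ((1 - u ^+ 2) * (X w ^+ 2 / (s ^+ 2 *+ 2))))%:E = (u^-1)%:E)%E.
  rewrite (ge0_expectation_normal mf); last by move=> x; exact: expR_ge0.
  transitivity (\int[lebesgue_measure]_x ((u^-1)%:E * (normal_pdf 0 (s / u) x)%:E))%E.
    apply: eq_integral => x _; rewrite -EFinM; congr EFin.
    rewrite (normal_pdfE0 _ _ s0) (normal_pdfE0 _ _ (divr_gt0 s0 u0)) mulrCA -expRD [RHS]mulrA -peakE.
    congr (_ * expR _).
    by rewrite subr0; field; rewrite !gt_eqF.
  rewrite ge0_integralZl//.
  - by rewrite integral_normal_pdf mule1.
  - by apply/measurable_EFinP; exact: measurable_normal_pdf.
  - by move=> x _; rewrite lee_fin normal_pdf_ge0.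
  - by rewrite lee_fin invr_ge0 ltW.
have i1 : L1 P (fun w => expR ((1 - u ^+ 2) * (X w ^+ 2 / (s ^+ 2 *+ 2)))).
  apply: L1_ge0 => [|w|]; [|exact: expR_ge0|by rewrite E ltry].
  exact: (measurableT_comp mf mX).
by split => //; apply: EFin_inj; rewrite -Ex_EFin.
Qed.

Lemma normal_moments : [/\ L1 P (fun w => X w ^+ 4), Ex P X = 0,
  Ex P (fun w => X w ^+ 2) = s ^+ 2 & Ex P (fun w => X w ^+ 4) <= 32 * s ^+ 4].
Proof.
have s20 : 0 < s ^+ 2 by rewrite exprn_gt0.
(* For u = 1/2 the expectation is 2 and the exponent is y = 3 X^2 / (8 s^2). From y^2 / 2 <= exp y
   follows X^4 <= 16 s^4 exp y, whence the constant 32. *)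
have [i4 E4] := normal_exp_square_moment (u := 1 / 2) ltac:(lra).
set g := (fun w => expR _) in i4 E4.
have b4 w : X w ^+ 4 <= 16 * s ^+ 4 * g w.
  rewrite /g; set y := (1 - _) * _.
  have yE : y * (8 * s ^+ 2) = 3 * X w ^+ 2 by rewrite /y; field; rewrite gt_eqF.
  have y0 : 0 <= y.
    rewrite -(pmulr_lge0 _ (_ : 0 < 8 * s ^+ 2)); last by rewrite mulr_gt0.
    by rewrite yE mulr_ge0// sqr_ge0.
  have ey : y ^+ 2 / 2 <= expR y.
    by have := expR_ge1Dxn 1 y0; rewrite -[2`!]/2%N; lra.
  have s4 : 0 < s ^+ 4 by rewrite exprn_gt0.
  have : (y * (8 * s ^+ 2)) ^+ 2 = 9 * X w ^+ 4 by rewrite yE; ring.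
  have -> : (y * (8 * s ^+ 2)) ^+ 2 = 128 * s ^+ 4 * (y ^+ 2 / 2) by field.
  move=> H; have : s ^+ 4 * (y ^+ 2 / 2) <= s ^+ 4 * expR y by rewrite ler_pM2l.
  have : 0 < s ^+ 4 * expR y by rewrite mulr_gt0// expR_gt0.
  lra.
have mX2 : measurable_fun setT (fun w => X w ^+ 2) by exact: measurable_funX.
have mX4 : measurable_fun setT (fun w => X w ^+ 4) by exact: measurable_funX.
have L4 : L1 P (fun w => X w ^+ 4).
  apply: (L1_le mX4 (L1Z (16 * s ^+ 4) i4)) => w.
  by rewrite ger0_norm ?exprn_even_ge0// b4.
have L2' : L1 P (fun w => X w ^+ 2).
  apply: (L1_le mX2 (L1D (L1_cst P 1) L4)) => w.
  rewrite ger0_norm ?sqr_ge0//.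
  rewrite -[X w ^+ 4]/(X w ^+ (2 * 2)) exprM; set z := X w ^+ 2.
  by have := sqr_ge0 (z - 1); have := sqr_ge0 z; rewrite !expr2; lra.
have L1X : L1 P X by apply: L2_L1.
split => //.
- apply: (@first_moment_eq0 _ (s ^+ 2 / 2)); first by rewrite divr_ge0// ltW.
  move=> t; have [it <-] := normal_exp_moment t.
  rewrite -ExZ// -[X in X + _](Ex_cst P) -ExD//; [|exact: L1_cst|exact: L1Z].
  by apply: Ex_le => // [|w]; [apply: L1D; [exact: L1_cst|exact: L1Z]|exact: expR_ge1Dx].
- have [] : 2 * (Ex P (fun w => X w ^+ 2) / (s ^+ 2 *+ 2)) = 1; last first.
    by move/(congr1 ( *%R^~ (s ^+ 2))); rewrite mul1r => <-; field; rewrite gt_eqF.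
  apply: second_moment_eq.
    by rewrite divr_ge0 ?mulrn_wge0 ?(ltW s20)//; apply: Ex_ge0 => w; exact: sqr_ge0.
  move=> u u0; have [iu <-] := normal_exp_square_moment u0.
  rewrite [_ / (s ^+ 2 *+ 2)]mulrC mulrA -ExZ// -[X in X + _](Ex_cst P) -ExD//; [|exact: L1_cst|exact: L1Z].
  apply: Ex_le => // [|w]; first by apply: L1D; [exact: L1_cst|exact: L1Z].
  by apply: le_trans (expR_ge1Dx _); rewrite lerD2l -mulrA [_^-1 * _]mulrC.
- apply: (@le_trans _ _ (Ex P (fun w => 16 * s ^+ 4 * g w))).
    by apply: Ex_le => //; exact: L1Z.
  by rewrite ExZ// E4 div1r invrK; lra.
Qed.

End GaussianMoments.

(** * Measurability with respect to a generated sigma-algebra *)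

Section SigmaMeasurable.
Context {R : realType} {d : measure_display} {T : measurableType d}.
Implicit Types (G H : set (set T)) (X Y : T -> R).

(** Viewing the sigma-algebra as the structure of [g_sigma_algebraType] gives adapted variables all
    closure properties of measurable functions. *)
Lemma sigma_measurableP G X :
  sigma_measurable <<s G>> X <-> measurable_fun setT (X : g_sigma_algebraType G -> R).
Proof.
split=> [GX _ U mU|GX U mU]; first by rewrite setTI; exact: GX.
by have := GX measurableT U mU; rewrite setTI.
Qed.

Lemma g_sigma_algebra_sub G H : G `<=` <<s H>> -> <<s G>> `<=` <<s H>>.
Proof. by move=> GH; apply: smallest_sub => //; exact: smallest_sigma_algebra. Qed.

Lemma g_sigma_algebra_measurable G : G `<=` measurable -> <<s G>> `<=` measurable.
Proof. by move=> GH; apply: smallest_sub => //; exact: sigma_algebra_measurable. Qed.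

Lemma sigma_measurable_sub (F F' : set (set T)) X :
  F `<=` F' -> sigma_measurable F X -> sigma_measurable F' X.
Proof. by move=> FF' FX U mU; exact/FF'/FX. Qed.

Lemma sigma_measurable_fun (F : set (set T)) X :
  F `<=` measurable -> sigma_measurable F X -> measurable_fun setT X.
Proof. by move=> FF' FX _ U mU; rewrite setTI; exact/FF'/FX. Qed.

Lemma sigma_measurable_cst G c : sigma_measurable <<s G>> (fun=> c : R).
Proof. by apply/sigma_measurableP; exact: measurable_cst. Qed.

Lemma sigma_measurableD G X Y : sigma_measurable <<s G>> X -> sigma_measurable <<s G>> Y ->
  sigma_measurable <<s G>> (fun w => X w + Y w).
Proof.
by move=> /sigma_measurableP GX /sigma_measurableP GY; apply/sigma_measurableP; exact: measurable_funD.
Qed.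

Lemma sigma_measurableB G X Y : sigma_measurable <<s G>> X -> sigma_measurable <<s G>> Y ->
  sigma_measurable <<s G>> (fun w => X w - Y w).
Proof.
by move=> /sigma_measurableP GX /sigma_measurableP GY; apply/sigma_measurableP; exact: measurable_funB.
Qed.

Lemma sigma_measurableM G X Y : sigma_measurable <<s G>> X -> sigma_measurable <<s G>> Y ->
  sigma_measurable <<s G>> (fun w => X w * Y w).
Proof.
by move=> /sigma_measurableP GX /sigma_measurableP GY; apply/sigma_measurableP; exact: measurable_funM.
Qed.

Lemma sigma_measurable_comp G X (f : R -> R) : measurable_fun setT f ->
  sigma_measurable <<s G>> X -> sigma_measurable <<s G>> (fun w => f (X w)).
Proof.
move=> mf /sigma_measurableP GX; apply/sigma_measurableP.
exact: (measurableT_comp mf GX).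
Qed.

End SigmaMeasurable.

(** * Independence of events and of random variables *)

Section Independence.
Context {R : realType} {d : measure_display} {T : measurableType d}.
Variable P : probability T R.
Implicit Types (X Y : T -> R).

(** The finite measures P(A n C) and P(A) P(C), as functions of A, agree on a pi-system containing
    the whole space, hence on the sigma-algebra it generates. *)
Lemma indep_sigma_algebra (G : set (set T)) (C : set T) :
  setI_closed G -> G setT -> G `<=` measurable -> measurable C ->
  (forall A, G A -> P (A `&` C) = (P A * P C)%E) ->
  forall A, <<s G>> A -> P (A `&` C) = (P A * P C)%E.
Proof.
move=> GI GT Gm mC GC A GA.
have PC0 : 0 <= fine (P C) by rewrite fine_ge0.
have PCf : P C \is a fin_num by exact: fin_num_measure.
have mscaleE B : mscale (NngNum PC0) P B = (P B * P C)%E.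
  by rewrite /mscale /= fineK// muleC.
rewrite -mscaleE.
apply: (@g_sigma_algebra_measure_unique _ R T G Gm (fun=> setT) (fun=> GT) _
  (mrestr P mC) (mscale (NngNum PC0) P) GI) => //.
- by rewrite bigcup_const.
- by move=> B GB; apply: etrans (esym (mscaleE B)); exact: GC.
- move=> _; apply: (@le_lt_trans _ _ 1%E); last exact: ltry.
  exact/probability_le1/measurableI.
Qed.

Definition indep_rv X Y := forall U V : set R, measurable U -> measurable V ->
  P (X @^-1` U `&` Y @^-1` V) = (P (X @^-1` U) * P (Y @^-1` V))%E.

(** The joint law and the product of the laws agree on rectangles, so they coincide. Tonelli on
    absolute values gives integrability, then Fubini gives the value. *)
Lemma indep_rv_expectation X Y : indep_rv X Y -> L1 P X -> L1 P Y ->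
  L1 P (fun w => X w * Y w) /\ Ex P (fun w => X w * Y w) = Ex P X * Ex P Y.
Proof.
move=> iXY L1X L1Y.
have mX := L1_measurable L1X; have mY := L1_measurable L1Y.
pose X' : {mfun T >-> R} := mfun_Sub (mem_set mX).
pose Y' : {mfun T >-> R} := mfun_Sub (mem_set mY).
have mXY : measurable_fun setT (fun w => (X w, Y w)) by exact: measurable_fun_pair.
pose Z : {mfun T >-> (R * R)%type} := mfun_Sub (mem_set mXY).
pose mu := distribution P X'; pose nu := distribution P Y'.
have E A : measurable A -> (mu \x nu)%E A = distribution P Z A.
  apply: product_measure_unique => U V mU mV.
  by rewrite /distribution /pushforward /= -iXY.
have mM : measurable_fun setT (fun z : (R * R)%type => z.1 * z.2) by exact: measurable_funM.
have mabs : measurable_fun [set: R] (fun y : R => `|y|%:E).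
  by apply/measurable_EFinP; exact: normr_measurable.
have absE : (\int[P]_w `|(X w * Y w)%:E| = (Ex P (fun w => `|X w|))%:E * (Ex P (fun w => `|Y w|))%:E)%E.
  transitivity (\int[distribution P Z]_z `|(z.1 * z.2)%:E|)%E.
    rewrite ge0_integral_distribution//.
    by apply: measurableT_comp => //; exact/measurable_EFinP.
  rewrite -(@eq_measure_integral _ _ _ _ _ (mu \x nu)%E)//; last first.
    by move=> A mA _; exact: E.
  rewrite fubini_tonelli1//; last first.
    by apply: measurableT_comp => //; exact/measurable_EFinP.
  rewrite /fubini_F.
  have inner x : (\int[nu]_y `|(x * y)%:E| = `|x|%:E * (Ex P (fun w => `|Y w|))%:E)%E.
    rewrite ge0_integral_distribution//; last first.
      apply: measurableT_comp => //; apply/measurable_EFinP.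
      exact: measurable_funM.
    under eq_integral do rewrite /= normrM EFinM.
    rewrite ge0_integralZl//; last first.
      by apply/measurable_EFinP; exact: measurableT_comp.
    by congr (_ * _)%E; rewrite Ex_EFin//; exact: L1_abs.
  under eq_integral do rewrite inner.
  rewrite ge0_integralZr//.
  - rewrite ge0_integral_distribution//.
    by rewrite /= -(Ex_EFin (L1_abs L1X)).
  - by rewrite lee_fin; exact: Ex_ge0.
have L1XY : L1 P (fun w => X w * Y w).
  apply/integrableP; split; first exact/measurable_EFinP/measurable_funM.
  by rewrite /= absE -EFinM ltry.
split => //; apply: EFin_inj; rewrite EFinM -!Ex_EFin//.
have iZ : (mu \x nu)%E.-integrable setT (fun z => (z.1 * z.2)%:E).
  apply/integrableP; split; first exact/measurable_EFinP.
  rewrite -(@eq_measure_integral _ _ _ _ _ (distribution P Z)); last first.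
    by move=> A mA _; exact/esym/E.
  rewrite ge0_integral_distribution//; last first.
    by apply: measurableT_comp => //; exact/measurable_EFinP.
  by rewrite /= absE -EFinM ltry.
transitivity (\int[distribution P Z]_z (z.1 * z.2)%:E)%E.
  by rewrite integral_distribution//; exact/measurable_EFinP.
rewrite -(@eq_measure_integral _ _ _ _ _ (mu \x nu)%E)//; last first.
  by move=> A mA _; exact: E.
rewrite -integral12_prod_meas1// /fubini_F.
have inner x : (\int[nu]_y (x * y)%:E = x%:E * \int[P]_w (Y w)%:E)%E.
  rewrite integral_distribution//; last 2 first.
  - exact/measurable_EFinP/measurable_funM.
  - exact: (L1Z x L1Y).
  under eq_integral do rewrite /= EFinM.
  by rewrite integralZl.
under eq_integral do rewrite inner.
rewrite (Ex_EFin L1Y) integralZr//; last first.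
  by apply: (@integrable_pushforward _ _ _ _ _ _ mX) => //; exact: L1X.
congr (_ * _)%E; rewrite integral_distribution//.
Qed.

End Independence.

(** * Independence of a Brownian increment from the past *)

Section BrownianIndependence.
Context {R : realType} {d : measure_display} {T : measurableType d}.
Variable P : probability T R.
Implicit Types (B X Y : R -> T -> R) (S : seq R).

(** Only finitely many times are involved, so that one grid contains them all: [two_sided_BM] gives
    independence along finite grids. *)
Definition incr_sigma B S : set (set T) :=
  <<s [set A | exists r v (U : set R), [/\ r \in S, v \in S, measurable U &
         A = increment B r v @^-1` U]] >>.

(** The pi-system on which independence along the grid is a product formula. *)
Definition grid_rect B (tau : nat -> R) (N : nat) : set (set T) :=
  [set A | exists2 U : nat -> set R, (forall j, measurable (U j)) &
     A = \bigcap_(j in `I_N) (increment B (tau j) (tau j.+1) @^-1` U j)].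

Lemma incr_sigma_sub B S S' : {subset S <= S'} -> incr_sigma B S `<=` incr_sigma B S'.
Proof.
move=> SS'; apply: g_sigma_algebra_sub => A [r [v [U [rS vS mU ->]]]].
by apply: sub_gen_smallest; exists r, v, U; split => //; exact: SS'.
Qed.

Lemma increment_measurable B s t : two_sided_BM P B -> measurable_fun setT (increment B s t).
Proof. by case=> mB _ _ _ _; exact: measurable_funB. Qed.

Lemma incr_sigma_measurable B S : two_sided_BM P B -> incr_sigma B S `<=` measurable.
Proof.
move=> BM; apply: g_sigma_algebra_measurable => _ [r [v [U [_ _ mU ->]]]].
by rewrite -[_ @^-1` _]setTI; exact: increment_measurable.
Qed.

Lemma incr_sigma_process B S : incr_sigma B S `<=` process_sigma B.
Proof.
apply: g_sigma_algebra_sub => _ [r [v [U [_ _ mU ->]]]].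
have Bm u : sigma_measurable (process_sigma B) (B u).
  by move=> V mV; apply: sub_gen_smallest; exists u, V.
exact: (sigma_measurableB (Bm v) (Bm r)).
Qed.

Lemma grid_rect_setI B tau N : setI_closed (grid_rect B tau N).
Proof.
move=> _ _ [U mU ->] [V mV ->]; exists (fun j => U j `&` V j).
  by move=> j; exact: measurableI.
apply/seteqP; split=> [w [UA VA] j jN|w UV]; first by split; [exact: UA|exact: VA].
by split=> j jN; have [] := UV j jN.
Qed.

Lemma grid_rect_setT B tau N : grid_rect B tau N setT.
Proof. by exists (fun=> setT) => //; apply/seteqP; split. Qed.

Lemma grid_rect_measurable B tau N : two_sided_BM P B -> grid_rect B tau N `<=` measurable.
Proof.
move=> BM _ [U mU ->]; apply: bigcap_measurableType => j _.
by rewrite -[_ @^-1` _]setTI; exact: increment_measurable.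
Qed.

(** An increment between two grid points is a difference of two increments from [tau 0], each a
    telescoping sum of grid steps. *)
Lemma incr_sigma_grid B S tau N :
  (forall r, r \in S -> exists2 i, (i <= N)%N & r = tau i) ->
  incr_sigma B S `<=` <<s grid_rect B tau N >>.
Proof.
move=> Stau; apply: g_sigma_algebra_sub => _ [r [v [U [rS vS mU ->]]]].
have step k : (k < N)%N ->
    sigma_measurable <<s grid_rect B tau N >> (increment B (tau k) (tau k.+1)).
  move=> kN V mV; apply: sub_gen_smallest; exists (fun j => if j == k then V else setT).
    by move=> j; case: ifP.
  apply/seteqP; split=> [w Vw j jN|w Vw] /=; first by case: eqP => [->|].
  by have := Vw k kN; rewrite /= eqxx.
have from0 k : (k <= N)%N ->
    sigma_measurable <<s grid_rect B tau N >> (increment B (tau 0%N) (tau k)).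
  elim: k => [_|k IH kN].
    have -> : increment B (tau 0%N) (tau 0%N) = fun=> 0.
      by apply/funext => w; rewrite /increment subrr.
    exact: sigma_measurable_cst.
  have -> : increment B (tau 0%N) (tau k.+1) =
      fun w => increment B (tau 0%N) (tau k) w + increment B (tau k) (tau k.+1) w.
    by apply/funext => w; rewrite /increment; ring.
  exact: (sigma_measurableD (IH (ltnW kN)) (step k kN)).
have [i iN ri] := Stau _ rS; have [j jN vj] := Stau _ vS.
suff -> : increment B r v =
    fun w => increment B (tau 0%N) (tau j) w - increment B (tau 0%N) (tau i) w.
  by apply: (sigma_measurableB (from0 _ jN) (from0 _ iN)).
by apply/funext => w; rewrite /increment -ri -vj; ring.
Qed.

Lemma finite_past_grid S s t : (forall r, r \in S -> r <= s) -> s < t ->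
  exists N (tau : nat -> R), [/\ forall j, (j < N.+1)%N -> tau j < tau j.+1,
    tau N = s, tau N.+1 = t & forall r, r \in S -> exists2 i, (i <= N)%N & r = tau i].
Proof.
(* Adding s to S makes s the largest point of the sorted list, so that appending t creates [s, t] as
   the last cell. *)
move=> Ss st; pose L := sort <=%R (undup (s :: S)).
have memL r : (r \in L) = (r == s) || (r \in S) by rewrite mem_sort mem_undup in_cons.
have sL : s \in L by rewrite memL eqxx.
have Lne : (0 < size L)%N by case: (L) sL.
have Llt : sorted <%R L by rewrite lt_sorted_uniq_le sort_uniq undup_uniq sort_le_sorted.
have Lsort : sorted <=%R L by exact: sort_le_sorted.
have Lle r : r \in L -> r <= s by rewrite memL => /orP[/eqP->//|/Ss].
pose N := (size L).-1; have NE : size L = N.+1 by rewrite prednK.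
pose L' := rcons L t.
have L'lt : sorted <%R L'.
  rewrite /L' -cats1; case E : L Lne Llt => [|x l] //= _ pl.
  rewrite cat_path pl /= andbT; apply: le_lt_trans st; apply: Lle.
  by rewrite E mem_last.
have nthN : nth t L N = s.
  have iN : (index s L <= N)%N by rewrite -ltnS -NE index_mem.
  apply/le_anti; rewrite Lle ?mem_nth ?NE//= -{1}(nth_index t sL).
  by rewrite (sorted_leq_nth le_trans le_refl)// ?inE ?NE ?ltnS.
have nthL i : (i <= N)%N -> nth t L' i = nth t L i by move=> iN; rewrite nth_rcons NE ltnS iN.
exists N, (nth t L'); split.
- move=> j jN; apply: (sorted_ltn_nth lt_trans) => //; rewrite ?inE size_rcons NE ?ltnS//.
  exact: ltnW.
- by rewrite nthL.
- by rewrite nth_rcons NE ltnn eqxx.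
- move=> r rS; exists (index r L).
    by rewrite -ltnS -NE index_mem memL rS orbT.
  rewrite nthL ?nth_index ?memL ?rS ?orbT//.
  by rewrite -ltnS -NE index_mem memL rS orbT.
Qed.

Lemma BM_increment_indep_past B S s t A (V : set R) : two_sided_BM P B ->
  (forall r, r \in S -> r <= s) -> s < t -> incr_sigma B S A -> measurable V ->
  P (A `&` increment B s t @^-1` V) = (P A * P (increment B s t @^-1` V))%E.
Proof.
move=> BM Ss st AS mV; have [N [tau [tlt tN tN1 Stau]]] := finite_past_grid Ss st.
have mC : measurable (increment B s t @^-1` V).
  by rewrite -[_ @^-1` _]setTI; exact: increment_measurable.
apply: (@indep_sigma_algebra _ _ _ _ (grid_rect B tau N)) => //.
- exact: grid_rect_setI.
- exact: grid_rect_setT.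
- exact: grid_rect_measurable.
- have [_ _ _ _ indep] := BM.
  (* Independence is used twice: on the grid of N + 1 cells with V in the last one, and on the first
     N cells alone. *)
  move=> _ [U mU ->]; pose U' j := if (j < N)%N then U j else V.
  have mU' j : measurable (U' j) by rewrite /U'; case: ifP.
  have U'N : U' N = V by rewrite /U' ltnn.
  have := indep N.+1 tau U' tlt mU'; rewrite big_ord_recr /= U'N tN tN1.
  rewrite (eq_bigr (fun j : 'I_N => P (increment B (tau j) (tau j.+1) @^-1` U j))); last first.
    by move=> j _; rewrite /U' ltn_ord.
  rewrite -(indep N tau U) //; last by move=> j jN; apply: tlt; exact: ltnW.
  move=> <-; congr (P _); apply/seteqP; split=> [w [Uw Vw] j /= jN|w Uw].
    rewrite /U'; case: ltnP => [jN'|Nj]; first exact: Uw.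
    have -> : j = N by apply/eqP; rewrite eqn_leq Nj -ltnS jN.
    by rewrite tN tN1.
  split=> [j /= jN|]; first by have := Uw j (ltnW jN); rewrite /U' jN.
  by have := Uw N (ltnSn N); rewrite /U' /= ltnn tN tN1.
- exact: incr_sigma_grid AS.
Qed.

End BrownianIndependence.

(** * Independence of the complex noise increments from the filtration *)

Section NoiseIndependence.
Context {R : realType} {d : measure_display} {T : measurableType d}.
Variables (P : probability T R) (Z : R -> T -> R[i]).
Hypothesis ZBM : two_sided_complex_BM P Z.
Let X u w := complex.Re (Z u w).
Let Y u w := complex.Im (Z u w).

Let incr_Re r s : (fun w => complex.Re (Z s w - Z r w)) = increment X r s.
Proof. by apply/funext => w; rewrite raddfB. Qed.

Let incr_Im r s : (fun w => complex.Im (Z s w - Z r w)) = increment Y r s.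
Proof. by apply/funext => w; rewrite raddfB. Qed.

Lemma noise_filtration_measurable t : noise_filtration P Z t `<=` measurable.
Proof.
have [XBM YBM _] := ZBM.
apply: g_sigma_algebra_measurable => _ [[r [s [U [_ _ mU] [->|->]]]]|[]//].
- by rewrite incr_Re -[_ @^-1` _]setTI; exact: (increment_measurable r s XBM measurableT mU).
- by rewrite incr_Im -[_ @^-1` _]setTI; exact: (increment_measurable r s YBM measurableT mU).
Qed.

Lemma noise_filtration_mono s t : s <= t -> noise_filtration P Z s `<=` noise_filtration P Z t.
Proof.
move=> st; apply: g_sigma_algebra_sub => A [[r [v [U [rv vs mU] AE]]]|A0].
  by apply: sub_gen_smallest; left; exists r, v, U => //; split => //; exact: le_trans st.
by apply: sub_gen_smallest; right.
Qed.

Lemma sigma_measurable_noise_incr_Re s t : s <= t ->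
  sigma_measurable (noise_filtration P Z t) (increment X s t).
Proof.
move=> st U mU; apply: sub_gen_smallest; left; exists s, t, U => //.
by left; rewrite incr_Re.
Qed.

Lemma sigma_measurable_noise_incr_Im s t : s <= t ->
  sigma_measurable (noise_filtration P Z t) (increment Y s t).
Proof.
move=> st U mU; apply: sub_gen_smallest; left; exists s, t, U => //.
by right; rewrite incr_Im.
Qed.

Definition noise_incr_rect s t : set (set T) :=
  [set A | exists U V : set R, [/\ measurable U, measurable V &
     A = increment X s t @^-1` U `&` increment Y s t @^-1` V]].

(** The generators of the filtration are not stable under intersection. Events that split into a
    real and an imaginary part over a common finite set of times, together with the null events,
    are. *)
Let noise_past s : set (set T) :=
  [set A | (exists (S : seq R) (A1 A2 : set T), [/\ forall r, r \in S -> r <= s, incr_sigma X S A1,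
     incr_sigma Y S A2 & A = A1 `&` A2]) \/ (measurable A /\ P A = 0%E)].

Let noise_past_setI s : setI_closed (noise_past s).
Proof.
have [XBM YBM _] := ZBM.
have meas A : noise_past s A -> measurable A.
  case=> [[S [A1 [A2 [_ A1S A2S ->]]]]|[]//].
  by apply: measurableI; [exact: (incr_sigma_measurable XBM A1S)|exact: (incr_sigma_measurable YBM A2S)].
have null A B : measurable A -> measurable B -> P B = 0%E -> P (A `&` B) = 0%E.
  by move=> mA mB B0; apply: (subset_measure0 _ mB) => //; exact: measurableI.
move=> A B pA pB; have mA := meas _ pA; have mB := meas _ pB.
case: pA => [[S1 [A1 [A2 [S1s A1S A2S AE]]]]|[_ PA0]]; last first.
  by right; split; [exact: measurableI|rewrite setIC; exact: null].
case: pB => [[S2 [B1 [B2 [S2s B1S B2S BE]]]]|[_ PB0]]; last first.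
  by right; split; [exact: measurableI|exact: null].
left; exists (S1 ++ S2), (A1 `&` B1), (A2 `&` B2); split.
- by move=> r; rewrite mem_cat => /orP[/S1s|/S2s].
- apply: (@measurableI _ (g_sigma_algebraType _)).
    by apply: incr_sigma_sub A1S => r rS; rewrite mem_cat rS.
  by apply: incr_sigma_sub B1S => r rS; rewrite mem_cat rS orbT.
- apply: (@measurableI _ (g_sigma_algebraType _)).
    by apply: incr_sigma_sub A2S => r rS; rewrite mem_cat rS.
  by apply: incr_sigma_sub B2S => r rS; rewrite mem_cat rS orbT.
- by rewrite AE BE setIACA.
Qed.

Let incr_sigma_setT (B : R -> T -> R) S : incr_sigma B S setT.
Proof. exact: (@measurableT _ (g_sigma_algebraType _)). Qed.

Let noise_past_gen s : noise_filtration P Z s `<=` <<s noise_past s >>.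
Proof.
apply: g_sigma_algebra_sub => A [[r [v [U [rv vs mU] AE]]]|A0]; last first.
  by apply: sub_gen_smallest; right.
have Ss q : q \in [:: r; v] -> q <= s.
  by rewrite !inE => /orP[/eqP->|/eqP->//]; exact: le_trans vs.
apply: sub_gen_smallest; left; exists [:: r; v].
case: AE => ->; rewrite ?incr_Re ?incr_Im.
- exists (increment X r v @^-1` U), setT; rewrite setIT; split => //.
  by apply: sub_gen_smallest; exists r, v, U; split => //; rewrite !inE eqxx ?orbT.
- exists setT, (increment Y r v @^-1` U); rewrite setTI; split => //.
  by apply: sub_gen_smallest; exists r, v, U; split => //; rewrite !inE eqxx ?orbT.
Qed.

(** Two extensions from pi-systems: first in C with A fixed, then in A with C a fixed rectangle. *)
Lemma noise_incr_indep s t A C : s < t -> noise_filtration P Z s A ->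
  <<s noise_incr_rect s t >> C -> P (A `&` C) = (P A * P C)%E.
Proof.
move=> st As Cst; have [XBM YBM XY] := ZBM.
have mX (U : set R) : measurable U -> measurable (increment X s t @^-1` U).
  by move=> mU; rewrite -[_ @^-1` _]setTI; exact: (increment_measurable s t XBM measurableT mU).
have mY (U : set R) : measurable U -> measurable (increment Y s t @^-1` U).
  by move=> mU; rewrite -[_ @^-1` _]setTI; exact: (increment_measurable s t YBM measurableT mU).
have mA := noise_filtration_measurable As.
rewrite setIC muleC; apply: (@indep_sigma_algebra _ _ _ _ (noise_incr_rect s t)) Cst => //.
- move=> _ _ [U1 [V1 [mU1 mV1 ->]]] [U2 [V2 [mU2 mV2 ->]]].
  exists (U1 `&` U2), (V1 `&` V2); split; [exact: measurableI|exact: measurableI|].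
  by rewrite setIACA.
- by exists setT, setT; split => //; rewrite !preimage_setT setIT.
- by move=> _ [U [V [mU mV ->]]]; apply: measurableI; [exact: mX|exact: mY].
move=> _ [U [V [mU mV ->]]]; rewrite setIC muleC.
apply: (@indep_sigma_algebra _ _ _ _ (noise_past s)).
- exact: noise_past_setI.
- by left; exists [::], setT, setT; split => //; rewrite setIT.
- move=> B [[S [A1 [A2 [_ A1S A2S ->]]]]|[]//].
  by apply: measurableI; [exact: (incr_sigma_measurable XBM A1S)|exact: (incr_sigma_measurable YBM A2S)].
- by apply: measurableI; [exact: mX|exact: mY].
- move=> B [[S [A1 [A2 [Ss A1S A2S ->]]]]|[mB B0]]; last first.
    rewrite B0 mul0e; apply: (subset_measure0 _ mB) => //; apply: measurableI => //.
    by apply: measurableI; [exact: mX|exact: mY].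
  have pX (V' : set R) : measurable V' -> process_sigma X (increment X s t @^-1` V').
    move=> mV'; apply: (@incr_sigma_process _ _ _ X [:: s; t]).
    by apply: sub_gen_smallest; exists s, t, V'; split => //; rewrite !inE eqxx ?orbT.
  have pY (V' : set R) : measurable V' -> process_sigma Y (increment Y s t @^-1` V').
    move=> mV'; apply: (@incr_sigma_process _ _ _ Y [:: s; t]).
    by apply: sub_gen_smallest; exists s, t, V'; split => //; rewrite !inE eqxx ?orbT.
  (* Regroup into a real and an imaginary event, separate them by independence of X and Y, split
     past from increment in each, and recombine by the same independence. *)
  rewrite setIACA XY; last 2 first.
  + apply: (@measurableI _ (g_sigma_algebraType _)); last exact: pX.
    exact: (incr_sigma_process A1S).
  + apply: (@measurableI _ (g_sigma_algebraType _)); last exact: pY.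
    exact: (incr_sigma_process A2S).
  rewrite (BM_increment_indep_past XBM Ss)// (BM_increment_indep_past YBM Ss)//.
  rewrite (XY A1 A2); [|exact: (incr_sigma_process A1S)|exact: (incr_sigma_process A2S)].
  by rewrite XY; [rewrite muleACA|exact: pX|exact: pY].
- exact: noise_past_gen.
Qed.

Lemma noise_expectation_prod s t (zeta xi : T -> R) : s < t ->
  sigma_measurable (noise_filtration P Z s) zeta -> L1 P zeta ->
  sigma_measurable <<s noise_incr_rect s t >> xi -> L1 P xi ->
  L1 P (fun w => zeta w * xi w) /\ Ex P (fun w => zeta w * xi w) = Ex P zeta * Ex P xi.
Proof.
move=> st mz iz mxi ixi; apply: indep_rv_expectation => // U V mU mV.
by apply: noise_incr_indep st _ _; [exact: mz|exact: mxi].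
Qed.

Lemma sigma_measurable_rect_Re s t :
  sigma_measurable <<s noise_incr_rect s t >> (increment X s t).
Proof.
move=> U mU; apply: sub_gen_smallest; exists U, setT; split => //.
by rewrite preimage_setT setIT.
Qed.

Lemma sigma_measurable_rect_Im s t :
  sigma_measurable <<s noise_incr_rect s t >> (increment Y s t).
Proof.
move=> U mU; apply: sub_gen_smallest; exists setT, U; split => //.
by rewrite preimage_setT setTI.
Qed.

Lemma noise_incr_Re_Im_indep s t : indep_rv P (increment X s t) (increment Y s t).
Proof.
have [XBM YBM XY] := ZBM.
move=> U V mU mV; apply: XY.
- apply: (@incr_sigma_process _ _ _ X [:: s; t]); apply: sub_gen_smallest.
  by exists s, t, U; split => //; rewrite !inE eqxx ?orbT.
- apply: (@incr_sigma_process _ _ _ Y [:: s; t]); apply: sub_gen_smallest.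
  by exists s, t, V; split => //; rewrite !inE eqxx ?orbT.
Qed.

End NoiseIndependence.

(** * Iterated integrals over time and probability space *)

Section TimeSpaceIntegral.
Context {R : realType} {d : measure_display} {T : measurableType d}.
Variable P : probability T R.
Variables s t : R.
Implicit Types f g : R * T -> R.

Let D : set (R * T) := `[s, t] `*` setT.

(** Iterated in the same order as in [ito_integrand] and [is_ito_integral], so that their L^2
    conditions are instances. *)
Definition ts_integral f : \bar R :=
  (\int[P]_w \int[lebesgue_measure]_(u in `[s, t]) (f (u, w))%:E)%E.

Let patch_pairE f u w : (((fun z => (f z)%:E) \_ D) (u, w) = ((fun v => (f (v, w))%:E) \_ `[s, t]) u)%E.
Proof.
rewrite !patchE; congr (if _ then _ else _).
by apply/idP/idP; rewrite !inE /D /= => // -[].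
Qed.

Let mD : @measurable _ (measurableTypeR R * T)%type D.
Proof. by apply: measurableX => //; exact: measurable_itv. Qed.

(** Integrands are measurable on the strip [s, t] x T only; extending them by zero makes Tonelli on
    the whole product applicable. *)
Let mpatch f : measurable_fun D f ->
  @measurable_fun _ _ (measurableTypeR R * T)%type _ setT ((fun z => (f z)%:E) \_ D).
Proof.
move=> mf; apply/(measurable_restrictT _ mD).
by apply/measurable_EFinP; exact: mf.
Qed.

Let patch_ge0 f : (forall z, 0 <= f z) -> forall z, (0 <= ((fun z => (f z)%:E) \_ D) z)%E.
Proof. by move=> f0 z; rewrite patchE; case: ifP => // _; rewrite lee_fin. Qed.

Let mu : {measure set (measurableTypeR R * T) -> \bar R} :=
  (@lebesgue_measure R \x P)%E.

Lemma ts_integralE f : measurable_fun D f -> (forall z, 0 <= f z) ->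
  ts_integral f = (\int[mu]_(z in D) (f z)%:E)%E.
Proof.
move=> mf f0; rewrite integral_mkcond (fubini_tonelli2 _ (mpatch mf) (patch_ge0 f0)).
apply: eq_integral => w _; rewrite integral_mkcond.
by apply: eq_integral => u _; rewrite -patch_pairE.
Qed.

Lemma ts_integral_tonelli f : measurable_fun D f -> (forall z, 0 <= f z) ->
  ts_integral f = (\int[lebesgue_measure]_(u in `[s, t]) \int[P]_w (f (u, w))%:E)%E.
Proof.
move=> mf f0; rewrite ts_integralE// integral_mkcond.
rewrite (fubini_tonelli1 _ (mpatch mf) (patch_ge0 f0)) [RHS]integral_mkcond.
apply: eq_integral => u _; rewrite [RHS]patchE; case: ifP => ust.
  apply: eq_integral => w _.
  by rewrite patchE /= mem_set// /D /=; split => //; exact: set_mem ust.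
apply: integral0_eq => w _.
by rewrite patchE memNset// => -[us _]; move: ust; rewrite mem_set.
Qed.

Lemma ts_integral_ge0 f : (forall z, 0 <= f z) -> (0 <= ts_integral f)%E.
Proof. by move=> f0; apply: integral_ge0 => w _; apply: integral_ge0 => u _; rewrite lee_fin. Qed.

Lemma ts_integral_le f g : measurable_fun D f -> measurable_fun D g ->
  (forall z, 0 <= f z) -> (forall z, f z <= g z) -> (ts_integral f <= ts_integral g)%E.
Proof.
move=> mf mg f0 fg; have g0 z : 0 <= g z := le_trans (f0 z) (fg z).
rewrite !ts_integralE//; apply: ge0_le_integral => //.
- by move=> z _; rewrite lee_fin.
- by apply/measurable_EFinP; exact: mf.
- by apply/measurable_EFinP; exact: mg.
- by move=> z _; rewrite lee_fin.
Qed.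

Lemma ts_integralD f g : measurable_fun D f -> measurable_fun D g ->
  (forall z, 0 <= f z) -> (forall z, 0 <= g z) ->
  (ts_integral (fun z => (f z + g z)%R) = ts_integral f + ts_integral g)%E.
Proof.
move=> mf mg f0 g0; rewrite !ts_integralE//.
- rewrite -ge0_integralD//.
  + by move=> z _; rewrite lee_fin.
  + by apply/measurable_EFinP; exact: mf.
  + by move=> z _; rewrite lee_fin.
  + by apply/measurable_EFinP; exact: mg.
- exact: measurable_funD.
- by move=> z; exact: addr_ge0.
Qed.

Lemma ts_integralZ f c : measurable_fun D f -> (forall z, 0 <= f z) -> 0 <= c ->
  (ts_integral (fun z => (c * f z)%R) = c%:E * ts_integral f)%E.
Proof.
move=> mf f0 c0; rewrite !ts_integralE//.
- rewrite -ge0_integralZl//.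
  + by apply/measurable_EFinP; exact: mf.
  + by move=> z _; rewrite lee_fin.
- exact: measurable_funM.
- by move=> z; exact: mulr_ge0.
Qed.

Lemma measurable_time_integral f : measurable_fun D f -> (forall z, 0 <= f z) ->
  measurable_fun setT (fun w => \int[lebesgue_measure]_(u in `[s, t]) (f (u, w))%:E)%E.
Proof.
move=> mf f0.
have := measurable_fun_fubini_tonelli_G (m1 := @lebesgue_measure R) _ (mpatch mf) (patch_ge0 f0).
apply: eq_measurable_fun => w _; rewrite /fubini_G [RHS]integral_mkcond.
by apply: eq_integral => u _; rewrite -patch_pairE.
Qed.

Lemma measurable_fun_time_section f w : measurable_fun D f ->
  measurable_fun `[s, t] (fun u => f (u, w)).
Proof.
move=> mf.
apply: (measurable_comp _ _ mf) => //.
- by move=> _ [u ust <-]; split.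
- by apply: measurable_funTS; exact: pair2_measurable.
Qed.

Lemma measurable_fun_spaceD (X : T -> R) : measurable_fun setT X ->
  measurable_fun D (fun z : R * T => X z.2).
Proof.
by move=> mX; apply: measurable_funTS; exact: (measurableT_comp mX measurable_snd).
Qed.

End TimeSpaceIntegral.

(** * Integrals of step processes against the noise *)

Section StochasticIntegral.
Context {R : realType} {d : measure_display} {T : measurableType d}.
Variables (P : probability T R) (Z : R -> T -> R[i]).
Hypothesis ZBM : two_sided_complex_BM P Z.
Let F := noise_filtration P Z.

(** The conditional mean 0 and conditional variance t - s of an increment given the past, tested
    against past variables. This treats the real and the imaginary part of Z alike. *)
Definition noise_integrator (W : R -> T -> R) : Prop :=
  (forall s t, s <= t -> sigma_measurable (F t) (increment W s t)) /\
  forall s t (zeta : T -> R), s < t -> sigma_measurable (F s) zeta -> L1 P zeta ->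
    [/\ L1 P (fun w => zeta w * increment W s t w),
        Ex P (fun w => zeta w * increment W s t w) = 0,
        L1 P (fun w => zeta w * increment W s t w ^+ 2) &
        Ex P (fun w => zeta w * increment W s t w ^+ 2) = (t - s) * Ex P zeta].

Lemma BM_increment_moments W s t : two_sided_BM P W -> s < t ->
  [/\ L1 P (fun w => increment W s t w ^+ 4), Ex P (increment W s t) = 0,
    Ex P (fun w => increment W s t w ^+ 2) = t - s &
    Ex P (fun w => increment W s t w ^+ 4) <= 32 * (t - s) ^+ 2].
Proof.
move=> BM st; have mW := increment_measurable s t BM; have [_ _ _ law _] := BM.
have ts0 : 0 < t - s by rewrite subr_gt0.
have [] := @normal_moments _ _ _ P _ (Num.sqrt (t - s)) _ mW (law s t st).
  by rewrite sqrtr_gt0.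
have -> : Num.sqrt (t - s) ^+ 4 = (t - s) ^+ 2.
  by rewrite -[4%N]/(2 * 2)%N exprM sqr_sqrtr ?(ltW ts0).
by rewrite sqr_sqrtr ?(ltW ts0)// => ? ? ? ?; split.
Qed.

Lemma L1_of_fourth_moment (f : T -> R) : measurable_fun setT f ->
  L1 P (fun w => f w ^+ 4) -> L2 P f.
Proof.
move=> mf f4; split => //; apply: (L1_le _ (L1D (L1_cst P 1) f4)).
  exact: measurable_funX.
move=> w; rewrite ger0_norm ?sqr_ge0//.
rewrite -[f w ^+ 4]/(f w ^+ (2 * 2)) exprM; set z := f w ^+ 2.
by have := sqr_ge0 (z - 1); have := sqr_ge0 z; rewrite !expr2; lra.
Qed.

Let BM_noise_integrator W : two_sided_BM P W ->
  (forall s t, s <= t -> sigma_measurable (F t) (increment W s t)) ->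
  (forall s t, sigma_measurable <<s noise_incr_rect Z s t >> (increment W s t)) ->
  noise_integrator W.
Proof.
move=> BM Wad Wrect; split => // s t zeta st mz iz.
have mW := increment_measurable s t BM.
have [W4 W1 W2 _] := BM_increment_moments BM st.
have [_ iW2] := L1_of_fourth_moment mW W4.
have iW : L1 P (increment W s t) := L2_L1 (L1_of_fourth_moment mW W4).
have [i1 e1] := noise_expectation_prod ZBM st mz iz (Wrect s t) iW.
have mW2 : sigma_measurable <<s noise_incr_rect Z s t >> (fun w => increment W s t w ^+ 2).
  apply: (@sigma_measurable_comp _ _ _ _ _ (fun x : R => x ^+ 2)) => //.
have [i2 e2] := noise_expectation_prod ZBM st mz iz mW2 iW2.
by split => //; [rewrite e1 W1 mulr0|rewrite e2 W2 mulrC].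
Qed.

Lemma noise_integrator_Re : noise_integrator (fun u w => complex.Re (Z u w)).
Proof.
have [XBM YBM XY] := ZBM; apply: BM_noise_integrator => //.
- by move=> s t; exact: sigma_measurable_noise_incr_Re.
- by move=> s t; exact: sigma_measurable_rect_Re.
Qed.

Lemma noise_integrator_Im : noise_integrator (fun u w => complex.Im (Z u w)).
Proof.
have [XBM YBM XY] := ZBM; apply: BM_noise_integrator => //.
- by move=> s t; exact: sigma_measurable_noise_incr_Im.
- by move=> s t; exact: sigma_measurable_rect_Im.
Qed.

Lemma grid_mono N (tau : nat -> R) : (forall j, (j < N)%N -> tau j < tau j.+1) ->
  forall i j, (i <= j <= N)%N -> tau i <= tau j.
Proof.
move=> tlt i j /andP[]; elim: j => [|j IH]; first by rewrite leqn0 => /eqP->.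
rewrite leq_eqVlt => /orP[/eqP->//|]; rewrite ltnS => ij jN.
by apply: le_trans (IH ij (ltnW jN)) _; exact/ltW/tlt.
Qed.

Variable W : R -> T -> R.
Hypothesis Wint : noise_integrator W.

Let Fmeas t : F t `<=` measurable := @noise_filtration_measurable _ _ _ _ _ ZBM t.

Let L2_increment s t : s < t -> L2 P (increment W s t).
Proof.
move=> st; have [Wad Wi] := Wint.
split; first exact: (sigma_measurable_fun (@Fmeas t) (Wad s t (ltW st))).
have [] := Wi s t (fun=> 1) st (@sigma_measurable_cst _ _ _ _ 1) (L1_cst P 1).
by under eq_fun do rewrite mul1r; move=> _ _; under eq_fun do rewrite mul1r.
Qed.

(** Induction on the number of cells. The last conclusion is the martingale property tested against
    bounded variables known at the initial time; it is what survives the passage to general Ito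
    integrals. *)
Lemma step_integral_isometry N (tau : nat -> R) (c : nat -> T -> R) (M : R) :
  (forall j, (j < N)%N -> tau j < tau j.+1) ->
  (forall j, (j < N)%N -> sigma_measurable (F (tau j)) (c j)) ->
  (forall j w, (j < N)%N -> `|c j w| <= M) ->
  let S w := \sum_(j < N) c j w * increment W (tau j) (tau j.+1) w in
  [/\ sigma_measurable (F (tau N)) S, L2 P S,
      Ex P (fun w => S w ^+ 2) = \sum_(j < N) (tau j.+1 - tau j) * Ex P (fun w => c j w ^+ 2)
    & forall zeta (M' : R), sigma_measurable (F (tau 0%N)) zeta -> (forall w, `|zeta w| <= M') ->
        Ex P (fun w => zeta w * S w) = 0].
Proof.
elim: N => [|N IH] tlt cm cM.
  have -> /= : (fun w => \sum_(j < 0) c j w * increment W (tau j) (tau j.+1) w) = fun=> 0.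
    by apply/funext => w; rewrite big_ord0.
  rewrite big_ord0; split.
  - exact: sigma_measurable_cst.
  - exact: L2_cst.
  - by rewrite expr0n /= Ex_cst.
  - by move=> zeta M' _ _; under eq_fun do rewrite mulr0; rewrite Ex_cst.
have [Sm S2 SE Sz] := IH (fun j jN => tlt j (ltnW jN)) (fun j jN => cm j (ltnW jN))
  (fun j w jN => cM j w (ltnW jN)).
set S := (fun w => _) in Sm S2 SE Sz => /=.
have recE w : \sum_(j < N.+1) c j w * increment W (tau j) (tau j.+1) w =
    S w + c N w * increment W (tau N) (tau N.+1) w by rewrite big_ord_recr.
rewrite [X in sigma_measurable _ X](funext recE) [X in L2 _ X](funext recE).
have tN : tau N < tau N.+1 by exact: tlt.
set D := increment W (tau N) (tau N.+1).
have D2 : L2 P D by exact: L2_increment.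
have cmN := cm N (ltnSn N).
have mcN := sigma_measurable_fun (@Fmeas (tau N)) cmN.
have cMN w : `|c N w| <= M by exact: cM.
have cD2 : L2 P (fun w => c N w * D w) by exact: (L2_bM mcN cMN D2).
have [Wad Wi] := Wint.
have FN : F (tau N) `<=` F (tau N.+1) by apply: noise_filtration_mono; exact: ltW.
have c2m : sigma_measurable (F (tau N)) (fun w => c N w ^+ 2).
  exact: (sigma_measurableM cmN cmN).
have [_ ic2] : L2 P (c N) by exact: (L2_bounded P mcN cMN).
have [iq _ iqq qq] := Wi _ _ _ tN c2m ic2.
split.
- apply: (sigma_measurableD (sigma_measurable_sub FN Sm)).
  apply: (sigma_measurableM (sigma_measurable_sub FN cmN)).
  exact: (Wad _ _ (ltW tN)).
- exact: L2D.
- rewrite big_ord_recr /= -SE -qq.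
  (* The cross term vanishes: S and the last coefficient are known at time [tau N], so their product
     is a legitimate past variable. *)
  have Sc : L1 P (fun w => S w * c N w) by apply: L1_L2M => //; exact: L2_bounded cMN.
  have mSc := sigma_measurableM Sm cmN.
  have [iSc eSc _ _] := Wi _ _ _ tN mSc Sc.
  transitivity (Ex P (fun w => (S w ^+ 2 + 2 * (S w * c N w * D w)) + c N w ^+ 2 * D w ^+ 2)).
    by congr (Ex P _); apply/funext => w /=; rewrite recE /D; ring.
  rewrite ExD//; last by apply: L1D; [exact: S2.2|exact: L1Z].
  rewrite ExD//; [|exact: S2.2|exact: L1Z].
  by rewrite ExZ// eSc mulr0 addr0.
- move=> zeta M' mz zM'.
  have F0 : F (tau 0%N) `<=` F (tau N).
    by apply: noise_filtration_mono; apply: (grid_mono tlt); rewrite leq0n leqnSn.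
  have mz' := sigma_measurable_sub F0 mz.
  have mzT := sigma_measurable_fun (@Fmeas (tau N)) mz'.
  have mzc := sigma_measurableM mz' cmN.
  have izc : L1 P (fun w => zeta w * c N w).
    by apply: (L1_bM mzT zM'); apply: L2_L1; exact: L2_bounded cMN.
  have [izD ezD _ _] := Wi _ _ _ tN mzc izc.
  transitivity (Ex P (fun w => zeta w * S w + zeta w * c N w * D w)).
    by congr (Ex P _); apply/funext => w /=; rewrite recE /D; ring.
  rewrite ExD//; first by rewrite (Sz _ _ mz zM') ezD addr0.
  by apply: (L1_bM mzT zM'); exact: L2_L1.
Qed.

End StochasticIntegral.

Lemma sqrD_le {R : realType} (a b : R) : (a + b) ^+ 2 <= 2 * a ^+ 2 + 2 * b ^+ 2.
Proof. by have := sqr_ge0 (a - b); rewrite !expr2; lra. Qed.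

Lemma ts_integral_sqrD {R : realType} {d : measure_display} {T : measurableType d}
    (P : probability T R) (s t : R) (f g : R * T -> R) :
  measurable_fun (`[s, t] `*` setT) f -> measurable_fun (`[s, t] `*` setT) g ->
  (ts_integral P s t (fun z => ((f z + g z) ^+ 2)%R) <=
    2%:E * ts_integral P s t (fun z => (f z ^+ 2)%R) +
    2%:E * ts_integral P s t (fun z => (g z ^+ 2)%R))%E.
Proof.
move=> mf mg; have mf2 := measurable_funX 2 mf; have mg2 := measurable_funX 2 mg.
have f0 z : 0 <= f z ^+ 2 by exact: sqr_ge0.
have g0 z : 0 <= g z ^+ 2 by exact: sqr_ge0.
have n2 : 0 <= 2 :> R by [].
have f20 z : 0 <= 2 * f z ^+ 2 by exact: mulr_ge0.
have g20 z : 0 <= 2 * g z ^+ 2 by exact: mulr_ge0.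
have mf22 : measurable_fun (`[s, t] `*` setT) (fun z => 2 * f z ^+ 2) by exact: measurable_funM.
have mg22 : measurable_fun (`[s, t] `*` setT) (fun z => 2 * g z ^+ 2) by exact: measurable_funM.
rewrite -(ts_integralZ P mf2 f0 n2) -(ts_integralZ P mg2 g0 n2) -(ts_integralD P mf22 mg22 f20 g20).
apply: ts_integral_le.
- by apply: measurable_funX; exact: measurable_funD.
- exact: measurable_funD.
- by move=> z; exact: sqr_ge0.
- by move=> z; exact: sqrD_le.
Qed.

Lemma cvge0_near_le {R : realType} (u : nat -> \bar R) (e : R) : 0 < e -> u @ \oo --> 0%E ->
  \forall m \near \oo, (u m <= e%:E)%E.
Proof.
move=> e0 /fine_cvgP[ufin] /cvgr_le/(_ _ e0) ue.
by apply: filterS2 ufin ue => m um /=; rewrite -lee_fin fineK.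
Qed.

(** * Lebesgue integral of a step function *)

Section StepFunctions.
Context {R : realType}.

Lemma integral_step_function (N : nat) (tau v : nat -> R) (f : R -> R) :
  (forall j, (j < N)%N -> tau j < tau j.+1) -> measurable_fun setT f -> (forall u, 0 <= f u) ->
  (forall j u, (j < N)%N -> tau j <= u < tau j.+1 -> f u = v j) ->
  (\int[lebesgue_measure]_(u in `[tau 0%N, tau N]) (f u)%:E
    = (\sum_(j < N) (tau j.+1 - tau j) * v j)%:E)%E.
Proof.
move=> tlt mf f0 fv.
have mfE (D : set R) : measurable_fun D (EFin \o f).
  by apply/measurable_EFinP; exact: measurable_funTS.
(* The cells are half-open, so the value at the end point [tau N] is not controlled; that single
   point is dropped. *)
rewrite -integral_itv_bndo_bndc; last exact: mfE.
elim: N tlt fv => [|N IH] tlt fv.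
  by rewrite set_itvco0 integral_set0 big_ord0.
have t0N : tau 0%N <= tau N.
  by apply: (grid_mono (fun j jN => tlt j (ltnW jN))); rewrite leqnn andbT.
have tN := tlt N (ltnSn N).
rewrite (@itv_bndbnd_setU _ _ _ (BLeft (tau N))) ?bnd_simp ?(ltW tN)//.
rewrite ge0_integral_setU//=; last 3 first.
- exact: mfE.
- by move=> u _; rewrite lee_fin.
- apply/disj_set2P; rewrite -subset0 => u [] /=; rewrite !in_itv /= => /andP[_ uN] /andP[Nu _].
  by move: (lt_le_trans uN Nu); rewrite ltxx.
rewrite IH; [|by move=> j jN; apply: tlt; exact: ltnW|by move=> j u jN; apply: fv; exact: ltnW].
rewrite big_ord_recr /= EFinD; congr (_ + _)%E.
rewrite (eq_integral (fun=> (v N)%:E)); last first.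
  by move=> u; rewrite inE /= in_itv /= => uN; rewrite (fv N).
by rewrite integral_cst//= lebesgue_measure_itv /= lte_fin tN -EFinD -EFinM mulrC.
Qed.

End StepFunctions.

(** * The isometry for simple processes and its consequences for Ito integrals *)

Section ItoIsometry.
Context {R : realType} {d : measure_display} {T : measurableType d}.
Variables (P : probability T R) (Z : R -> T -> R[i]).
Hypothesis ZBM : two_sided_complex_BM P Z.
Let F := noise_filtration P Z.
Let Fmeas t : F t `<=` measurable := @noise_filtration_measurable _ _ _ _ _ ZBM t.

Lemma sp_valE s t (h : simple_process F s t) j u w : (j < sp_size h)%N ->
  sp_grid h j <= u < sp_grid h j.+1 -> sp_val h u w = sp_coef h j w.
Proof.
move=> jN /andP[ju uj]; rewrite /sp_val (bigD1 (Ordinal jN)) //= big1 => [|i ij].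
  by rewrite indicE mem_set ?mulr1 ?addr0 //= in_itv /= ju uj.
rewrite indicE memNset ?mulr0//= in_itv /= => /andP[iu ui].
have tlt k : (k < sp_size h)%N -> sp_grid h k < sp_grid h k.+1 by exact: sp_grid_incr.
have mono := grid_mono tlt.
have [ltij|ltji|eqij] := ltngtP i j.
- by have := mono i.+1 j; rewrite ltij ltnW// => /(_ isT) /(lt_le_trans ui) /(le_lt_trans ju); rewrite ltxx.
- by have := mono j.+1 i; rewrite ltji ltnW ?ltn_ord// => /(_ isT) /(lt_le_trans uj) /(le_lt_trans iu); rewrite ltxx.
- by move/negP: ij; apply; apply/eqP/val_inj.
Qed.

Lemma measurable_sp_val s t (h : simple_process F s t) (D : set (R * T)) :
  measurable_fun D (fun z : R * T => sp_val h z.1 z.2).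
Proof.
apply: measurable_funTS; apply: measurable_sum => j.
apply: measurable_funM.
  apply: (measurableT_comp _ measurable_snd).
  exact: (sigma_measurable_fun (@Fmeas _) (sp_coef_meas (ltn_ord j))).
apply: (measurableT_comp _ measurable_fst).
by apply: measurable_indic; exact: measurable_itv.
Qed.

Lemma sp_grid_start_le s t (h : simple_process F s t) j : (j <= sp_size h)%N -> s <= sp_grid h j.
Proof.
move=> jN.
have tlt k : (k < sp_size h)%N -> sp_grid h k < sp_grid h k.+1 by exact: sp_grid_incr.
by have := grid_mono tlt (i := 0) (j := j); rewrite sp_grid_start; apply.
Qed.

Variable W : R -> T -> R.
Hypothesis Wint : noise_integrator P Z W.

Lemma sp_isometry s t (h : simple_process F s t) (c0 : T -> R) (M : R) :
  sigma_measurable (F s) c0 -> (forall w, `|c0 w| <= M) ->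
  [/\ L2 P (fun w => sp_integral h W w - c0 w * increment W s t w),
     ts_integral P s t (fun z => (sp_val h z.1 z.2 - c0 z.2) ^+ 2) =
       (Ex P (fun w => (sp_integral h W w - c0 w * increment W s t w) ^+ 2))%:E &
     forall (zeta : T -> R) (M' : R), sigma_measurable (F s) zeta -> (forall w, `|zeta w| <= M') ->
       Ex P (fun w => zeta w * (sp_integral h W w - c0 w * increment W s t w)) = 0].
Proof.
move=> mc0 c0M.
have [K hK] := sp_coef_bounded h.
have tlt k : (k < sp_size h)%N -> sp_grid h k < sp_grid h k.+1 by exact: sp_grid_incr.
have mc0j j : (j < sp_size h)%N -> sigma_measurable (F (sp_grid h j)) c0.
  move=> jN; apply: sigma_measurable_sub mc0; apply: noise_filtration_mono.
  by apply: sp_grid_start_le; exact: ltnW.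
pose c j w := sp_coef h j w - c0 w.
have cm j : (j < sp_size h)%N -> sigma_measurable (F (sp_grid h j)) (c j).
  by move=> jN; exact: (sigma_measurableB (sp_coef_meas jN) (mc0j j jN)).
have cK j w : (j < sp_size h)%N -> `|c j w| <= K + M.
  by move=> jN; apply: (le_trans (ler_normB _ _)); apply: lerD => //; exact: hK.
have [Sm S2 SE Sz] := step_integral_isometry ZBM Wint tlt cm cK.
set S := (fun w => _) in Sm S2 SE Sz.
have sumE w : \sum_(j < sp_size h) increment W (sp_grid h j) (sp_grid h j.+1) w = increment W s t w.
  rewrite -(big_mkord xpredT (fun j => increment W (sp_grid h j) (sp_grid h j.+1) w)).
  by rewrite /increment (telescope_sumr (fun j => W (sp_grid h j) w))// sp_grid_end sp_grid_start.
have SEq w : S w = sp_integral h W w - c0 w * increment W s t w.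
  rewrite /S /sp_integral -sumE mulr_sumr -sumrB; apply: eq_bigr => j _.
  by rewrite /c mulrBl.
have -> : (fun w => sp_integral h W w - c0 w * increment W s t w) = S.
  by apply/funext => w; rewrite SEq.
split => //.
- have mcj j : (j < sp_size h)%N -> measurable_fun setT (c j).
    by move=> jN; exact: (sigma_measurable_fun (@Fmeas _) (cm j jN)).
  have L1c j : (j < sp_size h)%N -> L1 P (fun w => c j w ^+ 2).
    by move=> jN; have [] := L2_bounded P (mcj j jN) (fun w => cK j w jN).
  have -> : Ex P (fun w => (sp_integral h W w - c0 w * increment W s t w) ^+ 2) =
      Ex P (fun w => S w ^+ 2) by congr (Ex P _); apply/funext => w; rewrite SEq.
  rewrite SE /ts_integral.
  transitivity (\int[P]_w (\sum_(j < sp_size h) (sp_grid h j.+1 - sp_grid h j) * c j w ^+ 2)%:E)%E.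
    apply: eq_integral => w _.
    have := @integral_step_function _ _ _ (fun j => c j w ^+ 2) (fun u => (sp_val h u w - c0 w) ^+ 2) tlt.
    rewrite sp_grid_start sp_grid_end; apply => //=.
    - apply: measurable_funX; apply: measurable_funB => //; apply: measurable_sum => j.
      by apply: measurable_funM => //; apply: measurable_indic; exact: measurable_itv.
    - by move=> u; exact: sqr_ge0.
    - by move=> j u jN uj; rewrite (sp_valE w jN uj).
  under eq_integral do rewrite -sumEFin.
  rewrite ge0_integral_sum//=; last 2 first.
  + move=> j; apply/measurable_EFinP; apply: measurable_funM => //.
    by apply: measurable_funX; exact: mcj.
  + by move=> j w _; rewrite lee_fin mulr_ge0 ?sqr_ge0// subr_ge0 ltW// tlt.
  rewrite -sumEFin; apply: eq_bigr => j _.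
  by rewrite (Ex_EFin (L1Z _ (L1c j _)))// ExZ//; exact: L1c.
- move=> zeta M' mz zM'.
  rewrite -[RHS](Sz zeta M' _ zM'); last by rewrite sp_grid_start.
  by congr (Ex P _); apply/funext => w; rewrite -SEq.
Qed.

(** Approximation by simple processes. The factor 4 comes from two uses of (a + b)^2 <= 2 a^2 + 2
    b^2; only the order of magnitude matters later. *)
Lemma ito_bound s t H I (c0 : T -> R) (M : R) : s < t ->
  is_ito_integral P F W s t H I ->
  sigma_measurable (F s) c0 -> (forall w, `|c0 w| <= M) ->
  [/\ L2 P I,
     ((Ex P (fun w => (I w - c0 w * increment W s t w) ^+ 2))%:E <=
       4%:E * ts_integral P s t (fun z => (H z.1 z.2 - c0 z.2) ^+ 2)%R)%E &
     forall (zeta : T -> R) (M' : R), sigma_measurable (F s) zeta -> (forall w, `|zeta w| <= M') ->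
       Ex P (fun w => zeta w * (I w - c0 w * increment W s t w)) = 0].
Proof.
move=> st [[mH _ _] mI [h [h1 h2]]] mc0 c0M.
have mc0T := sigma_measurable_fun (@Fmeas s) mc0.
have iso m := sp_isometry (h m) mc0 c0M.
have mZ : measurable_fun (`[s, t] `*` setT) (fun z : R * T => c0 z.2).
  exact: measurable_fun_spaceD.
have [Wad Wi] := Wint.
have W2 : L2 P (increment W s t).
  split; first exact: (sigma_measurable_fun (@Fmeas t) (Wad s t (ltW st))).
  have [_ _ + _] := Wi s t (fun=> 1) st (@sigma_measurable_cst _ _ _ _ 1) (L1_cst P 1).
  by under eq_fun do rewrite mul1r.
have cW2 : L2 P (fun w => c0 w * increment W s t w) by exact: (L2_bM mc0T c0M W2).
have sp2 m : L2 P (sp_integral (h m) W).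
  have [Y2 _ _] := iso m; have := L2D Y2 cW2.
  by under eq_fun do rewrite subrK.
have mI2 m : measurable_fun setT (fun w => sp_integral (h m) W w - I w).
  exact: measurable_funB (sp2 m).1 mI.
have near_ (e : R) : 0 < e -> exists m,
    [/\ (ts_integral P s t (fun z => (sp_val (h m) z.1 z.2 - H z.1 z.2) ^+ 2)%R <= e%:E)%E,
        L2 P (fun w => sp_integral (h m) W w - I w) &
        Ex P (fun w => (sp_integral (h m) W w - I w) ^+ 2) <= e].
  move=> e0; have [m [e1 e2]] := filter_ex (filterI (cvge0_near_le e0 h1) (cvge0_near_le e0 h2)).
  rewrite unlock in e2; exists m; split => //.
    split => //; apply: L1_ge0 => [|w|].
    - exact: measurable_funX.
    - exact: sqr_ge0.
    - by apply: le_lt_trans e2 _; rewrite ltry.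
  have L : L1 P (fun w => (sp_integral (h m) W w - I w) ^+ 2).
    apply: L1_ge0 => [|w|].
    - exact: measurable_funX.
    - exact: sqr_ge0.
    - by apply: le_lt_trans e2 _; rewrite ltry.
  by rewrite -lee_fin -Ex_EFin.
have I2 : L2 P I.
  have [m [_ D2 _]] := near_ 1 ltr01; have := L2B (sp2 m) D2.
  by under eq_fun do rewrite subKr.
have mHc : measurable_fun (`[s, t] `*` setT) (fun z : R * T => H z.1 z.2 - c0 z.2).
  exact: measurable_funB.
split => //.
- apply/lee_addgt0Pr => e e0.
  (* The approximation errors enter with total weight 2 + 2 * 2 = 6. *)
  have e60 : 0 < e / 6 by rewrite divr_gt0.
  have [m [J1 D2 E2]] := near_ _ e60; have [Y2 iso2 _] := iso m.
  have mV : measurable_fun (`[s, t] `*` setT) (fun z : R * T => sp_val (h m) z.1 z.2).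
    exact: measurable_sp_val.
  have J2 : (ts_integral P s t (fun z => (sp_val (h m) z.1 z.2 - c0 z.2) ^+ 2)%R <=
      2%:E * ts_integral P s t (fun z => (sp_val (h m) z.1 z.2 - H z.1 z.2) ^+ 2)%R +
      2%:E * ts_integral P s t (fun z => (H z.1 z.2 - c0 z.2) ^+ 2)%R)%E.
    have mVH : measurable_fun (`[s, t] `*` setT) (fun z : R * T => sp_val (h m) z.1 z.2 - H z.1 z.2).
      exact: measurable_funB.
    have := ts_integral_sqrD P mVH mHc.
    by under eq_fun do rewrite addrA subrK.
  have E3 : Ex P (fun w => (I w - c0 w * increment W s t w) ^+ 2) <=
      2 * Ex P (fun w => (sp_integral (h m) W w - I w) ^+ 2) +
      2 * Ex P (fun w => (sp_integral (h m) W w - c0 w * increment W s t w) ^+ 2).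
    rewrite -!ExZ//; [|exact: Y2.2|exact: D2.2].
    rewrite -ExD; [|exact: (L1Z _ D2.2)|exact: (L1Z _ Y2.2)].
    apply: Ex_le => [||w].
    + exact: (L2B I2 cW2).2.
    + by apply: L1D; apply: L1Z; [exact: D2.2|exact: Y2.2].
    + set a := sp_integral _ _ _ - I w; set b := sp_integral _ _ _ - _ * _.
      have -> : I w - c0 w * increment W s t w = - a + b by rewrite /a /b; ring.
      by rewrite -[a ^+ 2]sqrrN; exact: sqrD_le.
  apply: (@le_trans _ _ (2%:E * (e / 6)%:E + 2%:E * (2%:E * (e / 6)%:E +
      2%:E * ts_integral P s t (fun z => (H z.1 z.2 - c0 z.2) ^+ 2)%R))%E).
    apply: (le_trans (y := (2 * Ex P (fun w => (sp_integral (h m) W w - I w) ^+ 2) +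
      2 * Ex P (fun w => (sp_integral (h m) W w - c0 w * increment W s t w) ^+ 2))%:E)).
      by rewrite lee_fin.
    rewrite EFinD !EFinM; apply: leeD.
      by rewrite lee_pmul2l// lee_fin.
    rewrite lee_pmul2l// -iso2; apply: (le_trans J2); apply: leeD => //.
    by rewrite lee_pmul2l.
  have : (0 <= ts_integral P s t (fun z => (H z.1 z.2 - c0 z.2) ^+ 2)%R)%E.
    by apply: ts_integral_ge0 => z; exact: sqr_ge0.
  case: (ts_integral _ _ _ _) => [r _| _|]//.
    by rewrite -!EFinM -!EFinD lee_fin; lra.
  by rewrite [X in (_ <= X + _)%E]gt0_muley ?lte_fin// addye// leey.
- move=> zeta M' mz zM'.
  have mzT := sigma_measurable_fun (@Fmeas s) mz.
  have M'0 : 0 <= M' + 1.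
    by apply: (le_trans (normr_ge0 (zeta point))); apply: (le_trans (zM' _)); rewrite lerDl.
  apply/eqP; rewrite -normr_le0; apply/ler_addgt0Pr => e e0; rewrite add0r.
  (* By AM-GM |zeta x| <= (M' + 1) (e1 / 2 + x^2 / (2 e1)). With E x^2 <= e1^2 the expectation is at
     most (M' + 1) e1 <= e. *)
  pose e1 := e / (M' + 1 + 1); have D0 : 0 < M' + 1 + 1 by lra.
  have e10 : 0 < e1 by exact: divr_gt0.
  have [m [_ D2 E2]] := near_ (e1 ^+ 2) (exprn_gt0 2 e10); have [Y2 _ iso3] := iso m.
  have zY : L1 P (fun w => zeta w * (sp_integral (h m) W w - c0 w * increment W s t w)).
    by apply: (L1_bM mzT zM'); exact: L2_L1.
  have zI : L1 P (fun w => zeta w * (I w - c0 w * increment W s t w)).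
    by apply: (L1_bM mzT zM'); apply: L2_L1; exact: L2B.
  rewrite -[X in `|X|]subr0 -(iso3 zeta M' mz zM') -ExB//.
  have D1 : L1 P (fun w => (sp_integral (h m) W w - I w) ^+ 2) := D2.2.
  have i2 : L1 P (fun w => (M' + 1) * e1 / 2 + (M' + 1) / (2 * e1) * (sp_integral (h m) W w - I w) ^+ 2).
    by apply: L1D; [exact: L1_cst|exact: L1Z].
  apply: (le_trans (Ex_abs_le (L1B zI zY) i2 _)) => [w|].
    rewrite -mulrBr normrM; set x := sp_integral (h m) W w - I w.
    rewrite (_ : _ - _ = - x); last by rewrite /x; ring.
    rewrite normrN; apply: (@le_trans _ _ ((M' + 1) * `|x|)).
      by rewrite ler_wpM2r// (le_trans (zM' w))// lerDl.
    rewrite -[x ^+ 2]real_normK ?num_real//.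
    have -> : (M' + 1) * e1 / 2 + (M' + 1) / (2 * e1) * `|x| ^+ 2 =
        (M' + 1) * `|x| + (M' + 1) / (2 * e1) * (e1 - `|x|) ^+ 2.
      by field; rewrite gt_eqF.
    by rewrite lerDl mulr_ge0 ?sqr_ge0// divr_ge0// mulr_ge0// ltW.
  rewrite ExD//; [|exact: L1_cst|exact: L1Z].
  rewrite Ex_cst ExZ//.
  apply: (@le_trans _ _ ((M' + 1) * e1 / 2 + (M' + 1) / (2 * e1) * e1 ^+ 2)).
    by rewrite lerD2l ler_wpM2l// divr_ge0// mulr_ge0// ltW.
  have -> : (M' + 1) * e1 / 2 + (M' + 1) / (2 * e1) * e1 ^+ 2 = (M' + 1) * e1.
    by field; rewrite gt_eqF.
  rewrite /e1 mulrA ler_pdivrMr// mulrC ler_pM2l//; lra.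
Qed.

End ItoIsometry.

Lemma measurable_space_integral {R : realType} {d : measure_display} {T : measurableType d}
    (P : probability T R) (s t : R) (f : R * T -> R) :
  measurable_fun (`[s, t] `*` setT) f -> (forall z, 0 <= f z) ->
  measurable_fun `[s, t] (fun u => \int[P]_w (f (u, w))%:E)%E.
Proof.
move=> mf f0.
have mD : @measurable _ (measurableTypeR R * T)%type (`[s, t] `*` setT).
  by apply: measurableX => //; exact: measurable_itv.
have mp : @measurable_fun _ _ (measurableTypeR R * T)%type _ setT
    ((fun z => (f z)%:E) \_ (`[s, t] `*` setT)).
  by apply/(measurable_restrictT _ mD); apply/measurable_EFinP; exact: mf.
have p0 z : (0 <= ((fun z => (f z)%:E) \_ (`[s, t] `*` setT)) z)%E.
  by rewrite patchE; case: ifP => // _; rewrite lee_fin.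
have mF := measurable_fun_fubini_tonelli_F (m2 := P) _ mp p0.
suff : @measurable_fun _ _ (measurableTypeR R) _ `[s, t] (fun u => \int[P]_w (f (u, w))%:E)%E by [].
apply: eq_measurable_fun (measurable_funTS mF) => u ust; apply: eq_integral => w _.
by rewrite patchE mem_set//; split => //; exact: set_mem.
Qed.

(** * Bounds for time integrals and almost sure comparison *)

Section SpaceTimeBounds.
Context {R : realType} {d : measure_display} {T : measurableType d}.
Variable P : probability T R.

Lemma Ex_le_ae (f g : T -> R) : L1 P f -> L1 P g -> {ae P, forall w, f w <= g w} ->
  Ex P f <= Ex P g.
Proof.
(* The minimum is below g everywhere and equals f almost surely, which reduces the claim to a
   pointwise comparison. *)
move=> fi gi fg; pose m w := Num.min (f w) (g w).
have mm : measurable_fun setT m.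
  by apply: measurable_minr; [exact: (L1_measurable fi)|exact: (L1_measurable gi)].
have fm : {ae P, forall w, f w = m w} by apply: filterS fg => w /min_idPl H; rewrite /m H.
rewrite (Ex_ae (L1_measurable fi) mm fm); apply: Ex_le => // [|w].
  exact: L1_ae fm fi.
by rewrite /m ge_min lexx orbT.
Qed.

Variables s t : R.
Hypothesis st : s <= t.

Lemma ts_integral_le_const (f : R * T -> R) (c : R) : 0 <= c ->
  measurable_fun (`[s, t] `*` setT) f -> (forall z, 0 <= f z) ->
  (forall u, s <= u <= t -> (\int[P]_w (f (u, w))%:E <= c%:E)%E) ->
  (ts_integral P s t f <= (c * (t - s))%:E)%E.
Proof.
move=> c0 mf f0 fc; rewrite ts_integral_tonelli//.
have mF : measurable_fun `[s, t] (fun u => \int[P]_w (f (u, w))%:E)%E.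
  exact: measurable_space_integral.
apply: (@le_trans _ _ (\int[lebesgue_measure]_(u in `[s, t]) c%:E)%E).
  apply: ge0_le_integral => //.
  by move=> u _; apply: integral_ge0 => w _; rewrite lee_fin.
rewrite integral_cst//= lebesgue_measure_itv /= lte_fin.
case: ltP => [_|ts]; first by rewrite -EFinD -EFinM.
by rewrite mule0 lee_fin mulr_ge0// subr_ge0.
Qed.

Lemma integrable_itv_bounded (f : R -> R) (M : R) : measurable_fun `[s, t] f ->
  (forall u, s <= u <= t -> `|f u| <= M) ->
  lebesgue_measure.-integrable `[s, t] (EFin \o f).
Proof.
move=> mf fM; apply: measurable_bounded_integrable => //.
  by rewrite /= lebesgue_measure_itv /=; case: ifP => _; rewrite ?ltry// -EFinD ltry.
exists M; split; first exact: num_real.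
move=> x Mx u /= ust; rewrite (le_trans (fM u _))// ?ltW//.
Qed.

Lemma Rintegral_itv_cst (c : R) : Rintegral lebesgue_measure `[s, t] (fun=> c) = (t - s) * c.
Proof.
have := Rintegral_cst (@lebesgue_measure R) (measurable_itv `[s, t]) c.
rewrite /= lebesgue_measure_itv /= lte_fin => ->.
case: ltP => [_|ts]; first by rewrite mulrC.
have -> : t = s by apply/le_anti; rewrite st ts.
by rewrite subrr /= mulr0 mul0r.
Qed.

Lemma Rintegral_sub_cst_le (f g : R -> R) (c M : R) :
  measurable_fun `[s, t] f -> measurable_fun `[s, t] g ->
  (forall u, s <= u <= t -> `|f u| <= M) -> (forall u, s <= u <= t -> `|g u| <= M) ->
  (forall u, s <= u <= t -> `|f u - c| <= g u) ->
  `|Rintegral lebesgue_measure `[s, t] f - (t - s) * c| <= Rintegral lebesgue_measure `[s, t] g.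
Proof.
move=> mf mg fM gM fcg.
have fi := integrable_itv_bounded mf fM; have gi := integrable_itv_bounded mg gM.
have ci : lebesgue_measure.-integrable `[s, t] (EFin \o (fun=> c)).
  by apply: (@integrable_itv_bounded _ `|c|).
have fci : lebesgue_measure.-integrable `[s, t] (EFin \o (fun u => f u - c)).
  by apply: (integrableB _ fi ci).
rewrite -Rintegral_itv_cst -RintegralB//.
apply: (le_trans (le_normr_Rintegral _ fci)) => //.
apply: le_Rintegral => //.
by apply: integrable_abse fci.
Qed.

End SpaceTimeBounds.

(* Here xi stands for the Gaussian Euler increment, rho = D + r for the rest of the increment,
   and A, A1 for the function and its derivative at the Euler point; cross terms are split by AM-GM with weight e. *)
Lemma euler_remainder_le {R : realType} (B e h p0 p1 p2 A A1 A2 xi rho D r b q : R) :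
  0 <= B -> 0 < e -> e <= 1 -> rho = D + r -> `|p1| <= B ->
  `|A2 - A - A1 * rho| <= B * rho ^+ 2 -> `|A1 - p1| <= B * `|xi| ->
  `|A - p0 - p1 * xi - p2 * (xi ^+ 2 / 2)| <= B * `|xi| ^+ 3 ->
  `|A2 - p0 - h * (p1 * b + p2 * q) - p1 * r - p1 * xi - p2 * (xi ^+ 2 / 2 - h * q)|
   <= B * (2 / e * rho ^+ 2 + 2 * e * xi ^+ 2 + e^-1 * xi ^+ 4 + `|D - h * b|).
Proof.
move=> B0 e0 e1 rhoE p1B hA2 hA1 hA.
have -> : A2 - p0 - h * (p1 * b + p2 * q) - p1 * r - p1 * xi - p2 * (xi ^+ 2 / 2 - h * q) =
  (A2 - A - A1 * rho) + ((A1 - p1) * rho + (p1 * (D - h * b) + (A - p0 - p1 * xi - p2 * (xi ^+ 2 / 2)))).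
  by rewrite rhoE; ring.
have ei : 1 <= e^-1 by rewrite invf_ge1.
have amgm (y z : R) : 0 <= y -> 0 <= z -> y * z <= (e * y ^+ 2 + e^-1 * z ^+ 2) / 2.
  move=> y0 z0; rewrite -subr_ge0.
  have -> : (e * y ^+ 2 + e^-1 * z ^+ 2) / 2 - y * z = e^-1 / 2 * (e * y - z) ^+ 2.
    by field; rewrite gt_eqF.
  by rewrite mulr_ge0 ?sqr_ge0// divr_ge0// invr_ge0 ltW.
have h1 : `|(A1 - p1) * rho| <= B * ((e * xi ^+ 2 + e^-1 * rho ^+ 2) / 2).
  rewrite normrM; apply: (@le_trans _ _ (B * `|xi| * `|rho|)); first by rewrite ler_wpM2r.
  rewrite -mulrA ler_wpM2l//; apply: (le_trans (amgm _ _ (normr_ge0 _) (normr_ge0 _))).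
  by rewrite !real_normK ?num_real.
have h2 : B * `|xi| ^+ 3 <= B * ((e * xi ^+ 2 + e^-1 * xi ^+ 4) / 2).
  rewrite ler_wpM2l// exprS; apply: (le_trans (amgm _ _ (normr_ge0 _) (sqr_ge0 _))).
  by rewrite !real_normK ?num_real// -exprM.
have h3 : `|p1 * (D - h * b)| <= B * `|D - h * b| by rewrite normrM ler_wpM2r.
have h4 : B * rho ^+ 2 <= B * (e^-1 * rho ^+ 2).
  by rewrite ler_wpM2l// ler_peMl// sqr_ge0.
have q1 : 0 <= B * (e * xi ^+ 2) by rewrite mulr_ge0// mulr_ge0 ?sqr_ge0// ltW.
have q2 : 0 <= B * (e^-1 * rho ^+ 2) by rewrite mulr_ge0// mulr_ge0 ?sqr_ge0// invr_ge0 ltW.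
have q3 : 0 <= B * (e^-1 * xi ^+ 4).
  by rewrite mulr_ge0// mulr_ge0 ?exprn_even_ge0// invr_ge0 ltW.
apply: (le_trans (ler_normD _ _)).
have := ler_normD ((A1 - p1) * rho) (p1 * (D - h * b) + (A - p0 - p1 * xi - p2 * (xi ^+ 2 / 2))).
have := ler_normD (p1 * (D - h * b)) (A - p0 - p1 * xi - p2 * (xi ^+ 2 / 2)).
have -> : 2 / e * rho ^+ 2 = 2 * (e^-1 * rho ^+ 2) by rewrite mulrA.
by lra.
Qed.

Lemma sqr_sum3_le {R : realType} (D K r r1 r2 : R) : D ^+ 2 <= K ^+ 2 -> r = r1 - r2 ->
  2 * D ^+ 2 + 2 * r ^+ 2 <= 2 * K ^+ 2 + 4 * r1 ^+ 2 + 4 * r2 ^+ 2.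
Proof. by move=> DK ->; have := sqrD_le r1 (- r2); rewrite sqrrN; lra. Qed.

Lemma sqr_sum_fourth {R : realType} (x y : R) :
  2 * (8 * x ^+ 2) ^+ 2 + 2 * (2 * y ^+ 2) ^+ 2 = 128 * x ^+ 4 + 8 * y ^+ 4.
Proof. ring. Qed.

Lemma euler_remainder_arith {R : realType} (K2 K E r1 r2 : R) : r1 <= 16 * K * E -> r2 <= 16 * K * E ->
  2 * (K2 * E) + 4 * r1 + 4 * r2 <= (2 * K2 + 128 * K) * E.
Proof. lra. Qed.

(** The bookkeeping of orders with h = e^2: the expectations of rho^2 and xi^4 are of order e^4 and
    are divided by e, that of xi^2 is of order e^2 and is multiplied by e, so that everything
    becomes e^3. *)
Lemma euler_error_arith {R : realType} (e Kr c x2 x4 r2 dd Dd : R) : 0 < e ->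
  r2 <= Kr * e ^+ 4 -> x2 <= 10 * e ^+ 2 -> x4 <= c * (e ^+ 2) ^+ 2 -> dd <= Dd * e ^+ 3 ->
  2 / e * r2 + 2 * e * x2 + e^-1 * x4 + dd <= (2 * Kr + 20 + c + Dd) * e ^+ 3.
Proof.
move=> e0 h1 h2 h3 h4.
have -> : (2 * Kr + 20 + c + Dd) * e ^+ 3 =
    2 / e * (Kr * e ^+ 4) + 2 * e * (10 * e ^+ 2) + e^-1 * (c * (e ^+ 2) ^+ 2) + Dd * e ^+ 3.
  by field; rewrite gt_eqF.
have i0 : 0 <= e^-1 by rewrite invr_ge0 ltW.
have e2 : 0 <= 2 * e by rewrite mulr_ge0// ltW.
have e3 : 0 <= 2 / e by rewrite mulr_ge0.
by rewrite !lerD// ler_wpM2l.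
Qed.

Lemma time_average_expectation {R : realType} {d : measure_display} {T : measurableType d}
    (P : probability T R) (s t : R) (g : R * T -> R) (c M : R) : s <= t ->
  measurable_fun (`[s, t] `*` setT) g -> (forall z, 0 <= g z) -> (forall z, g z <= M) -> 0 <= c ->
  (forall u, s <= u <= t -> (\int[P]_w (g (u, w))%:E <= c%:E)%E) ->
  L1 P (fun w => Rintegral lebesgue_measure `[s, t] (fun u => g (u, w))) /\
  Ex P (fun w => Rintegral lebesgue_measure `[s, t] (fun u => g (u, w))) <= c * (t - s).
Proof.
move=> st mg g0 gM c0 gc; set V := (fun w => _).
have VE w : (V w)%:E = (\int[lebesgue_measure]_(u in `[s, t]) (g (u, w))%:E)%E.
  rewrite /V /Rintegral fineK//; apply: integrable_fin_num => //.
  apply: (integrable_itv_bounded (M := M)); first exact: measurable_fun_time_section.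
  by move=> u _; rewrite ger0_norm.
have mV : measurable_fun setT V.
  apply/measurable_EFinP; have := measurable_time_integral mg g0.
  by apply: eq_measurable_fun => w _; rewrite /= VE.
have le : (\int[P]_w (V w)%:E <= (c * (t - s))%:E)%E.
  under eq_integral do rewrite VE.
  exact: (ts_integral_le_const st c0 mg g0 gc).
have LV : L1 P V.
  apply: L1_ge0 => //; first by move=> w; apply: Rintegral_ge0.
  by apply: le_lt_trans le _; rewrite ltry.
by split => //; rewrite -lee_fin -Ex_EFin.
Qed.

(** * One Euler step for the expectation of a wave *)

Section WeakExpansion.
Context {R : realType} {d : measure_display} {T : measurableType d}.
Variables (P : probability T R) (Z : R -> T -> R[i]).
Hypothesis ZBM : two_sided_complex_BM P Z.
Variables (beta : R) (n : nat) (lambda : R) (a : R -> T -> R).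
Hypothesis beta_gt0 : 0 < beta.
Hypothesis sol : is_strong_solution P Z beta n lambda a.

Let F := noise_filtration P Z.
Let X u w := complex.Re (Z u w).
Let Y u w := complex.Im (Z u w).
(** [H1] and [H2] are the real and imaginary parts of e^(-i a) - 1. *)
Let H1 u w := cos (a u w) - 1.
Let H2 u w := - sin (a u w).

Definition det_drift (u : R) : R := lambda * (beta / 4) * expR (beta / 4 * u).
(** The sine term is the real part of (e^(-i a) - 1)(- i n). *)
Definition drift (u : R) (w : T) : R := det_drift u - n%:R * sin (a u w).
Definition drift_bound (T0 : R) : R := `|det_drift T0| + n%:R.

Let mXY := noise_filtration_measurable ZBM.

Let adapted u : sigma_measurable (F u) (a u).
Proof. by case: sol. Qed.

Lemma solution_measurable u : measurable_fun setT (a u).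
Proof. exact: (sigma_measurable_fun (@noise_filtration_measurable _ _ _ _ _ ZBM u) (@adapted u)). Qed.

Let H1_adapted u : sigma_measurable (F u) (H1 u).
Proof.
apply: (@sigma_measurable_comp _ _ _ _ _ (fun x : R => cos x - 1) _ (@adapted u)).
by apply: measurable_funB => //; exact: continuous_measurable_fun (@continuous_cos R).
Qed.

Let H2_adapted u : sigma_measurable (F u) (H2 u).
Proof.
apply: (@sigma_measurable_comp _ _ _ _ _ (fun x : R => - sin x) _ (@adapted u)).
apply: measurableT_comp => //; exact: continuous_measurable_fun (@continuous_sin R).
Qed.

Let H1_le u w : `|H1 u w| <= 2.
Proof. by apply: (le_trans (ler_normB _ _)); rewrite normr1; have := cos_max (a u w); lra. Qed.

Let H2_le u w : `|H2 u w| <= 1.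
Proof. by rewrite normrN; exact: sin_max. Qed.

Let H2_le2 u w : `|H2 u w| <= 2.
Proof. by apply: (le_trans (H2_le u w)); lra. Qed.

Lemma det_drift_le (u T0 : R) : u <= T0 -> `|det_drift u| <= `|det_drift T0|.
Proof.
move=> uT; rewrite /det_drift !normrM ler_wpM2l// !ger0_norm ?expR_ge0//.
by rewrite ler_expR ler_pM2l// divr_gt0.
Qed.

Lemma drift_le (u T0 : R) w : u <= T0 -> `|drift u w| <= drift_bound T0.
Proof.
move=> uT; apply: (le_trans (ler_normB _ _)); apply: lerD; first exact: det_drift_le.
by rewrite normrM normr_nat ler_piMr// sin_max.
Qed.

Lemma det_drift_lipschitz (u v T0 : R) : u <= v -> v <= T0 ->
  `|det_drift v - det_drift u| <= `|det_drift T0| * (beta / 4) * (v - u).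
Proof.
move=> uv vT; have b4 : 0 < beta / 4 by rewrite divr_gt0.
rewrite -mulrBr normrM.
have e1 : expR (beta / 4 * v) - expR (beta / 4 * u) <= expR (beta / 4 * v) * (beta / 4 * (v - u)).
  have := expR_ge1Dx (beta / 4 * u - beta / 4 * v); rewrite expRB => h.
  have ev := expR_gt0 (beta / 4 * v).
  move: h; rewrite ler_pdivlMr// => h.
  have -> : beta / 4 * (v - u) = beta / 4 * v - beta / 4 * u by ring.
  nra.
have e0 : 0 <= expR (beta / 4 * v) - expR (beta / 4 * u).
  by rewrite subr_ge0 ler_expR ler_pM2l.
rewrite (ger0_norm e0); apply: (@le_trans _ _ (`|det_drift v| * (beta / 4 * (v - u)))).
  have -> : `|det_drift v| = `|lambda * (beta / 4)| * expR (beta / 4 * v).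
    by rewrite /det_drift normrM (ger0_norm (expR_ge0 _)).
  by rewrite -[X in _ <= X]mulrA ler_wpM2l.
by rewrite mulrA ler_wpM2r ?subr_ge0// ler_wpM2r ?det_drift_le// ltW.
Qed.

Let solution_integrals s t : s < t -> exists I1 I2,
  [/\ is_ito_integral P F X s t H1 I1, is_ito_integral P F Y s t H2 I2 &
   {ae P, forall w, a t w - a s w =
     Rintegral lebesgue_measure `[s, t] (fun u => drift u w) + (I1 w - I2 w)}].
Proof.
move=> st; have [_ _ /(_ s t st) [I [[I1 [I2 [i1 i2 iE]]] ae]] _] := sol.
exists I1, I2; split.
- have -> : H1 = fun u w => complex.Re (cis (- a u w) - 1).
    by apply/funext => u; apply/funext => w; rewrite /H1 /= cosN.
  exact: i1.
- have -> : H2 = fun u w => complex.Im (cis (- a u w) - 1).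
    by apply/funext => u; apply/funext => w; rewrite /H2 /= sinN subr0.
  exact: i2.
- apply: filterS ae => w ->; rewrite iE; congr (_ + _).
  apply: eq_Rintegral => u _; rewrite /drift /det_drift /=; congr (_ + _).
  by rewrite sinN; ring.
Qed.

Let measurable_H2_section (s t : R) (w : T) : s < t -> measurable_fun `[s, t] (fun u => H2 u w).
Proof.
move=> st; have [I1 [I2 [_ [[mH _ _] _ _] _]]] := solution_integrals st.
exact: (measurable_fun_time_section w mH).
Qed.

Let measurable_drift_section (s t : R) (w : T) : s < t -> measurable_fun `[s, t] (fun u => drift u w).
Proof.
move=> st; have -> : (fun u => drift u w) = fun u => det_drift u + n%:R * H2 u w.
  by apply/funext => u; rewrite /drift /H2 mulrN.
apply: measurable_funD.
  apply: measurable_funTS; apply: measurable_funM => //.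
  by apply: measurableT_comp => //; exact: measurable_funM.
by apply: measurable_funM => //; exact: measurable_H2_section.
Qed.

(* D is the drift integral, truncated so that it is bounded everywhere and not only almost everywhere. *)
Lemma solution_decomposition s t T0 : s < t -> t <= T0 -> exists D I1 I2 : T -> R,
  [/\ is_ito_integral P F X s t H1 I1, is_ito_integral P F Y s t H2 I2,
   measurable_fun setT D /\ (forall w, `|D w| <= drift_bound T0 * (t - s)),
   {ae P, forall w, a t w = a s w + D w + (I1 w - I2 w)} &
   {ae P, forall w, D w = Rintegral lebesgue_measure `[s, t] (fun u => drift u w)}].
Proof.
move=> st tT; have [I1 [I2 [i1 i2 ae]]] := solution_integrals st.
have mI1 : measurable_fun setT I1 by case: i1.
have mI2 : measurable_fun setT I2 by case: i2.
pose K := drift_bound T0 * (t - s).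
have ts0 : 0 <= t - s by rewrite subr_ge0 ltW.
have K0 : 0 <= K by rewrite mulr_ge0// addr_ge0.
pose D0 w := a t w - a s w - (I1 w - I2 w).
have mD0 : measurable_fun setT D0.
  apply: measurable_funB; first by apply: measurable_funB; exact: solution_measurable.
  exact: measurable_funB.
pose D w := Num.max (- K) (Num.min K (D0 w)).
have bound w : `|Rintegral lebesgue_measure `[s, t] (fun u => drift u w)| <= K.
  have dT u : s <= u <= t -> `|drift u w| <= drift_bound T0.
    by move=> /andP[_ ut]; apply: drift_le; exact: le_trans tT.
  have := @Rintegral_sub_cst_le _ s t (ltW st) (fun u => drift u w) (fun=> drift_bound T0) 0 (drift_bound T0).
  rewrite mulr0 subr0 Rintegral_itv_cst ?(ltW st)// mulrC; apply => //.
  - exact: measurable_drift_section.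
  - by move=> u _; rewrite ger0_norm// addr_ge0.
  - by move=> u ust; rewrite subr0; exact: dT.
have aeD : {ae P, forall w, D0 w = Rintegral lebesgue_measure `[s, t] (fun u => drift u w)}.
  by apply: filterS ae => w; rewrite /D0 => ->; rewrite addrK.
have DD0 w : D0 w = Rintegral lebesgue_measure `[s, t] (fun u => drift u w) -> D w = D0 w.
  move=> E; have := bound w; rewrite -E ler_norml => /andP[h1 h2].
  by rewrite /D (min_idPr h2) (max_idPr h1).
exists D, I1, I2; split => //.
- split.
    by apply: measurable_maxr => //; exact: measurable_minr.
  move=> w; rewrite ler_norml /D le_max lexx /= ge_max ge_min lexx /= andbT.
  by apply: (@le_trans _ _ 0) => //; rewrite oppr_le0.
- apply: filterS aeD => w /DD0 ->; rewrite /D0; ring.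
- by apply: filterS aeD => w E; rewrite (DD0 _ E).
Qed.

Let zero_adapted u : sigma_measurable (F u) (fun=> 0 : R).
Proof. exact: sigma_measurable_cst. Qed.

Let ito_second_moment (W : R -> T -> R) s t (H : R -> T -> R) I (M : R) : noise_integrator P Z W -> s < t -> 0 <= M ->
  is_ito_integral P F W s t H I -> (forall u w, `|H u w| <= M) ->
  L2 P I /\ Ex P (fun w => I w ^+ 2) <= 4 * (M ^+ 2 * (t - s)).
Proof.
move=> Wint st M0 iI HM; have [[mH Had _] _ _] := iI.
have z0 (w : T) : `|0 : R| <= 0 by rewrite normr0.
have [I2 EI _] := ito_bound ZBM Wint st iI (@zero_adapted s) z0.
split => //; rewrite -lee_fin.
have -> : Ex P (fun w => I w ^+ 2) = Ex P (fun w => (I w - 0 * increment W s t w) ^+ 2).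
  by congr (Ex P _); apply/funext => w; rewrite mul0r subr0.
apply: (le_trans EI); rewrite EFinM lee_pmul2l//.
apply: ts_integral_le_const; rewrite ?sqr_ge0 ?(ltW st)//.
- by apply: measurable_funX; apply: measurable_funB => //; exact: mH.
- by move=> z; exact: sqr_ge0.
- move=> u ust; have mHu : measurable_fun setT (H u).
    exact: (sigma_measurable_fun (@mXY u) (Had u ust)).
  have [_ iH2] := L2_bounded P mHu (HM u).
  under eq_integral do rewrite /= subr0.
  rewrite (Ex_EFin iH2) lee_fin -[X in _ <= X](Ex_cst P).
  apply: Ex_le => //; first exact: L1_cst.
  by move=> w; rewrite -[X in X <= _]real_normK ?num_real// lerXn2r ?nnegrE.
Qed.

Lemma increment_second_moment T0 : exists2 K : R, 0 <= K &
  forall s t : R, s < t -> t <= T0 -> t - s <= 1 ->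
    L1 P (fun w => (a t w - a s w) ^+ 2) /\ Ex P (fun w => (a t w - a s w) ^+ 2) <= K * (t - s).
Proof.
pose K0 := drift_bound T0; have K00 : 0 <= K0 by rewrite addr_ge0.
(* By [ito_second_moment] the integrals of H1 and H2 have second moments at most 16 h and 4 h for h
   = t - s; each is weighted by 4 in [sqr_sum3_le], and 80 = 64 + 16. *)
exists (2 * K0 ^+ 2 + 80); first by have := sqr_ge0 K0; lra.
move=> s t st tT ts1; have ts0 : 0 < t - s by rewrite subr_gt0.
have [D [I1 [I2 [i1 i2 [mD DK] aE _]]]] := solution_decomposition st tT.
have [L1I EI1] := ito_second_moment (noise_integrator_Re ZBM) st (ler0n R 2) i1 H1_le.
have [L2I EI2] := ito_second_moment (noise_integrator_Im ZBM) st ler01 i2 H2_le.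
have LD := L2_bounded P mD DK.
have LS : L2 P (fun w => D w + (I1 w - I2 w)) by apply: L2D => //; exact: L2B.
have ma : measurable_fun setT (fun w => (a t w - a s w) ^+ 2).
  by apply: measurable_funX; apply: measurable_funB; exact: solution_measurable.
have ae2 : {ae P, forall w, (D w + (I1 w - I2 w)) ^+ 2 = (a t w - a s w) ^+ 2}.
  by apply: filterS aE => w ->; congr (_ ^+ 2); ring.
split; first exact: L1_ae ma ae2 LS.2.
rewrite -(Ex_ae (L1_measurable LS.2) ma ae2).
pose G (w : T) : R := 2 * (K0 * (t - s)) ^+ 2 + 4 * I1 w ^+ 2 + 4 * I2 w ^+ 2.
apply: (@le_trans _ _ (Ex P G)).
  apply: Ex_le => [||w]; first exact: LS.2.
    apply: L1D; last exact: L1Z _ L2I.2.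
    by apply: L1D; [exact: L1_cst|exact: L1Z _ L1I.2].
  apply: (le_trans (sqrD_le _ _)).
  apply: sqr_sum3_le => //.
  rewrite -[X in X <= _]real_normK ?num_real// lerXn2r ?nnegrE ?DK//.
  by rewrite mulr_ge0// ltW.
rewrite /G ExD; [|by apply: L1D; [exact: L1_cst|exact: L1Z _ L1I.2]|exact: L1Z _ L2I.2].
rewrite ExD; [|exact: L1_cst|exact: L1Z _ L1I.2].
rewrite Ex_cst (ExZ _ L1I.2) (ExZ _ L2I.2) exprMn.
have h2 : (t - s) ^+ 2 <= t - s by rewrite expr2 ler_piMr// ltW.
have : K0 ^+ 2 * (t - s) ^+ 2 <= K0 ^+ 2 * (t - s) by rewrite ler_wpM2l// sqr_ge0.
move: EI1 EI2; rewrite !expr2; lra.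
Qed.

Let H_increment (H : R -> T -> R) : (forall u w v, `|H u w - H v w| <= 2 * `|a u w - a v w|) ->
  (forall u, measurable_fun setT (H u)) -> (forall u w, `|H u w| <= 2) ->
  forall T0 K : R, (forall s t : R, s < t -> t <= T0 -> t - s <= 1 ->
    L1 P (fun w => (a t w - a s w) ^+ 2) /\ Ex P (fun w => (a t w - a s w) ^+ 2) <= K * (t - s)) ->
  0 <= K -> forall s t u : R, s <= u <= t -> s < t -> t <= T0 -> t - s <= 1 ->
  L1 P (fun w => (H u w - H s w) ^+ 2) /\ Ex P (fun w => (H u w - H s w) ^+ 2) <= 4 * K * (t - s).
Proof.
move=> HL mH H2b T0 K hK K0 s t u /andP[su ut] st tT ts1.
have L : L2 P (fun w => H u w - H s w).
  by apply: L2B; [exact: L2_bounded (H2b u)|exact: L2_bounded (H2b s)].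
split; first exact: L.2.
move: su; rewrite le_eqVlt => /predU1P[<-|su].
  under [in Ex P _]eq_fun do rewrite subrr expr0n /=.
  by rewrite Ex_cst !mulr_ge0// subr_ge0 ltW.
have [La Ea] := hK s u su (le_trans ut tT) (le_trans (lerB ut (lexx s)) ts1).
apply: (@le_trans _ _ (Ex P (fun w => 4 * (a u w - a s w) ^+ 2))).
  apply: Ex_le => [||w]; [exact: L.2|exact: L1Z|].
  rewrite -[X in X <= _]real_normK ?num_real// -[(a u w - a s w) ^+ 2]real_normK ?num_real//.
  have -> : 4 * `|a u w - a s w| ^+ 2 = (2 * `|a u w - a s w|) ^+ 2 by ring.
  by rewrite lerXn2r ?nnegrE ?mulr_ge0// HL.
rewrite ExZ// -mulrA ler_pM2l//; apply: (le_trans Ea).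
by rewrite ler_wpM2l// lerB.
Qed.

Let H1_lip u w v : `|H1 u w - H1 v w| <= 2 * `|a u w - a v w|.
Proof.
have -> : H1 u w - H1 v w = cos (a v w + (a u w - a v w)) - cos (a v w).
  by rewrite [a v w + _]addrC subrK /H1; ring.
exact: cos_lipschitz.
Qed.

Let H2_lip u w v : `|H2 u w - H2 v w| <= 2 * `|a u w - a v w|.
Proof.
have -> : H2 u w - H2 v w = - (sin (a v w + (a u w - a v w)) - sin (a v w)).
  by rewrite [a v w + _]addrC subrK /H2; ring.
by rewrite normrN; exact: sin_lipschitz.
Qed.

Let mH1 u : measurable_fun setT (H1 u).
Proof. exact: (sigma_measurable_fun (@mXY u) (@H1_adapted u)). Qed.

Let mH2 u : measurable_fun setT (H2 u).
Proof. exact: (sigma_measurable_fun (@mXY u) (@H2_adapted u)). Qed.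

(** On [s, t] the integrand deviates from its value at s by order h in mean square, by the Lipschitz
    bound and [increment_second_moment]; integrating over a time h gives order h^2. *)
Let ito_euler (W : R -> T -> R) (H : R -> T -> R) : noise_integrator P Z W ->
  (forall u w v, `|H u w - H v w| <= 2 * `|a u w - a v w|) ->
  (forall u, sigma_measurable (F u) (H u)) -> (forall u w, `|H u w| <= 2) ->
  forall T0 K : R, (forall s t : R, s < t -> t <= T0 -> t - s <= 1 ->
    L1 P (fun w => (a t w - a s w) ^+ 2) /\ Ex P (fun w => (a t w - a s w) ^+ 2) <= K * (t - s)) ->
  0 <= K -> forall (s t : R) I, s < t -> t <= T0 -> t - s <= 1 -> is_ito_integral P F W s t H I ->
  [/\ L2 P (fun w => I w - H s w * increment W s t w),
     Ex P (fun w => (I w - H s w * increment W s t w) ^+ 2) <= 16 * K * (t - s) ^+ 2 &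
     forall (zeta : T -> R) (M : R), sigma_measurable (F s) zeta -> (forall w, `|zeta w| <= M) ->
       Ex P (fun w => zeta w * (I w - H s w * increment W s t w)) = 0].
Proof.
move=> Wint HL Had H2b T0 K hK K0 s t I st tT ts1 iI.
have mH u : measurable_fun setT (H u) := sigma_measurable_fun (@mXY u) (Had u).
have [I2 EI zI] := ito_bound ZBM Wint st iI (Had s) (H2b s).
have [[mHD _ _] _ _] := iI.
have [Wad Wi] := Wint.
have W2 : L2 P (increment W s t).
  split; first exact: (sigma_measurable_fun (@mXY t) (Wad s t (ltW st))).
  have [_ _ + _] := Wi s t (fun=> 1) st (@sigma_measurable_cst _ _ _ _ 1) (L1_cst P 1).
  by under eq_fun do rewrite mul1r.
split => //.
- by apply: L2B => //; exact: L2_bM (mH s) (H2b s) W2.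
- rewrite -lee_fin; apply: (le_trans EI).
  have -> : 16 * K * (t - s) ^+ 2 = 4 * ((4 * K * (t - s)) * (t - s)) by ring.
  rewrite [leRHS]EFinM lee_pmul2l//; apply: ts_integral_le_const; first exact: ltW.
  + by rewrite !mulr_ge0// subr_ge0 ltW.
  + apply: measurable_funX; apply: measurable_funB => //.
    exact: measurable_fun_spaceD.
  + by move=> z; exact: sqr_ge0.
  + move=> u ust.
    have [L E] := H_increment HL mH H2b hK K0 ust st tT ts1.
    by rewrite (Ex_EFin L) lee_fin.
Qed.

(** Only an L^1 bound is needed here. The stochastic part of the drift moves by order e in mean over
    a time e^2, so its integral errs by order e^3; the deterministic part contributes order e^4. *)
Let drift_euler T0 K : (forall s t : R, s < t -> t <= T0 -> t - s <= 1 ->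
    L1 P (fun w => (a t w - a s w) ^+ 2) /\ Ex P (fun w => (a t w - a s w) ^+ 2) <= K * (t - s)) ->
  0 <= K -> forall (s t e : R) (D : T -> R), s < t -> t <= T0 -> 0 < e -> e <= 1 -> t - s = e ^+ 2 ->
  (forall w, `|D w| <= drift_bound T0 * (t - s)) -> measurable_fun setT D ->
  {ae P, forall w, D w = Rintegral lebesgue_measure `[s, t] (fun u => drift u w)} ->
  L1 P (fun w => `|D w - (t - s) * drift s w|) /\
  Ex P (fun w => `|D w - (t - s) * drift s w|) <=
    (`|det_drift T0| * (beta / 4) + n%:R / 2 + 2 * n%:R * K) * e ^+ 3.
Proof.
move=> hK K0 s t e D st tT e0 e1 tse DK mD aeD.
have ts1 : t - s <= 1 by rewrite tse expr_le1// ltW.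
have ts0 : 0 < t - s by rewrite subr_gt0.
have b4 : 0 < beta / 4 by rewrite divr_gt0.
set L := `|det_drift T0| * (beta / 4).
have L0 : 0 <= L by rewrite mulr_ge0// ltW.
(* Majorant of the drift deviation on [s, t], using |x| <= e / 2 + x^2 / (2 e) to pass from the
   known second moment to a first moment. *)
pose g (z : R * T) := L * (t - s) + n%:R * (e / 2 + (2 * e)^-1 * (H2 z.1 z.2 - H2 s z.2) ^+ 2).
have [I1 [I2 [_ [[mHD _ _] _ _] _]]] := solution_integrals st.
have ie0 : 0 <= (2 * e)^-1 by rewrite invr_ge0 mulr_ge0// ltW.
have mg : measurable_fun (`[s, t] `*` setT) g.
  apply: measurable_funD => //; apply: measurable_funM => //; apply: measurable_funD => //.
  apply: measurable_funM => //; apply: measurable_funX; apply: measurable_funB => //.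
  exact: measurable_fun_spaceD.
have g0 z : 0 <= g z.
  apply: addr_ge0; first by rewrite mulr_ge0// ltW.
  by rewrite mulr_ge0// addr_ge0 ?divr_ge0 ?(ltW e0)// mulr_ge0// sqr_ge0.
pose M := L * (t - s) + n%:R * (e / 2 + (2 * e)^-1 * 4).
have gM z : g z <= M.
  rewrite lerD2l ler_wpM2l// lerD2l ler_wpM2l//.
  rewrite -[X in X <= _]real_normK ?num_real//.
  have : `|H2 z.1 z.2 - H2 s z.2| <= 2.
    by apply: (le_trans (ler_normB _ _)); have := H2_le z.1 z.2; have := H2_le s z.2; lra.
  by move=> h; have := lerXn2r 2 (normr_ge0 _) (ler0n R 2) h; rewrite -natrX.
pose c := L * (t - s) + n%:R * (e / 2 + (2 * e)^-1 * (4 * K * (t - s))).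
have c0 : 0 <= c.
  apply: addr_ge0; first by rewrite mulr_ge0// ltW.
  rewrite mulr_ge0// addr_ge0 ?divr_ge0 ?(ltW e0)// mulr_ge0// mulr_ge0 ?(ltW ts0)//.
  exact: mulr_ge0.
have gc u : s <= u <= t -> (\int[P]_w (g (u, w))%:E <= c%:E)%E.
  move=> ust; have [LH EH] := H_increment H2_lip mH2 H2_le2 hK K0 ust st tT ts1.
  have L2 : L1 P (fun w => e / 2 + (2 * e)^-1 * (H2 u w - H2 s w) ^+ 2).
    by apply: L1D; [exact: L1_cst|exact: L1Z].
  have Lg : L1 P (fun w => g (u, w)) by apply: L1D; [exact: L1_cst|exact: L1Z].
  rewrite (Ex_EFin Lg) lee_fin /g /= ExD; [|exact: L1_cst|exact: L1Z].
  rewrite Ex_cst lerD2l ExZ// ler_wpM2l// ExD; [|exact: L1_cst|exact: L1Z].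
  by rewrite Ex_cst lerD2l ExZ// ler_wpM2l.
have [LV EV] := time_average_expectation (ltW st) mg g0 gM c0 gc.
have mds : measurable_fun setT (fun w => D w - (t - s) * drift s w).
  apply: measurable_funB => //; apply: measurable_funM => //.
  have -> : drift s = fun w => det_drift s + n%:R * H2 s w.
    by apply/funext => w; rewrite /drift /H2 mulrN.
  by apply: measurable_funD => //; exact: measurable_funM.
have LD : L1 P (fun w => `|D w - (t - s) * drift s w|).
  apply: L1_abs; apply: (@L1_bounded _ _ _ _ _ (drift_bound T0 * (t - s) + (t - s) * drift_bound T0)) => // w.
  apply: (le_trans (ler_normB _ _)); apply: lerD => //.
  rewrite normrM (ger0_norm (ltW ts0)) ler_wpM2l ?(ltW ts0)// drift_le//.
  exact: le_trans (ltW st) tT.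
split => //; apply: (@le_trans _ _ (c * (t - s))).
  apply: le_trans EV; apply: Ex_le_ae => //; apply: filterS aeD => w ->.
  apply: (Rintegral_sub_cst_le (ltW st) (M := Num.max (drift_bound T0) M)).
  - exact: measurable_drift_section.
  - exact: (measurable_fun_time_section w mg).
  - move=> u /andP[_ ut]; rewrite le_max; apply/orP; left.
    by apply: drift_le; exact: le_trans tT.
  - by move=> u _; rewrite ger0_norm// le_max gM orbT.
  - move=> u /andP[su ut].
    have -> : drift u w - drift s w = (det_drift u - det_drift s) + n%:R * (H2 u w - H2 s w).
      by rewrite /drift /H2; ring.
    apply: (le_trans (ler_normD _ _)); apply: lerD.
      apply: (le_trans (det_drift_lipschitz su (le_trans ut tT))).
      by rewrite ler_wpM2l// lerB.
    rewrite normrM normr_nat ler_wpM2l//= -[(_ - _) ^+ 2]real_normK ?num_real//.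
    rewrite -subr_ge0.
    have -> : e / 2 + (2 * e)^-1 * `|H2 u w - H2 s w| ^+ 2 - `|H2 u w - H2 s w| =
       (2 * e)^-1 * (e - `|H2 u w - H2 s w|) ^+ 2 by field; rewrite gt_eqF.
    by rewrite mulr_ge0// sqr_ge0.
have -> : c * (t - s) = L * e ^+ 4 + (n%:R / 2 + 2 * n%:R * K) * e ^+ 3.
  by rewrite /c tse; field; rewrite gt_eqF.
have : L * e ^+ 4 <= L * e ^+ 3.
  by rewrite ler_wpM2l// exprSr ler_piMr// exprn_ge0// ltW.
lra.
Qed.

Let integrator_Re := noise_integrator_Re ZBM.
Let integrator_Im := noise_integrator_Im ZBM.

(** Conditionally on time s, xi is centred with variance h |e^(-i a) - 1|^2 = 2 h (1 - cos a), where
    h = t - s; the mixed term vanishes by independence of the two noises. *)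
Let euler_increment_moments (s t : R) (zeta : T -> R) (M : R) : s < t ->
  sigma_measurable (F s) zeta -> (forall w, `|zeta w| <= M) ->
  let xi w := H1 s w * increment X s t w - H2 s w * increment Y s t w in
  [/\ L1 P (fun w => zeta w * xi w), Ex P (fun w => zeta w * xi w) = 0,
    L1 P (fun w => zeta w * (xi w ^+ 2 / 2 - (t - s) * (1 - cos (a s w)))) &
    Ex P (fun w => zeta w * (xi w ^+ 2 / 2 - (t - s) * (1 - cos (a s w)))) = 0].
Proof.
move=> st mz zM xi.
have mzT := sigma_measurable_fun (@mXY s) mz.
have [XBM YBM _] := ZBM.
have [_ WX] := integrator_Re; have [_ WY] := integrator_Im.
have bL1 (f : T -> R) (M' : R) : sigma_measurable (F s) f -> (forall w, `|f w| <= M') ->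
    L1 P (fun w => zeta w * f w) /\ sigma_measurable (F s) (fun w => zeta w * f w).
  move=> mf fM'; split; last exact: sigma_measurableM.
  apply: (L1_bM mzT zM); apply: L1_bounded fM'.
  exact: (sigma_measurable_fun (@mXY s) mf).
have [iz1 mz1] := bL1 _ _ (@H1_adapted s) (H1_le s).
have [iz2 mz2] := bL1 _ _ (@H2_adapted s) (H2_le s).
have [a1 b1 _ _] := WX s t _ st mz1 iz1.
have [a2 b2 _ _] := WY s t _ st mz2 iz2.
have sq4 (x : R) : `|x| <= 2 -> `|x ^+ 2| <= 4.
  move=> x2; rewrite normrX; have := lerXn2r 2 (normr_ge0 x) (ler0n R 2) x2.
  by rewrite -natrX.
have [iz11 mz11] := bL1 _ 4 (sigma_measurableM (@H1_adapted s) (@H1_adapted s)) (fun w => sq4 _ (H1_le s w)).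
have [iz22 mz22] := bL1 _ 4 (sigma_measurableM (@H2_adapted s) (@H2_adapted s)) (fun w => sq4 _ (H2_le2 s w)).
have H12 w : `|H1 s w * H2 s w| <= 4.
  rewrite normrM; have := ler_pM (normr_ge0 _) (normr_ge0 _) (H1_le s w) (H2_le2 s w).
  by rewrite -natrM.
have [iz12 mz12] := bL1 _ 4 (sigma_measurableM (@H1_adapted s) (@H2_adapted s)) H12.
have [_ _ a11 b11] := WX s t _ st mz11 iz11.
have [_ _ a22 b22] := WY s t _ st mz22 iz22.
have [X4 X1 X2 _] := BM_increment_moments XBM st.
have [Y4 Y1 Y2 _] := BM_increment_moments YBM st.
have LX : L2 P (increment X s t) := L1_of_fourth_moment (increment_measurable s t XBM) X4.
have LY : L2 P (increment Y s t) := L1_of_fourth_moment (increment_measurable s t YBM) Y4.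
have [iXY eXY] := indep_rv_expectation (noise_incr_Re_Im_indep ZBM s t) (L2_L1 LX) (L2_L1 LY).
have mrX : sigma_measurable <<s noise_incr_rect Z s t >> (increment X s t).
  exact: sigma_measurable_rect_Re.
have mrY : sigma_measurable <<s noise_incr_rect Z s t >> (increment Y s t).
  exact: sigma_measurable_rect_Im.
have mXYr := sigma_measurableM mrX mrY.
have [a12 b12] := noise_expectation_prod ZBM st mz12 iz12 mXYr iXY.
rewrite eXY X1 mul0r mulr0 in b12.
have E1 : (fun w => zeta w * xi w) = fun w => zeta w * H1 s w * increment X s t w - zeta w * H2 s w * increment Y s t w.
  by apply/funext => w; rewrite /xi; ring.
have E2 : (fun w => zeta w * (xi w ^+ 2 / 2 - (t - s) * (1 - cos (a s w)))) = fun w =>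
   2^-1 * (zeta w * (H1 s w * H1 s w) * increment X s t w ^+ 2) +
   2^-1 * (zeta w * (H2 s w * H2 s w) * increment Y s t w ^+ 2) -
   zeta w * (H1 s w * H2 s w) * (increment X s t w * increment Y s t w) -
   ((t - s) / 2 * (zeta w * (H1 s w * H1 s w)) + (t - s) / 2 * (zeta w * (H2 s w * H2 s w))).
  apply/funext => w.
  have -> : 1 - cos (a s w) = (H1 s w * H1 s w + H2 s w * H2 s w) / 2.
    by rewrite /H1 /H2; have := cos2Dsin2 (a s w); rewrite !expr2; lra.
  by rewrite /xi; field.
rewrite E1 E2; split.
- exact: L1B.
- by rewrite ExB// b1 b2 subrr.
- apply: L1B; last by apply: L1D; exact: L1Z.
  by apply: L1B => //; apply: L1D; exact: L1Z.
- rewrite ExB; last 2 first.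
  + by apply: L1B => //; apply: L1D; exact: L1Z.
  + by apply: L1D; exact: L1Z.
  rewrite ExB//; last by apply: L1D; exact: L1Z.
  rewrite ExD; [|exact: L1Z|exact: L1Z].
  rewrite ExD; [|exact: L1Z|exact: L1Z].
  rewrite !ExZ//.
  have -> : Ex P (fun w => zeta w * (H1 s w * H1 s w) * increment X s t w ^+ 2) =
    (t - s) * Ex P (fun w => zeta w * (H1 s w * H1 s w)) by exact: b11.
  have -> : Ex P (fun w => zeta w * (H2 s w * H2 s w) * increment Y s t w ^+ 2) =
    (t - s) * Ex P (fun w => zeta w * (H2 s w * H2 s w)) by exact: b22.
  by rewrite b12; field.
Qed.

(** From |H1| <= 2 and |H2| <= 1, xi^2 is at most 8 dX^2 + 2 dY^2, whence 10 = 8 + 2. Squaring gives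
    128 dX^4 + 8 dY^4, and 4352 = 32 * (128 + 8). *)
Let euler_increment_bounds (s t : R) : s < t ->
  let xi w := H1 s w * increment X s t w - H2 s w * increment Y s t w in
  [/\ L1 P (fun w => xi w ^+ 2), Ex P (fun w => xi w ^+ 2) <= 10 * (t - s),
    L1 P (fun w => xi w ^+ 4) & Ex P (fun w => xi w ^+ 4) <= 4352 * (t - s) ^+ 2].
Proof.
move=> st xi; have [XBM YBM _] := ZBM.
have [X4 X1 X2 X4b] := BM_increment_moments XBM st.
have [Y4 Y1 Y2 Y4b] := BM_increment_moments YBM st.
have mX := increment_measurable s t XBM; have mY := increment_measurable s t YBM.
have LX : L2 P (increment X s t) := L1_of_fourth_moment mX X4.
have LY : L2 P (increment Y s t) := L1_of_fourth_moment mY Y4.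
have mxi : measurable_fun setT xi.
  by apply: measurable_funB; apply: measurable_funM.
have b2 w : xi w ^+ 2 <= 8 * increment X s t w ^+ 2 + 2 * increment Y s t w ^+ 2.
  apply: (le_trans (sqrD_le _ _)); rewrite sqrrN !exprMn.
  have h1 : H1 s w ^+ 2 <= 4.
    have := lerXn2r 2 (normr_ge0 _) (ler0n R 2) (H1_le s w).
    by rewrite real_normK ?num_real// -natrX.
  have h2 : H2 s w ^+ 2 <= 1.
    have := lerXn2r 2 (normr_ge0 _) (ler0n R 1) (H2_le s w).
    by rewrite real_normK ?num_real// -natrX.
  have : H1 s w ^+ 2 * increment X s t w ^+ 2 <= 4 * increment X s t w ^+ 2.
    by rewrite ler_wpM2r ?sqr_ge0.
  have : H2 s w ^+ 2 * increment Y s t w ^+ 2 <= 1 * increment Y s t w ^+ 2.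
    by rewrite ler_wpM2r ?sqr_ge0.
  lra.
have b4 w : xi w ^+ 4 <= 128 * increment X s t w ^+ 4 + 8 * increment Y s t w ^+ 4.
  rewrite -[xi w ^+ 4]/(xi w ^+ (2 * 2)) exprM.
  have := lerXn2r 2 (sqr_ge0 (xi w)) (le_trans (sqr_ge0 (xi w)) (b2 w)) (b2 w).
  move=> h; apply: (le_trans h); apply: (le_trans (sqrD_le _ _)).
  by rewrite sqr_sum_fourth.
have L2x : L1 P (fun w => xi w ^+ 2).
  apply: (@L1_le _ _ _ _ _ _ _ (L1D (L1Z 8 LX.2) (L1Z 2 LY.2))).
    exact: measurable_funX.
  by move=> w; rewrite ger0_norm ?sqr_ge0.
have L4x : L1 P (fun w => xi w ^+ 4).
  apply: (@L1_le _ _ _ _ _ _ _ (L1D (L1Z 128 X4) (L1Z 8 Y4))).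
    exact: measurable_funX.
  by move=> w; rewrite ger0_norm ?exprn_even_ge0.
split => //.
- apply: (le_trans (Ex_le L2x (L1D (L1Z 8 LX.2) (L1Z 2 LY.2)) b2)).
  rewrite (ExD (L1Z 8 LX.2) (L1Z 2 LY.2)) (ExZ _ LX.2) (ExZ _ LY.2).
  have -> : Ex P (fun w => increment X s t w ^+ 2) = t - s by exact: X2.
  have -> : Ex P (fun w => increment Y s t w ^+ 2) = t - s by exact: Y2.
  by lra.
- apply: (le_trans (Ex_le L4x (L1D (L1Z 128 X4) (L1Z 8 Y4)) b4)).
  rewrite (ExD (L1Z 128 X4) (L1Z 8 Y4)) (ExZ _ X4) (ExZ _ Y4).
  by lra.
Qed.

Lemma wave_L1 (k th u : R) : L1 P (fun w => cos (k * a u w + th)).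
Proof.
apply: (@L1_bounded _ _ _ _ _ 1) => [|w]; last exact: cos_max.
apply: measurableT_comp; first exact: continuous_measurable_fun (@continuous_cos R).
by apply: measurable_funD => //; apply: measurable_funM => //; exact: solution_measurable.
Qed.

(** The increment of a is split as xi + rho: the Gaussian Euler part, of order e, and the rest, of
    order e^2 in L^2. The error exponent 3 exceeds the exponent 2 of the step, which is all that
    differentiability requires. *)
Lemma weak_step (k th T0 : R) : 0 <= k -> exists2 C : R, 0 <= C &
  forall s e, 0 < e -> e <= 1 -> s + e ^+ 2 <= T0 ->
  `|Ex P (fun w => cos (k * a (s + e ^+ 2) w + th)) - Ex P (fun w => cos (k * a s w + th))
    - e ^+ 2 * Ex P (fun w => - k * sin (k * a s w + th) * drift s w +
        - k ^+ 2 * cos (k * a s w + th) * (1 - cos (a s w)))| <= C * e ^+ 3.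
Proof.
move=> k0; have [B B1 [[kB k2B] tayA tayB tayC]] := wave_taylor th k0.
have [K K0 hK] := increment_second_moment T0.
pose Kd := drift_bound T0; have Kd0 : 0 <= Kd by rewrite addr_ge0.
pose Dd := `|det_drift T0| * (beta / 4) + n%:R / 2 + 2 * n%:R * K.
pose C := B * (2 * (2 * Kd ^+ 2 + 128 * K) + 20 + 4352 + Dd).
have B0 : 0 <= B by apply: le_trans B1.
have Dd0 : 0 <= Dd.
  have : 0 <= `|det_drift T0| * (beta / 4) by rewrite mulr_ge0// divr_ge0// ltW.
  have : 0 <= n%:R * K by rewrite mulr_ge0.
  by rewrite /Dd; have : 0 <= n%:R :> R by []; lra.
exists C.
  by apply: mulr_ge0 B0 _; have := sqr_ge0 Kd; lra.
move=> s e e0 e1 sT; set t := s + e ^+ 2.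
have tse : t - s = e ^+ 2 by rewrite /t addrAC subrr add0r.
have st : s < t by rewrite -subr_gt0 tse exprn_gt0.
have ts1 : t - s <= 1 by rewrite tse expr_le1// ltW.
have [D [I1 [I2 [i1 i2 [mD DK] aE aD]]]] := solution_decomposition st sT.
have [LR1 ER1 zR1] := ito_euler integrator_Re H1_lip H1_adapted H1_le hK K0 st sT ts1 i1.
have [LR2 ER2 zR2] := ito_euler integrator_Im H2_lip H2_adapted H2_le2 hK K0 st sT ts1 i2.
have [Lx2 Ex2 Lx4 Ex4] := euler_increment_bounds st.
have [LDd EDd] := drift_euler hK K0 st sT e0 e1 tse DK mD aD.
set xi := (fun w => H1 s w * increment X s t w - H2 s w * increment Y s t w) in Lx2 Ex2 Lx4 Ex4.
pose r1 w := I1 w - H1 s w * increment X s t w.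
pose r2 w := I2 w - H2 s w * increment Y s t w.
pose r w := r1 w - r2 w.
pose rho w := D w + r w.
pose p1 w := - k * sin (k * a s w + th).
pose p2 w := - k ^+ 2 * cos (k * a s w + th).
pose q w := 1 - cos (a s w).
have wave_comp (f : R -> R) : continuous f -> sigma_measurable (F s) (fun w => f (k * a s w + th)).
  move=> cf; apply: (@sigma_measurable_comp _ _ _ _ _ (fun x => f (k * x + th)) _ (@adapted s)).
  apply: measurableT_comp; first exact: continuous_measurable_fun.
  by apply: measurable_funD => //; exact: measurable_funM.
have mp1 : sigma_measurable (F s) p1.
  by apply: sigma_measurableM; [exact: sigma_measurable_cst|exact: wave_comp (@continuous_sin R)].
have mp2 : sigma_measurable (F s) p2.
  by apply: sigma_measurableM; [exact: sigma_measurable_cst|exact: wave_comp (@continuous_cos R)].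
have p1B w : `|p1 w| <= B.
  rewrite normrM normrN (ger0_norm k0); apply: le_trans kB.
  by rewrite ler_piMr// sin_max.
have p2B w : `|p2 w| <= B.
  rewrite normrM normrN (ger0_norm (sqr_ge0 k)); apply: le_trans k2B.
  by rewrite ler_piMr ?sqr_ge0// cos_max.
have mp1T := sigma_measurable_fun (@mXY s) mp1.
have mp2T := sigma_measurable_fun (@mXY s) mp2.
have [La Ea _ _] := euler_increment_moments st mp1 p1B.
have [_ _ Lb Eb] := euler_increment_moments st mp2 p2B.
have Lr1 : L1 P (fun w => p1 w * r1 w) by apply: (L1_bM mp1T p1B); exact: L2_L1.
have Lr2 : L1 P (fun w => p1 w * r2 w) by apply: (L1_bM mp1T p1B); exact: L2_L1.
have Lr : L1 P (fun w => p1 w * r w).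
  by rewrite (_ : (fun w => _) = fun w => p1 w * r1 w - p1 w * r2 w); [exact: L1B|apply/funext => w; rewrite mulrBr].
have Er : Ex P (fun w => p1 w * r w) = 0.
  have -> : (fun w => p1 w * r w) = fun w => p1 w * r1 w - p1 w * r2 w.
    by apply/funext => w; rewrite mulrBr.
  by rewrite ExB// (zR1 _ _ mp1 p1B) (zR2 _ _ mp1 p1B) subrr.
pose A2 w := cos (k * a t w + th); pose p0 w := cos (k * a s w + th).
have LA2 : L1 P A2 := wave_L1 k th t.
have Lp0 : L1 P p0 := wave_L1 k th s.
have mq : measurable_fun setT q.
  apply: measurable_funB => //; apply: measurableT_comp; last exact: solution_measurable.
  exact: continuous_measurable_fun (@continuous_cos R).
have mds : measurable_fun setT (drift s).
  apply: measurable_funB => //; apply: measurable_funM => //; apply: measurableT_comp.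
    exact: continuous_measurable_fun (@continuous_sin R).
  exact: solution_measurable.
have LL : L1 P (fun w => p1 w * drift s w + p2 w * q w).
  apply: L1D.
    apply: (L1_bM mp1T p1B); apply: (L1_bounded P mds (M := Kd)) => w.
    by apply: drift_le; apply: le_trans sT; exact: ltW.
  apply: (L1_bM mp2T p2B); apply: (L1_bounded P mq (M := 2)) => w.
  by rewrite distrC; exact: H1_le.
(* Subtracting the three terms of expectation zero does not change the mean, but leaves a random
   variable that is small in L^1. *)
pose N w := A2 w - p0 w - (t - s) * (p1 w * drift s w + p2 w * q w) - p1 w * r w - p1 w * xi w
  - p2 w * (xi w ^+ 2 / 2 - (t - s) * q w).
have LN0 : L1 P (fun w => A2 w - p0 w - (t - s) * (p1 w * drift s w + p2 w * q w)).
  by apply: L1B; [exact: L1B|exact: L1Z].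
have LN : L1 P N by apply: L1B => //; apply: L1B => //; exact: L1B.
have EN : Ex P N = Ex P A2 - Ex P p0 - e ^+ 2 * Ex P (fun w => p1 w * drift s w + p2 w * q w).
  rewrite /N ExB//; last by apply: L1B => //; exact: L1B.
  rewrite ExB//; last by exact: L1B.
  rewrite ExB// Er Ea Eb !subr0 ExB; [|exact: L1B|exact: L1Z].
  by rewrite ExB// ExZ// tse.
rewrite -EN.
have Lrho2 : L2 P rho by apply: L2D; [exact: L2_bounded DK|exact: L2B].
have Erho2 : Ex P (fun w => rho w ^+ 2) <= (2 * Kd ^+ 2 + 128 * K) * e ^+ 4.
  apply: (@le_trans _ _ (Ex P (fun w => 2 * (Kd * (t - s)) ^+ 2 + 4 * r1 w ^+ 2 + 4 * r2 w ^+ 2))).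
    apply: Ex_le => [||w]; first exact: Lrho2.2.
      apply: L1D; last exact: L1Z _ LR2.2.
      by apply: L1D; [exact: L1_cst|exact: L1Z _ LR1.2].
    apply: (le_trans (sqrD_le _ _)); apply: sqr_sum3_le => //.
    rewrite -[X in X <= _]real_normK ?num_real// lerXn2r ?nnegrE ?DK//.
    by rewrite mulr_ge0// subr_ge0 ltW.
  rewrite ExD; [|by apply: L1D; [exact: L1_cst|exact: L1Z _ LR1.2]|exact: L1Z _ LR2.2].
  rewrite ExD; [|exact: L1_cst|exact: L1Z _ LR1.2].
  rewrite Ex_cst (ExZ _ LR1.2) (ExZ _ LR2.2) exprMn.
  have e4 : (t - s) ^+ 2 = e ^+ 4 by rewrite tse -exprM.
  move: ER1 ER2; rewrite -/(r1 _) e4 => h1 h2.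
  have h1' : Ex P (fun w => r1 w ^+ 2) <= 16 * K * e ^+ 4 by exact: h1.
  have h2' : Ex P (fun w => r2 w ^+ 2) <= 16 * K * e ^+ 4 by exact: h2.
  exact: euler_remainder_arith.
pose G w := B * (2 / e * rho w ^+ 2 + 2 * e * xi w ^+ 2 + e^-1 * xi w ^+ 4 + `|D w - (t - s) * drift s w|).
have La1 : L1 P (fun w => 2 / e * rho w ^+ 2) by exact: L1Z _ Lrho2.2.
have La2 : L1 P (fun w => 2 * e * xi w ^+ 2) by exact: L1Z.
have La3 : L1 P (fun w => e^-1 * xi w ^+ 4) by exact: L1Z.
have LG0 : L1 P (fun w => 2 / e * rho w ^+ 2 + 2 * e * xi w ^+ 2 + e^-1 * xi w ^+ 4 + `|D w - (t - s) * drift s w|).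
  by apply: L1D => //; apply: L1D => //; exact: L1D.
have LG : L1 P G by exact: L1Z.
apply: (@le_trans _ _ (Ex P G)).
  apply: (le_trans (Ex_abs LN)); apply: Ex_le_ae => //; first exact: L1_abs.
  apply: filterS aE => w aw.
  have at_ : a t w = a s w + xi w + rho w by rewrite aw /rho /r /r1 /r2 /xi; ring.
  apply: (@euler_remainder_le _ B e (t - s) (p0 w) (p1 w) (p2 w)
    (cos (k * (a s w + xi w) + th)) (- k * sin (k * (a s w + xi w) + th))) => //.
  by rewrite /A2 at_; exact: tayA.
rewrite /G (ExZ _ LG0) ExD//; last by apply: L1D => //; exact: L1D.
rewrite ExD//; last exact: L1D.
rewrite ExD// (ExZ _ Lrho2.2) (ExZ _ Lx2) (ExZ _ Lx4) /C -mulrA ler_wpM2l//.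
by rewrite tse in Ex2 Ex4; exact: euler_error_arith.
Qed.

End WeakExpansion.

(* The step is written as e^2 because the Euler scheme has local error of order 3/2 in the step size. *)
Definition expansion_3_2 {R : realType} (g G : R -> R) : Prop := forall T0 : R, exists2 C : R, 0 <= C &
  forall s e : R, 0 < e -> e <= 1 -> s + e ^+ 2 <= T0 ->
  `|g (s + e ^+ 2) - g s - e ^+ 2 * G s| <= C * e ^+ 3.

Lemma expansion_3_2_sqrt {R : realType} (g G : R -> R) : expansion_3_2 g G ->
  forall T0 : R, exists2 C : R, 0 <= C &
  forall s h : R, 0 <= h -> h <= 1 -> s + h <= T0 -> `|g (s + h) - g s - h * G s| <= C * h * Num.sqrt h.
Proof.
move=> gG T0; have [C C0 hC] := gG T0; exists C => // s h h0 h1 sT.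
have [->|hn0] := eqVneq h 0; first by rewrite addr0 subrr !(mul0r, mulr0) subr0 normr0.
have hp : 0 < h by rewrite lt_def hn0.
have e2 : Num.sqrt h ^+ 2 = h by rewrite sqr_sqrtr.
have := hC s (Num.sqrt h); rewrite [_ ^+ 3]exprSr e2 mulrA; apply => //; first by rewrite sqrtr_gt0.
by rewrite -(@sqrtr1 R) ler_wsqrtr.
Qed.

(** * From forward expansions to continuity and differentiability *)

(** Boundedness of G makes g locally Lipschitz. Continuity has to come first: the G of each wave is
    built from waves, and differentiability of g asks for continuity of G. *)
Lemma expansion_continuous {R : realType} (g G : R -> R) : expansion_3_2 g G ->
  (forall T0, exists M, forall s, s <= T0 -> `|G s| <= M) -> continuous g.
Proof.
move=> gG Gb s; have [C C0 hC] := expansion_3_2_sqrt gG (s + 1).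
have [M hM] := Gb (s + 1).
have M0 : 0 <= M by apply: le_trans (hM s _) => //; rewrite lerDl.
have lip (u h : R) : 0 <= h -> h <= 1 -> u + h <= s + 1 -> `|g (u + h) - g u| <= (C + M) * h.
  move=> h0 h1 uh; have := hC u h h0 h1 uh => hc.
  rewrite -(subrK (h * G u) (g (u + h) - g u)); apply: (le_trans (ler_normD _ _)).
  rewrite mulrDl lerD//.
    apply: (le_trans hc); rewrite ler_piMr// ?mulr_ge0//.
    by rewrite -(@sqrtr1 R) ler_wsqrtr.
  rewrite normrM ger0_norm// mulrC ler_wpM2r// hM//.
  by apply: le_trans uh; rewrite lerDl.
apply/cvgrPdist_lt => eps eps0.
have CM : 0 < C + M + 1 by rewrite ltr_wpDl// addr_ge0.
have d0 : 0 < eps / (C + M + 1) by rewrite divr_gt0.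
near=> v.
have v1 : `|s - v| < 1 by near: v; exact: (nbhsx_ballx s _ ltr01).
have v2 : `|s - v| < eps / (C + M + 1) by near: v; exact: (nbhsx_ballx s _ d0).
rewrite ltr_pdivlMr// in v2.
have key : `|g s - g v| <= (C + M) * `|s - v|.
  have [sv|vs] := leP s v.
    rewrite distrC (distrC s) (ger0_norm (x := v - s)) ?subr_ge0//.
    have -> : v = s + (v - s) by ring.
    rewrite [in X in _ <= _ * X]addrAC subrr add0r; apply: lip; first by rewrite subr_ge0.
      by rewrite distrC ger0_norm ?subr_ge0// in v1; exact: ltW.
    by rewrite lerD2l; rewrite distrC ger0_norm ?subr_ge0// in v1; exact: ltW.
  rewrite (ger0_norm (x := s - v)); last by rewrite subr_ge0 ltW.
  have {1}-> : s = v + (s - v) by ring.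
  rewrite gtr0_norm ?subr_gt0// in v1.
  apply: lip; rewrite ?subr_ge0; [exact: ltW|exact: ltW|].
  by rewrite addrC subrK lerDl.
apply: (le_lt_trans key); apply: le_lt_trans v2; rewrite mulrC ler_wpM2l//.
by rewrite lerDl.
Unshelve. all: by end_near. Qed.

(** The expansion runs forward in time, so it gives the right difference quotient directly. The left
    one needs its uniformity in the base point and continuity of G. *)
Lemma expansion_is_derive {R : realType} (g G : R -> R) (s : R) : expansion_3_2 g G ->
  {for s, continuous G} -> is_derive s 1 g (G s).
Proof.
move=> gG cG; have [C C0 hC] := expansion_3_2_sqrt gG (s + 1).
have key : h^-1 *: (g (h + s) - g s) @[h --> 0^'] --> G s.
  apply/cvgrPdist_lt => eps eps0.
  have e2 : 0 < eps / 2 by rewrite divr_gt0.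
  have C1 : 0 < C + 1 by rewrite ltr_wpDl.
  have d0 : 0 < (eps / 2 / (C + 1)) ^+ 2 by rewrite exprn_gt0// divr_gt0.
  have cG' : \forall h \near (0 : R), `|G s - G (h + s)| < eps / 2.
    have hs : h + s @[h --> (0 : R)] --> s.
      by rewrite -[X in _ --> X]add0r; apply: cvgD => //; exact: cvg_cst.
    by move/cvgrPdist_lt : (cvg_comp _ _ hs cG); exact.
  have step (u h : R) : 0 < h -> h <= 1 -> h < (eps / 2 / (C + 1)) ^+ 2 -> u + h <= s + 1 ->
      `|G u - h^-1 * (g (u + h) - g u)| < eps / 2.
    move=> h0 h1 hd uh.
    have := hC u h (ltW h0) h1 uh.
    have -> : G u - h^-1 * (g (u + h) - g u) = - h^-1 * (g (u + h) - g u - h * G u).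
      by field; rewrite gt_eqF.
    rewrite normrM normrN (gtr0_norm (x := h^-1)) ?invr_gt0// => hh.
    apply: (@le_lt_trans _ _ (C * Num.sqrt h)).
      by rewrite mulrC ler_pdivrMr// mulrAC.
    have : Num.sqrt h < eps / 2 / (C + 1).
      by rewrite -(ltr_pXn2r (n := 2))// ?nnegrE ?sqrtr_ge0 ?sqr_sqrtr ?divr_ge0 // ltW.
    rewrite ltr_pdivlMr// => hs; apply: le_lt_trans hs; rewrite mulrC ler_wpM2l ?sqrtr_ge0//.
    by rewrite lerDl.
  rewrite near_withinE; near=> h => h0.
  have h1 : `|h| < 1 by near: h; apply: (@nbhs0_lt _ R).
  have h2 : `|h| < (eps / 2 / (C + 1)) ^+ 2 by near: h; apply: (@nbhs0_lt _ R).
  have h3 : `|G s - G (h + s)| < eps / 2 by near: h.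
  have [hp|hn] := ltP 0 h.
    rewrite gtr0_norm// in h1 h2.
    rewrite (addrC h); apply: (@lt_trans _ _ (eps / 2)).
      by apply: (step s h hp (ltW h1) h2); rewrite lerD2l ltW.
    by rewrite ltr_pdivrMr// ltr_pMr// ltrDl.
  have {}hn : h < 0 by rewrite lt_neqAle hn andbT; exact: h0.
  rewrite ltr0_norm// in h1 h2.
  (* For h < 0 expand forward from s + h with step - h; this yields G (s + h), which is then
     compared with G s. *)
  have := step (h + s) (- h); rewrite oppr_gt0 => /(_ hn (ltW h1) h2).
  rewrite addrAC subrr add0r lerDl => /(_ ler01).
  have -> : (- h)^-1 * (g s - g (h + s)) = h^-1 * (g (h + s) - g s).
    by rewrite invrN mulNr -mulrN opprB.
  move=> h4; rewrite [_ *: _]/( _ * _) -(subrKA (G (h + s))).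
  apply: (le_lt_trans (ler_normD _ _)); rewrite (splitr eps); exact: ltrD.
apply: DeriveDef.
  by apply/cvg_ex; exists (G s); move: key; under eq_fun do rewrite -[X in g (X + _)]mulr1.
by apply/cvg_lim => //; move: key; under eq_fun do rewrite -[X in g (X + _)]mulr1.
Unshelve. all: by end_near. Qed.

(* Chosen so that w_k A_(k,k+1) = - w_(k+1) A_(k+1,k). *)
Definition wgt (F : fieldType) (n k : nat) : F := 'C(2 * n, n + k)%:R / k%:R.

Lemma wgt_gt0 (F : numFieldType) (n k : nat) : (0 < k <= n)%N -> 0 < wgt F n k.
Proof. by case/andP => k0 kn; rewrite divr_gt0// ltr0n// bin_gt0 mul2n -addnn leq_add2l. Qed.

(** For neighbouring indices this is (n + k + 1) C(2n, n + k + 1) = (n - k) C(2n, n + k); the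
    division by k in the weight cancels the factor k of row k of A. *)
Lemma wgt_matA (F : numFieldType) (n : nat) (i j : 'I_n) :
  wgt F n i.+1 * matA n i j + wgt F n j.+1 * matA n j i =
  if i == j then - (2 * (wgt F n i.+1 * i.+1%:R ^+ 2)) else 0.
Proof.
have adj (k l : 'I_n) : l = k.+1 :> nat -> wgt F n k.+1 * matA n k l + wgt F n l.+1 * matA n l k = 0.
  move=> lk; have e1 : (l == k :> nat) = false by rewrite lk gtn_eqF.
  have e2 : (l.+1 == k :> nat) = false by rewrite lk gtn_eqF// ltnS ltnW.
  rewrite !mxE (eq_sym (k : nat)) e1 e2 lk eqxx.
  have := mul_bin_left (2 * n) (n + k.+1); rewrite -addnS {2}mul2n -addnn subnDl.
  move=> /(congr1 (fun x : nat => x%:R : F)); rewrite !natrM natrD natrB; last by rewrite -lk ltnW.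
  rewrite /wgt; set c' : F := 'C(_, n + k.+2)%:R; set c : F := 'C(_, n + k.+1)%:R => bin.
  apply/eqP; rewrite addr_eq0; apply/eqP.
  transitivity (- (2^-1 * ((n%:R - k.+1%:R) * c))); first by field.
  by rewrite -bin; field.
case: eqVneq => [->|ij]; first by rewrite !mxE eqxx /=; ring.
have ij' : (i == j :> nat) = false by apply/negbTE.
have [/esym|ji] := eqVneq (i.+1 : nat) j; first exact: adj.
have [/esym|ji'] := eqVneq (j.+1 : nat) i; first by move=> ?; rewrite addrC; exact: adj.
rewrite !mxE ij' (eq_sym (j : nat)) ij' (negbTE ji) (negbTE ji').
by rewrite !(eq_sym _ (_.+1)) (negbTE ji) (negbTE ji') !mulr0 addr0.
Qed.

Lemma matA_form (F : numFieldType) (n : nat) (x : 'cV[F]_n) :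
  \sum_(i < n) wgt F n i.+1 * (x i 0 * (matA n *m x) i 0) = - \sum_(i < n) wgt F n i.+1 * (i.+1%:R ^+ 2 * x i 0 ^+ 2).
Proof.
set S := LHS; have -> : S = \sum_(i < n) \sum_(j < n) wgt F n i.+1 * matA n i j * (x i 0 * x j 0).
  apply: eq_bigr => i _; rewrite mxE !mulr_sumr; apply: eq_bigr => j _; ring.
apply: (@mulfI _ 2) => //; rewrite mulr_natl mulr2n {2}exchange_big /= -big_split /=.
rewrite mulrN mulr_sumr -sumrN; apply: eq_bigr => i _.
rewrite -big_split /= (bigD1 i)//= big1 ?addr0; last first.
  move=> j ji; rewrite (mulrC (x j 0)) -mulrDl wgt_matA eq_sym (negbTE ji) mul0r //.
by rewrite -mulrDl wgt_matA eqxx; ring.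
Qed.

(** Seeing the vector as part of a sequence f exposes the boundary: the term in f 0, present in the
    first row only, becomes the inhomogeneous term (n + 1)/2 e_n. Used for the constant sequence and
    for the waves. *)
Lemma matA_col (F : numFieldType) (n : nat) (f : nat -> F) (i : 'I_n) :
  let k : F := i.+1%:R in
  (matA n *m \col_j f j.+1) i 0 + 2^-1 * k * (k + n%:R) * f 0%N * vece n i 0 =
  - k ^+ 2 * f i.+1 + 2^-1 * k * (k + n%:R) * f i + 2^-1 * k * (k - n%:R) * f i.+2.
Proof.
move=> k; rewrite mxE.
have E (j : 'I_n) : matA n i j * (\col_j f j.+1) j 0 =
    (if j == i :> nat then - k ^+ 2 * f i.+1 else 0) +
    (if j.+1 == i then 2^-1 * k * (k + n%:R) * f i else 0) +
    (if j == i.+1 :> nat then 2^-1 * k * (k - n%:R) * f i.+2 else 0).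
  rewrite !mxE.
  have [->|_] := eqVneq (j : nat) i.
    by rewrite (gtn_eqF (ltnSn _)) (ltn_eqF (ltnSn _)) !addr0.
  have [ij|_] := eqVneq j.+1 (i : nat).
    have -> : (j == i.+1 :> nat) = false by rewrite -ij ltn_eqF.
    by rewrite add0r addr0 ij.
  by case: eqVneq => [->|_]; rewrite !(mul0r, add0r).
rewrite (eq_bigr _ (fun j _ => E j)) !big_split /=.
have pick m (c : F) : \sum_(j < n) (if j == m :> nat then c else 0) = if (m < n)%N then c else 0.
  by rewrite -big_mkcond (big_ord1_eq _ (fun=> c)).
rewrite !pick ltn_ord !mxE.
(* In the last row k = n, so the coefficient of the value beyond the end of the vector is zero. *)
have -> : (if (i.+1 < n)%N then 2^-1 * k * (k - n%:R) * f i.+2 else 0) = 2^-1 * k * (k - n%:R) * f i.+2.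
  case: ltnP => // ni; have -> : k = n%:R by congr _%:R; apply/eqP; rewrite eqn_leq ltn_ord.
  by rewrite subrr mulr0 mul0r.
case: (nat_of_ord i) (ltn_ord i) @k {E} => [|m] mn k.
  by rewrite big1 => [|j _]; rewrite /= ?mulr1; [ring|].
have -> : \sum_(j < n) (if j.+1 == m.+1 then 2^-1 * k * (k + n%:R) * f m.+1 else 0) = 2^-1 * k * (k + n%:R) * f m.+1.
  by rewrite pick (ltnW mn).
by rewrite !mulr0 addr0.
Qed.

(** Real part of the weighted Hermitian product, kept in real coordinates because it is
    differentiated along a real variable. *)
Definition wdot {R : rcfType} (n : nat) (u v : 'cV[R[i]]_n) : R :=
  \sum_(i < n) wgt R n i.+1 *
    (complex.Re (u i 0) * complex.Re (v i 0) + complex.Im (u i 0) * complex.Im (v i 0)).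

(** * Energy estimates for A and B and invertibility of the resolvents *)

Section WeightedInnerProduct.
Context {R : rcfType}.
Variable n : nat.
Implicit Types u v g : 'cV[R[i]]_n.

Lemma wgt_ord_gt0 (i : 'I_n) : 0 < wgt R n i.+1.
Proof. by apply: wgt_gt0; rewrite ltn_ord. Qed.

Lemma wdotDr u v g : wdot u (v + g) = wdot u v + wdot u g.
Proof. by rewrite -big_split /=; apply: eq_bigr => i _; rewrite !mxE !raddfD /=; ring. Qed.

Lemma wdotZr (c : R) u v : wdot u (c%:C *: v) = c * wdot u v.
Proof.
rewrite mulr_sumr; apply: eq_bigr => i _; rewrite !mxE.
by case: (v i 0) => x y; rewrite /=; ring.
Qed.

Lemma wdot_ge0 v : 0 <= wdot v v.
Proof.
apply: sumr_ge0 => i _; apply: mulr_ge0; first exact/ltW/wgt_ord_gt0.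
by rewrite addr_ge0// -expr2 sqr_ge0.
Qed.

Lemma wdot_coord v (i : 'I_n) :
  wgt R n i.+1 * (complex.Re (v i 0) ^+ 2 + complex.Im (v i 0) ^+ 2) <= wdot v v.
Proof.
rewrite /wdot (bigD1 i)//= -!expr2 lerDl; apply: sumr_ge0 => j _.
by apply: mulr_ge0; [exact/ltW/wgt_ord_gt0|rewrite addr_ge0// -expr2 sqr_ge0].
Qed.

Lemma wdot_eq0 v : wdot v v <= 0 -> v = 0.
Proof.
move=> v0; apply/colP => i; rewrite mxE.
have := le_trans (wdot_coord v i) v0; rewrite pmulr_rle0 ?wgt_ord_gt0// => h.
have := sqr_ge0 (complex.Re (v i 0)); have := sqr_ge0 (complex.Im (v i 0)) => h1 h2.
have x0 : complex.Re (v i 0) = 0 by apply/eqP; rewrite -sqrf_eq0; apply/eqP; lra.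
have y0 : complex.Im (v i 0) = 0 by apply/eqP; rewrite -sqrf_eq0; apply/eqP; lra.
by case: (v i 0) x0 y0 => x y /= -> ->.
Qed.

Lemma wdot_le u v : 2 * wdot u v <= wdot u u + wdot v v.
Proof.
rewrite mulr_sumr -big_split /=; apply: ler_sum => i _.
rewrite -mulrDr mulrCA ler_wpM2l//; first exact/ltW/wgt_ord_gt0.
have := sqr_ge0 (complex.Re (u i 0) - complex.Re (v i 0)).
have := sqr_ge0 (complex.Im (u i 0) - complex.Im (v i 0)).
by rewrite !expr2; lra.
Qed.

Lemma matA_real : matA n = map_mx (real_complex R) (matA n).
Proof.
apply/matrixP => i j; rewrite !mxE /=; case: ifP => _.
  by rewrite rmorphN rmorphXn rmorph_nat.
case: ifP => _; first by rewrite !rmorphM rmorphD fmorphV !rmorph_nat.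
by case: ifP => _; rewrite ?rmorph0// !rmorphM rmorphB fmorphV !rmorph_nat.
Qed.

Lemma Re_realM (x : R) z : complex.Re (x%:C * z) = x * complex.Re z.
Proof. by case: z => y t /=; rewrite mul0r subr0. Qed.

Lemma Im_realM (x : R) z : complex.Im (x%:C * z) = x * complex.Im z.
Proof. by case: z => y t /=; rewrite mul0r addr0. Qed.

Lemma matA_Re v i : complex.Re ((matA n *m v) i 0) = (matA n *m map_mx (@complex.Re R) v) i 0.
Proof.
rewrite matA_real [in LHS]mxE [in RHS]mxE raddf_sum; apply: eq_bigr => j _ /=.
by rewrite [map_mx _ _ i j]mxE [map_mx _ _ j 0]mxE; exact: Re_realM.
Qed.

Lemma matA_Im v i : complex.Im ((matA n *m v) i 0) = (matA n *m map_mx (@complex.Im R) v) i 0.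
Proof.
rewrite matA_real [in LHS]mxE [in RHS]mxE raddf_sum; apply: eq_bigr => j _ /=.
by rewrite [map_mx _ _ i j]mxE [map_mx _ _ j 0]mxE; exact: Im_realM.
Qed.

Lemma matA_form_le (x : 'cV[R]_n) :
  \sum_(i < n) wgt R n i.+1 * (x i 0 * (matA n *m x) i 0) <= - \sum_(i < n) wgt R n i.+1 * x i 0 ^+ 2.
Proof.
rewrite matA_form lerN2; apply: ler_sum => i _; rewrite ler_wpM2l//; first exact/ltW/wgt_ord_gt0.
by rewrite ler_peMl ?sqr_ge0// exprn_ege1// ler1n.
Qed.

(** A is real, so it acts separately on real and imaginary parts; on each the form is minus the
    weighted sum of k^2 x_k^2, and k^2 >= 1. *)
Lemma wdot_matA v : wdot v (matA n *m v) <= - wdot v v.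
Proof.
have := lerD (matA_form_le (map_mx (@complex.Re R) v)) (matA_form_le (map_mx (@complex.Im R) v)).
rewrite -opprD -!big_split /=.
under eq_bigr => i _ do rewrite -matA_Re -matA_Im [map_mx _ _ _ _]mxE [X in _ + _ * (X * _)]mxE -mulrDr.
by under [in X in _ <= - X]eq_bigr => i _ do
  rewrite [map_mx _ _ _ _]mxE [X in _ + _ * X ^+ 2]mxE !expr2 -mulrDr.
Qed.

Lemma matB_col (F : fieldType) (m : nat) (x : 'cV[F]_m) i : (matB m *m x) i 0 = i.+1%:R * x i 0.
Proof. by rewrite /matB mul_diag_mx !mxE. Qed.

Lemma matB_scale (mu : R) v i : ((0 +i* mu) *: (matB n *m v)) i 0 =
  - (mu * i.+1%:R * complex.Im (v i 0)) +i* (mu * i.+1%:R * complex.Re (v i 0)).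
Proof.
rewrite mxE matB_col -(rmorph_nat (real_complex R)); case: (v i 0) => x y /=.
by apply/eqP; rewrite eq_complex /=; apply/andP; split; apply/eqP; ring.
Qed.

(** Multiplication by i mu B is anti-Hermitian for any diagonal weight. *)
Lemma wdot_imatB (mu : R) v : wdot v ((0 +i* mu) *: (matB n *m v)) = 0.
Proof. by apply: big1 => i _; rewrite matB_scale /=; ring. Qed.

Lemma wdot_matB v : wdot ((0 +i* 1) *: (matB n *m v)) ((0 +i* 1) *: (matB n *m v)) <= n%:R ^+ 2 * wdot v v.
Proof.
rewrite mulr_sumr; apply: ler_sum => i _; rewrite matB_scale /= [leRHS]mulrCA.
rewrite ler_wpM2l//; first exact/ltW/wgt_ord_gt0.
set x := complex.Re _; set y := complex.Im _.
have -> : - (1 * i.+1%:R * y) * - (1 * i.+1%:R * y) + 1 * i.+1%:R * x * (1 * i.+1%:R * x) =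
  i.+1%:R ^+ 2 * (x * x + y * y) by ring.
by rewrite ler_wpM2r ?lerXn2r ?nnegrE ?ler_nat ?ltn_ord// addr_ge0// -expr2 sqr_ge0.
Qed.

(* By [wdot_matA] and Cauchy-Schwarz. *)
Lemma resolvent_bound (j c : R) v : 0 <= j -> 0 <= c ->
  let g := j%:C *: v - c%:C *: (matA n *m v) in
  j ^+ 2 * wdot v v <= wdot g g /\ c * wdot v v <= wdot v g.
Proof.
move=> j0 c0 g.
have e : wdot v g = j * wdot v v - c * wdot v (matA n *m v).
  by rewrite /g -scaleNr -rmorphN wdotDr !wdotZr mulNr.
have h1 : c * wdot v (matA n *m v) <= c * - wdot v v by rewrite ler_wpM2l// wdot_matA.
have h2 : 0 <= c * wdot v v by rewrite mulr_ge0// wdot_ge0.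
have h3 : 0 <= j * wdot v v by rewrite mulr_ge0// wdot_ge0.
rewrite mulrN in h1; split; last by rewrite e; lra.
have := wdot_le (j%:C *: v) g.
have wC u w : wdot u w = wdot w u by apply: eq_bigr => i _; ring.
rewrite (wC _ g) !wdotZr (wC g v) (wC (_ *: v) v) wdotZr e => h.
have h4 : 0 <= j * (c * wdot v v) by rewrite mulr_ge0.
have h5 : j * (c * wdot v (matA n *m v)) <= j * - (c * wdot v v) by rewrite ler_wpM2l.
by rewrite mulrBr mulrA -expr2 in h; rewrite mulrN in h5; lra.
Qed.

Lemma unitmx_ker0 (F : fieldType) (m : nat) (M : 'M[F]_m) :
  (forall v : 'cV[F]_m, M *m v = 0 -> v = 0) -> M \in unitmx.
Proof.
move=> h; rewrite -unitmx_tr -row_free_unit -kermx_eq0; apply/eqP/row_matrixP => i.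
rewrite row0; apply: trmx_inj; rewrite trmx0; apply: h.
by apply: trmx_inj; rewrite trmx_mul trmxK trmx0 -row_mul mulmx_ker row0.
Qed.

Lemma matA_unit : matA n \in @unitmx R[i] n.
Proof.
apply: unitmx_ker0 => v Av; apply: wdot_eq0.
have [_] := @resolvent_bound 0 1 v (lexx _) ler01; rewrite Av scale0r scaler0 subr0 mul1r => h.
by apply: (le_trans h); rewrite -(scale0r 0) -(rmorph0 (real_complex R)) wdotZr mul0r.
Qed.

Lemma resolvent_unit (j : nat) (c : R) : (0 < j)%N -> 0 <= c ->
  (j%:R)%:M - c%:C *: matA n \in @unitmx R[i] n.
Proof.
move=> j0 c0; apply: unitmx_ker0 => v Mv; apply: wdot_eq0.
have [h _] := @resolvent_bound j%:R c v (ler0n _ _) c0.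
have e0 : (j%:R : R)%:C *: v - c%:C *: (matA n *m v) = 0.
  by rewrite -[RHS]Mv mulmxBl mul_scalar_mx -scalemxAl rmorph_nat.
move: h; rewrite e0.
have -> : wdot (n := n) 0 0 = 0 :> R by apply: big1 => i _; rewrite !mxE /= !mul0r addr0 mulr0.
by rewrite pmulr_rle0// exprn_gt0// ltr0n.
Qed.

End WeightedInnerProduct.

(** * The coefficients of the series: recursion and factorial decay *)

Section Coefficients.
Context {R : realType}.
Variables (beta : R) (n : nat).
Hypothesis beta_gt0 : 0 < beta.

Let s := svec beta n.

(** The three full coefficients of a row add up to zero, so the constant sequence leaves only the
    boundary term. This identifies s_0 with the vector of ones. *)
Lemma matA_vecf : matA n *m vecf n = - ((n.+1%:R / 2) *: vece n) :> 'cV[R[i]]_n.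
Proof.
have vf : vecf n = \col_(j < n) 1 :> 'cV[R[i]]_n by apply/colP => i; rewrite !mxE.
apply/colP => i; rewrite vf; have /= h := @matA_col R[i] n (fun=> 1) i.
have {}h : (matA n *m \col_j 1) i 0 + 2^-1 * i.+1%:R * (i.+1%:R + n%:R) * vece n i 0 = 0 :> R[i].
  by move: h; rewrite !mulr1 => ->; field.
rewrite [RHS]mxE [in RHS]mxE; apply/eqP; rewrite -addr_eq0 -[X in _ == X]h; apply/eqP; congr (_ + _).
by rewrite mxE; case: (nat_of_ord i) => [|m]; rewrite /= ?mulr0// -[in LHS]nat1r; field.
Qed.

Lemma svec0 : s 0%N = vecf n.
Proof.
by rewrite /s /= -[RHS](mulKmx (matA_unit n)) matA_vecf mulmxN -scalemxAr.
Qed.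

Lemma svec_eq (j : nat) : (j.+1%:R : R)%:C *: s j.+1 - (4 / beta)%:C *: (matA n *m s j.+1) =
  (0 +i* 1) *: (matB n *m s j).
Proof.
have c0 : 0 <= 4 / beta by rewrite divr_ge0// ltW.
have E (u : 'cV[R[i]]_n) x y : x *: u - y *: (matA n *m u) = (x%:M - y *: matA n) *m u.
  by rewrite mulmxBl mul_scalar_mx scalemxAl.
rewrite E rmorph_nat [s j.+1]/s /= -/s -scalemxAr.
by rewrite -(mulmxA (invmx _)) mulKVmx// resolvent_unit.
Qed.

(** At each step B costs at most a factor n, and the resolvent gains the factor 1/(j + 1). *)
Lemma wdot_svec (j : nat) : wdot (s j) (s j) <= wdot (s 0%N) (s 0%N) * (n%:R ^+ j / j`!%:R) ^+ 2.
Proof.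
elim: j => [|j IH]; first by rewrite expr0 fact0 divr1 expr1n mulr1.
have c0 : 0 <= 4 / beta by rewrite divr_ge0// ltW.
have [h _] := resolvent_bound (s j.+1) (ler0n R j.+1) c0.
have j2 : 0 < j.+1%:R ^+ 2 :> R by rewrite exprn_gt0.
rewrite -(ler_pM2l j2); apply: (le_trans h); rewrite svec_eq.
apply: (le_trans (wdot_matB _)).
apply: (@le_trans _ _ (n%:R ^+ 2 * (wdot (s 0%N) (s 0%N) * (n%:R ^+ j / j`!%:R) ^+ 2))).
  by rewrite ler_wpM2l// sqr_ge0.
rewrite (exprS _ j) factS natrM le_eqVlt; apply/orP; left; apply/eqP; field.
by rewrite pnatr_eq0 -lt0n fact_gt0 nat1r pnatr_eq0.
Qed.

Lemma svec_bound : exists2 C : R, 0 <= C & forall j k, `|s j k 0| <= (C * (n%:R ^+ j / j`!%:R))%:C.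
Proof.
(* The weights differ from one coordinate to the next; the sum dominates each coordinate
   constant. *)
pose C := \sum_(k < n) Num.sqrt (wdot (s 0%N) (s 0%N) / wgt R n k.+1).
exists C => [|j k]; first by apply: sumr_ge0 => k _; exact: sqrtr_ge0.
rewrite normc_def lecR.
have f0 : 0 <= n%:R ^+ j / j`!%:R :> R by rewrite divr_ge0// exprn_ge0.
apply: (@le_trans _ _ (Num.sqrt (wdot (s 0%N) (s 0%N) / wgt R n k.+1) * (n%:R ^+ j / j`!%:R))).
  rewrite -[X in _ * X](ger0_norm f0) -sqrtr_sqr -sqrtrM; last first.
    by rewrite divr_ge0 ?wdot_ge0// ltW// wgt_ord_gt0.
  apply: ler_wsqrtr; rewrite mulrAC ler_pdivlMr ?wgt_ord_gt0// mulrC.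
  by apply: le_trans (wdot_svec j); exact: wdot_coord.
rewrite ler_wpM2r// /C (bigD1 k)//= lerDl; apply: sumr_ge0 => i _; exact: sqrtr_ge0.
Qed.

End Coefficients.

(** * Difference quotients of powers *)

Lemma pow_lipschitz {F : numDomainType} (M z h : F) (j : nat) : 1 <= M -> `|z| <= M -> `|z + h| <= M ->
  `|(z + h) ^+ j - z ^+ j| <= j%:R * M ^+ j * `|h|.
Proof.
move=> M1 zM zhM; have M0 : 0 <= M := le_trans ler01 M1.
elim: j => [|j IH]; first by rewrite !expr0 subrr normr0 !mul0r.
have -> : (z + h) ^+ j.+1 - z ^+ j.+1 = (z + h) * ((z + h) ^+ j - z ^+ j) + h * z ^+ j by rewrite !exprS; ring.
apply: (le_trans (ler_normD _ _)); rewrite !normrM -natr1 mulrDl mulrDl mul1r lerD//.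
  by rewrite exprS mulrCA -mulrA ler_pM// mulrA.
rewrite mulrC ler_wpM2r// normrX exprS; apply: (@le_trans _ _ (M ^+ j)); last by rewrite ler_peMl// exprn_ge0.
by rewrite lerXn2r// nnegrE.
Qed.

Lemma pow_taylor {F : numDomainType} (M z h : F) (j : nat) : 1 <= M -> `|z| <= M -> `|z + h| <= M ->
  `|(z + h) ^+ j - z ^+ j - h * (j%:R * z ^+ j.-1)| <= j%:R ^+ 2 * M ^+ j * `|h| ^+ 2.
Proof.
move=> M1 zM zhM; have M0 : 0 <= M := le_trans ler01 M1.
elim: j => [|j IH]; first by rewrite !expr0 subrr mul0r mulr0 subr0 normr0 expr2 !mul0r.
have -> : (z + h) ^+ j.+1 - z ^+ j.+1 - h * (j.+1%:R * z ^+ j) =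
  z * ((z + h) ^+ j - z ^+ j - h * (j%:R * z ^+ j.-1)) + h * ((z + h) ^+ j - z ^+ j).
  by case: j {IH} => [|j]; rewrite /= !exprS -!natr1; ring.
apply: (le_trans (ler_normD _ _)); rewrite !normrM.
have h1 : `|z| * `|(z + h) ^+ j - z ^+ j - h * (j%:R * z ^+ j.-1)| <= M * (j%:R ^+ 2 * M ^+ j * `|h| ^+ 2).
  exact: ler_pM.
have h2 : `|h| * `|(z + h) ^+ j - z ^+ j| <= `|h| * (j%:R * M ^+ j * `|h|).
  by rewrite ler_wpM2l// pow_lipschitz.
apply: (le_trans (lerD h1 h2)).
have Mj : M ^+ j <= M ^+ j.+1 by rewrite exprS ler_peMl// exprn_ge0.
apply: (@le_trans _ _ (j%:R ^+ 2 * M ^+ j.+1 * `|h| ^+ 2 + j%:R * M ^+ j.+1 * `|h| ^+ 2)).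
  apply: lerD; first by rewrite (exprS M) le_eqVlt; apply/orP; left; apply/eqP; ring.
  have -> : `|h| * (j%:R * M ^+ j * `|h|) = j%:R * `|h| ^+ 2 * M ^+ j by ring.
  by rewrite [leRHS]mulrAC ler_wpM2l// mulr_ge0// exprn_ge0.
rewrite -mulrDl ler_wpM2r ?exprn_ge0// -mulrDl ler_wpM2r ?exprn_ge0//.
by rewrite -natr1 sqrrD1 -addrA lerD2l mulr2n -addrA lerDl addr_ge0.
Qed.

(** Over a general field so that it serves the complex derivative as well as the derivative along
    the real axis. *)
Lemma quadratic_is_derive {F : numFieldType} (f : F^o -> F^o) (x L K : F) : 0 <= K ->
  (forall h, `|h| <= 1 -> `|f (x + h) - f x - h * L| <= K * `|h| ^+ 2) -> is_derive (x : F^o) 1 f L.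
Proof.
move=> K0 hK.
have key : h^-1 *: (f (h + x) - f x) @[h --> (0 : F)^'] --> (L : F^o).
  apply/cvgrPdist_lt => eps eps0.
  have K1 : 0 < K + 1 by rewrite ltr_wpDl.
  have d0 : 0 < eps / (K + 1) by rewrite divr_gt0.
  rewrite near_withinE; near=> h => h0.
  have h1 : `|h| < 1 by near: h; apply: (@nbhs0_lt _ F^o).
  have h2 : `|h| < eps / (K + 1) by near: h; apply: (@nbhs0_lt _ F^o).
  have hp : 0 < `|h| by rewrite normr_gt0.
  have -> : L - h^-1 *: (f (h + x) - f x) = - h^-1 * (f (x + h) - f x - h * L).
    have E (u v : F) : L - h^-1 * (u - v) = - h^-1 * (u - v - h * L) by field.
    by rewrite [h + x]addrC; exact: E.
  rewrite normrM normrN normfV -(ltr_pM2l hp) mulVKf ?gt_eqF//.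
  apply: (le_lt_trans (hK h (ltW h1))).
  rewrite ltr_pdivlMr// mulrDr mulr1 in h2.
  rewrite expr2 mulrA mulrC ltr_pM2l// mulrC; apply: le_lt_trans h2.
  by rewrite lerDl.
apply: DeriveDef.
  by apply/cvg_ex; exists L; move: key; under eq_fun do rewrite -[X in f (X + _)]mulr1.
by apply/cvg_lim => //; move: key; under eq_fun do rewrite -[X in f (X + _)]mulr1.
Unshelve. all: by end_near. Qed.

Lemma cvg_increment {F : numFieldType} (u v w : nat -> F^o) (a b c h : F) :
  u @ \oo --> (a : F^o) -> v @ \oo --> (b : F^o) -> w @ \oo --> (c : F^o) ->
  (fun N => u N - v N - h * w N : F^o) @ \oo --> (a - b - h * c : F^o).
Proof. by move=> ua vb wc; apply: cvgB; [exact: cvgB|exact: cvgZr]. Qed.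

Section ComplexLimits.
Context {R : realType}.

Lemma norm_le_ReIm (z : R[i]) : `|z| <= (`|complex.Re z| + `|complex.Im z|)%:C.
Proof.
rewrite normc_def lecR -[leRHS]ger0_norm ?addr_ge0// -sqrtr_sqr ler_wsqrtr// sqrrD.
by rewrite !real_normK ?num_real// lerD2r lerDl mulrn_wge0// mulr_ge0.
Qed.

Lemma norm_ge_Im (z : R[i]) : `|complex.Im z|%:C <= `|z|.
Proof. by rewrite normc_def lecR -sqrtr_sqr ler_wsqrtr// lerDr sqr_ge0. Qed.

Lemma complex_cvg (u : nat -> R[i]^o) (l : R[i]) :
  complex.Re (u N) @[N --> \oo] --> complex.Re l -> complex.Im (u N) @[N --> \oo] --> complex.Im l ->
  u @ \oo --> (l : R[i]^o).
Proof.
move=> uR uI; apply/cvgrPdist_lt => e e0.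
have [er ei] : 0 < complex.Re e /\ complex.Im e = 0 by move: e0; rewrite ltcE /= => /andP[/eqP <- ->].
have eE : e = (complex.Re e)%:C by case: e ei {e0 er} => x y /= ->.
have e2 : 0 < complex.Re e / 2 by rewrite divr_gt0.
move/cvgrPdist_lt : uR => /(_ _ e2) uR; move/cvgrPdist_lt : uI => /(_ _ e2) uI.
near=> N; apply: (le_lt_trans (norm_le_ReIm _)); rewrite eE ltcR !raddfB /= (splitr (complex.Re e)).
by apply: ltrD; near: N.
Unshelve. all: by end_near. Qed.

Lemma complex_norm_lim (u : nat -> R[i]^o) (l : R[i]) (K : R) :
  u @ \oo --> (l : R[i]^o) -> (forall N, `|u N| <= K%:C) -> `|l| <= K%:C.
Proof.
move=> ul uK; rewrite normc_def lecR leNgt; apply/negP; set L := Num.sqrt _ => KL.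
have e0 : 0 < (L - K)%:C by rewrite ltcR subr_gt0.
move/cvgrPdist_lt : ul => /(_ _ e0) [N _ /(_ N (leqnn N)) /= hN].
have := ltr_leD hN (uK N); have -> : (L - K)%:C + K%:C = L%:C by rewrite -rmorphD subrK.
move/(le_lt_trans (ler_normD _ _)).
by rewrite subrK normc_def ltcR ltxx.
Qed.
End ComplexLimits.

Lemma exp_series_le {R : realType} (x : R) (N : nat) : 0 <= x ->
  \sum_(0 <= j < N) x ^+ j / j`!%:R <= expR x.
Proof.
move=> x0; apply: (nondecreasing_cvgn_le (u_ := series (exp_coeff x))); last exact: is_cvg_series_exp_coeff.
by apply: nondecreasing_series => j _ _; exact: exp_coeff_ge0.
Qed.

(** * Power series with factorially decaying coefficients *)

Section EntireSeries.
Context {R : realType}.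
Implicit Types (a : nat -> R[i]) (z h : R[i]).

(* Unlike mere summability at every point, this explicit majorant is stable under [derive_coef]. *)
Definition exp_bounded (C r : R) a := forall j, `|a j| <= (C * (r ^+ j / j`!%:R))%:C.

Definition power_sum a z (N : nat) : R[i] := \sum_(0 <= j < N) a j * z ^+ j.

Definition derive_coef a (j : nat) : R[i] := j.+1%:R * a j.+1.

(** Limits are taken coordinatewise, where convergence follows by comparison with a real exponential
    series. *)
Definition power_series a z : R[i] :=
  limn (fun N => complex.Re (power_sum a z N)) +i* limn (fun N => complex.Im (power_sum a z N)).

Lemma complex_norm_bound z : exists2 M : R, 1 <= M & `|z| <= M%:C.
Proof.
exists (1 + (`|complex.Re z| + `|complex.Im z|)); first by rewrite lerDl addr_ge0.
by apply: (le_trans (norm_le_ReIm z)); rewrite lecR lerDr.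
Qed.

Lemma exp_bounded_derive (C r : R) a : exp_bounded C r a -> exp_bounded (C * r) r (derive_coef a).
Proof.
move=> ha j; rewrite normrM normr_nat -(rmorph_nat (real_complex R)).
apply: (@le_trans _ _ (j.+1%:R%:C * (C * (r ^+ j.+1 / (j.+1)`!%:R))%:C)).
  by rewrite ler_wpM2l// ?lecR.
rewrite -rmorphM lecR factS natrM exprS le_eqVlt; apply/orP; left; apply/eqP; field.
by rewrite pnatr_eq0 -lt0n fact_gt0 nat1r pnatr_eq0.
Qed.

Lemma power_series_cvg (C r : R) a z : 0 <= C -> 0 <= r -> exp_bounded C r a ->
  (power_sum a z : nat -> R[i]^o) @ \oo --> (power_series a z : R[i]^o).
Proof.
move=> C0 r0 ha; have [M M1 zM] := complex_norm_bound z.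
have M0 : 0 <= M by apply: le_trans M1.
have cv (f : R[i] -> R) : {morph f : x y / x + y} -> (forall x, `|f x|%:C <= `|x|) ->
    cvgn (fun N => f (power_sum a z N)).
  move=> fD fb.
  have f0 : f 0 = 0 by apply: (addrI (f 0)); rewrite -fD !addr0.
  have -> : (fun N => f (power_sum a z N)) = series (fun j => f (a j * z ^+ j)).
    by apply/funext => N; rewrite /power_sum /series /= (big_morph f fD f0).
  apply: normed_cvg; apply: (@series_le_cvg _ _ (C *: exp_coeff (r * M))) => [j|j|j|].
  - exact: normr_ge0.
  - by rewrite /= mulr_ge0// exp_coeff_ge0// mulr_ge0.
  - rewrite /= -lecR; apply: (le_trans (fb _)); rewrite normrM normrX.
    apply: (@le_trans _ _ ((C * (r ^+ j / j`!%:R))%:C * M%:C ^+ j)).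
      by apply: ler_pM; rewrite ?exprn_ge0// lerXn2r// nnegrE// lecR.
    rewrite -rmorphXn -rmorphM lecR -[leRHS]/(C * ((r * M) ^+ j / j`!%:R)) exprMn.
    by rewrite le_eqVlt; apply/orP; left; apply/eqP; ring.
  - by rewrite seriesZ; apply: is_cvgZr; exact: is_cvg_series_exp_coeff.
apply: complex_cvg => /=.
  by apply: cv => [x y|x]; [rewrite raddfD|exact: normc_ge_Re].
by apply: cv => [x y|x]; [rewrite raddfD|exact: norm_ge_Im].
Qed.

(** A quadratic error uniform in N survives the limit, so no interchange of limit and derivative is
    needed. The derived sum has one term less, hence N against N + 1. *)
Lemma power_sum_taylor (C r M : R) a z h N : 0 <= C -> 0 <= r -> exp_bounded C r a ->
  1 <= M -> `|z| <= M%:C -> `|z + h| <= M%:C ->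
  `|power_sum a (z + h) N.+1 - power_sum a z N.+1 - h * power_sum (derive_coef a) z N| <=
    (C * expR (4 * r * M))%:C * `|h| ^+ 2.
Proof.
move=> C0 r0 ha M1 zM zhM; have M0 : 0 <= M by apply: le_trans M1.
have -> : power_sum a (z + h) N.+1 - power_sum a z N.+1 - h * power_sum (derive_coef a) z N =
    \sum_(0 <= j < N.+1) a j * ((z + h) ^+ j - z ^+ j - h * (j%:R * z ^+ j.-1)).
  have -> : power_sum (derive_coef a) z N = \sum_(0 <= j < N.+1) a j * (j%:R * z ^+ j.-1).
    rewrite big_nat_recl//= mul0r mulr0 add0r; apply: eq_bigr => j _.
    by rewrite /derive_coef; ring.
  by rewrite mulr_sumr -!sumrB; apply: eq_bigr => j _; ring.
have step j : `|a j * ((z + h) ^+ j - z ^+ j - h * (j%:R * z ^+ j.-1))| <=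
    (C * ((4 * r * M) ^+ j / j`!%:R))%:C * `|h| ^+ 2.
  have Mc : 1 <= M%:C :> R[i] by rewrite -(rmorph1 (real_complex R)) lecR.
  rewrite normrM.
  apply: (@le_trans _ _ ((C * (r ^+ j / j`!%:R))%:C * (j%:R ^+ 2 * M%:C ^+ j * `|h| ^+ 2))).
    by apply: ler_pM => //; exact: pow_taylor.
  rewrite mulrA; apply: ler_wpM2r; first exact: exprn_ge0.
  have -> : (j%:R : R[i]) = (j%:R : R)%:C by rewrite rmorph_nat.
  rewrite -(rmorphXn (real_complex R) 2) -(rmorphXn (real_complex R) j) -!rmorphM lecR.
  rewrite -[leLHS]mulrA; apply: ler_wpM2l => //.
  (* The factor j^2 of [pow_taylor] is absorbed into the geometric factor, at the price of 4 r M
     instead of r M. *)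
  have j4 : j%:R ^+ 2 <= 4 ^+ j :> R.
    by rewrite -!natrX ler_nat -(expnM 2 2) mulnC expnM leq_exp2r// ltnW// ltn_expl.
  have -> : (4 * r * M) ^+ j / j`!%:R = 4 ^+ j * (r ^+ j / j`!%:R * M ^+ j) by rewrite !exprMn; ring.
  rewrite [leLHS](_ : _ = j%:R ^+ 2 * (r ^+ j / j`!%:R * M ^+ j)); last by ring.
  by rewrite ler_wpM2r// mulr_ge0 ?divr_ge0 ?exprn_ge0.
apply: (le_trans (ler_norm_sum _ _ _)); apply: (le_trans (ler_sum _ (fun j _ => step j))).
rewrite -mulr_suml ler_wpM2r ?exprn_ge0// -rmorph_sum lecR -mulr_sumr ler_wpM2l//.
by apply: exp_series_le; rewrite !mulr_ge0.
Qed.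

Lemma power_series_taylor (C r : R) a z : 0 <= C -> 0 <= r -> exp_bounded C r a ->
  exists2 K : R, 0 <= K & forall h, `|h| <= 1 ->
    `|power_series a (z + h) - power_series a z - h * power_series (derive_coef a) z| <= K%:C * `|h| ^+ 2.
Proof.
move=> C0 r0 ha; have [M M1 zM] := complex_norm_bound z.
have M10 : 1 <= M + 1 by rewrite lerDr (le_trans ler01).
exists (C * expR (4 * r * (M + 1))) => [|h h1]; first by rewrite mulr_ge0 ?expR_ge0.
have zM1 : `|z| <= (M + 1)%:C by apply: (le_trans zM); rewrite lecR lerDl.
have zhM1 : `|z + h| <= (M + 1)%:C.
  by apply: (le_trans (ler_normD _ _)); rewrite rmorphD rmorph1 lerD.
have hE : `|h| ^+ 2 = (complex.Re `|h| ^+ 2)%:C.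
  by rewrite normc_def rmorphXn.
have c1 := @power_series_cvg _ _ _ (z + h) C0 r0 ha; have c2 := @power_series_cvg _ _ _ z C0 r0 ha.
have c3 := @power_series_cvg _ _ _ z (mulr_ge0 C0 r0) r0 (exp_bounded_derive ha).
rewrite -cvg_shiftS in c1.
rewrite -cvg_shiftS in c2.
have c4 := @cvg_increment R[i] _ _ _ _ _ _ h c1 c2 c3.
rewrite hE -rmorphM; apply: (complex_norm_lim c4) => N.
by have := power_sum_taylor N C0 r0 ha M10 zM1 zhM1; rewrite hE -rmorphM.
Qed.

Lemma power_series_is_derive (C r : R) a z : 0 <= C -> 0 <= r -> exp_bounded C r a ->
  is_derive (z : R[i]^o) 1 (power_series a : R[i]^o -> R[i]^o) (power_series (derive_coef a) z).
Proof.
move=> C0 r0 ha; have [K K0 hK] := power_series_taylor z C0 r0 ha.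
by apply: (@quadratic_is_derive R[i] _ _ _ K%:C); rewrite ?lecR.
Qed.

(** To be applied with f the real or the imaginary part; the hypotheses on f are what these two
    share. *)
Lemma power_series_real_derive (f : R[i] -> R) (C r : R) a (x : R) :
  {morph f : u v / u - v} -> (forall (t : R) u, f (t%:C * u) = t * f u) -> (forall u, `|f u|%:C <= `|u|) ->
  0 <= C -> 0 <= r -> exp_bounded C r a ->
  is_derive x 1 (fun t : R => f (power_series a t%:C)) (f (power_series (derive_coef a) x%:C)).
Proof.
move=> fB fZ fb C0 r0 ha; have [K K0 hK] := power_series_taylor x%:C C0 r0 ha.
apply: (@quadratic_is_derive R _ _ _ K) => // h h1.
have hh : `|h%:C| = `|h|%:C :> R[i] by rewrite normc_def /= expr0n addr0 sqrtr_sqr.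
have := hK h%:C; rewrite hh -(rmorph1 (real_complex R)) lecR => /(_ h1).
rewrite -rmorphXn -rmorphM -fZ -!fB rmorphD => H.
by rewrite -lecR; exact: le_trans (fb _) H.
Qed.

End EntireSeries.

Lemma power_series_bound {R : realType} (C r M : R) (a : nat -> R[i]) (z : R[i]) :
  0 <= C -> 0 <= r -> exp_bounded C r a -> 0 <= M -> `|z| <= M%:C ->
  `|power_series a z| <= (C * expR (r * M))%:C.
Proof.
move=> C0 r0 ha M0 zM; apply: (complex_norm_lim (@power_series_cvg _ _ _ _ z C0 r0 ha)) => N.
apply: (le_trans (ler_norm_sum _ _ _)).
apply: (@le_trans _ _ (\sum_(0 <= j < N) (C * ((r * M) ^+ j / j`!%:R))%:C)).
  apply: ler_sum => j _; rewrite normrM normrX.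
  apply: (@le_trans _ _ ((C * (r ^+ j / j`!%:R))%:C * M%:C ^+ j)).
    by apply: ler_pM; rewrite ?exprn_ge0// lerXn2r// nnegrE// lecR.
  rewrite -rmorphXn -rmorphM lecR exprMn.
  by rewrite le_eqVlt; apply/orP; left; apply/eqP; ring.
rewrite -rmorph_sum lecR -mulr_sumr ler_wpM2l//; apply: exp_series_le; exact: mulr_ge0.
Qed.

Lemma cvg_linear_eq {F : numFieldType} (n : nat) (u : 'I_n -> nat -> F^o) (v w : nat -> F^o)
    (U A : 'I_n -> F) (V W x y e : F) :
  (forall l, u l @ \oo --> (U l : F^o)) -> v @ \oo --> (V : F^o) -> w @ \oo --> (W : F^o) ->
  (forall N, x * v N = y * w N + \sum_l A l * u l N + e) -> x * V = y * W + \sum_l A l * U l + e.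
Proof.
move=> uU vV wW E.
have h1 : (fun N => x * v N : F^o) @ \oo --> (x * V : F^o) by exact: cvgZr.
have h2 : (fun N => y * w N + \sum_l A l * u l N + e : F^o) @ \oo --> (y * W + \sum_l A l * U l + e : F^o).
  apply: cvgD; last exact: cvg_cst.
  apply: cvgD; first exact: cvgZr.
  by apply: cvg_big => [|l _]; [exact: add_continuous|apply: cvgZr; exact: uU].
have E' : (fun N => x * v N : F^o) = (fun N => y * w N + \sum_l A l * u l N + e : F^o) by apply/funext.
by rewrite E' in h1; exact: (cvg_unique _ h1 h2).
Qed.

(** * The series as an entire solution of the equation *)

Section SeriesSolution.
Context {R : realType}.
Variables (beta : R) (n : nat).
Hypothesis beta_gt0 : 0 < beta.

Let s (k : 'I_n) (j : nat) : R[i] := svec beta n j k 0.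

Definition series_solution (z : R[i]) : 'cV[R[i]]_n := \col_k power_series (fun j => svec beta n j k 0) z.
Definition series_derivative (z : R[i]) : 'cV[R[i]]_n :=
  \col_k power_series (derive_coef (fun j => svec beta n j k 0)) z.

Lemma series_solutionE z k : series_solution z k 0 = power_series (s k) z.
Proof. by rewrite mxE. Qed.

Lemma series_derivativeE z k : series_derivative z k 0 = power_series (derive_coef (s k)) z.
Proof. by rewrite mxE. Qed.

Lemma svec_exp_bounded : exists2 C : R, 0 <= C & forall k : 'I_n, exp_bounded C n%:R (fun j => svec beta n j k 0).
Proof. by have [C C0 hC] := svec_bound n beta_gt0; exists C => // k j; exact: hC. Qed.

Lemma series_solution_derive (z : R[i]) (k : 'I_n) :
  is_derive (z : R[i]^o) 1 ((fun x => series_solution x k 0) : R[i]^o -> R[i]^o) (series_derivative z k 0).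
Proof.
have [C C0 hC] := svec_exp_bounded.
have := @power_series_is_derive R _ _ _ z C0 (ler0n R n) (hC k).
rewrite series_derivativeE.
by congr is_derive; apply/funext => x; rewrite series_solutionE.
Qed.

Lemma series_solution_cvg (z : R[i]) (k : 'I_n) :
  (power_sum (fun j => svec beta n j k 0) z : nat -> R[i]^o) @ \oo --> (series_solution z k 0 : R[i]^o).
Proof.
have [C C0 hC] := svec_exp_bounded.
by rewrite mxE; exact: (@power_series_cvg R _ _ _ z C0 (ler0n R n) (hC k)).
Qed.

Lemma series_solution0 : series_solution 0 = vecf n.
Proof.
apply/colP => k; rewrite -(svec0 beta n) mxE /power_series.
have -> : power_sum (fun j => svec beta n j k 0) 0 = fun N => if N is 0%N then 0 else svec beta n 0 k 0.
  apply/funext => -[|N]; first by rewrite /power_sum big_nil.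
  rewrite /power_sum big_nat_recl// expr0 mulr1 big1 ?addr0// => j _.
  by rewrite exprS mul0r mulr0.
have L (f : R[i] -> R) : limn (fun N => f (if N is 0%N then 0 else svec beta n 0 k 0)) = f (svec beta n 0 k 0).
  by apply/cvg_lim => //; rewrite -cvg_shiftS; exact: cvg_cst.
by rewrite !L; case: (svec _ _ _ _ _).
Qed.

Lemma svec_coord (j : nat) (k : 'I_n) :
  (beta / 4)%:C * (j.+1%:R * s k j.+1) =
  (0 +i* 1) * (beta / 4)%:C * k.+1%:R * s k j + \sum_(l < n) matA n k l * s l j.+1.
Proof.
rewrite /s; move: (svec beta n j) (svec beta n j.+1) (svec_eq n beta_gt0 j) => u v /matrixP/(_ k 0).
rewrite [in RHS]mxE matB_col !mxE rmorph_nat => /(congr1 (fun x => (beta / 4)%:C * x)).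
rewrite mulrBr [in X in _ - X]mulrA -rmorphM.
have -> : beta / 4 * (4 / beta) = 1 by field; rewrite gt_eqF.
rewrite rmorph1 mul1r => /eqP; rewrite subr_eq => /eqP ->; congr (_ + _); ring.
Qed.

(** The recursion gives an exact identity between partial sums, which passes to the limit. The sums
    multiplied by A have one term more, since the factor z raises the degree of the other two by
    one. *)
Lemma series_solution_ode (z : R[i]) :
  ((beta / 4)%:C * z) *: series_derivative z =
  (((0 +i* 1) * (beta / 4)%:C * z) *: matB n + matA n) *m series_solution z + (n.+1%:R / 2) *: vece n.
Proof.
have [C C0 hC] := svec_exp_bounded; have n0 := ler0n R n.
apply/colP => k; rewrite mulmxDl -scalemxAl.
have -> : (((beta / 4)%:C * z) *: series_derivative z) k 0 =
    (beta / 4)%:C * z * power_series (derive_coef (s k)) z by rewrite !mxE.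
have -> : (((0 +i* 1) * (beta / 4)%:C * z) *: (matB n *m series_solution z) + matA n *m series_solution z
      + n.+1%:R / 2 *: vece n) k 0 =
    ((0 +i* 1) * (beta / 4)%:C * z * k.+1%:R) * power_series (s k) z +
    \sum_l matA n k l * power_series (s l) z + n.+1%:R / 2 * vece n k 0.
  rewrite mxE [X in X + _]mxE [X in X + _ + _]mxE [X in _ + X]mxE matB_col mulrA; congr (_ * _ + _ + _).
    by rewrite mxE.
  by rewrite mxE; apply: eq_bigr => l _; congr (_ * _); rewrite mxE.
have cv l := @power_series_cvg _ _ _ _ z C0 n0 (hC l).
have cvS l : (fun N => power_sum (s l) z N.+1 : R[i]^o) @ \oo --> (power_series (s l) z : R[i]^o).
  by have := cv l; rewrite -cvg_shiftS.
have cd := @power_series_cvg _ _ _ _ z (mulr_ge0 C0 n0) n0 (exp_bounded_derive (hC k)).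
apply: (@cvg_linear_eq R[i] n _ _ _ _ _ _ _ _ _ _ cvS cd (cv k)) => N.
(* The constant coefficient: A s_0 cancels the inhomogeneous term. *)
have A0 : \sum_l matA n k l * s l 0 = - (n.+1%:R / 2 * vece n k 0).
  have := @matA_vecf R n => /matrixP/(_ k 0); rewrite -(svec0 beta n) [LHS]mxE => ->.
  by rewrite mxE [X in - X]mxE.
have -> : \sum_l matA n k l * power_sum (s l) z N.+1 =
    \sum_(0 <= j < N) (\sum_l matA n k l * s l j.+1) * z ^+ j.+1 - n.+1%:R / 2 * vece n k 0.
  rewrite -A0 addrC /power_sum.
  under eq_bigr => l _ do rewrite big_nat_recl// expr0 mulr1 mulrDr mulr_sumr.
  rewrite big_split /=; congr (_ + _); rewrite exchange_big /=; apply: eq_bigr => j _.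
  by rewrite mulr_suml; apply: eq_bigr => l _; rewrite mulrA.
rewrite -!addrA addNr addr0 /power_sum !mulr_sumr -big_split /=; apply: eq_bigr => j _.
have := svec_coord j k; rewrite /derive_coef -/(s k j) -/(s k j.+1) => h.
rewrite exprS; set S := \sum_l _ in h *.
transitivity ((beta / 4)%:C * (j.+1%:R * s k j.+1) * (z * z ^+ j)); first by ring.
by rewrite h; ring.
Qed.

End SeriesSolution.

(** * Uniqueness of the solution bounded near -oo *)

Lemma nonpos_of_expR_decay {R : realType} (x K : R) : (forall t : R, t <= 0 -> x <= K * expR (2 * t)) -> x <= 0.
Proof.
move=> h; rewrite leNgt; apply/negP => x0.
have K0 : x <= K by have := h 0 (lexx _); rewrite mulr0 expR0 mulr1.
have Kp : 0 < K by apply: lt_le_trans K0.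
(* At t = - K / x, exp(2 K / x) >= 1 + 2 K / x gives x + 2 K <= K, which is absurd. *)
have := h (- (K / x)); rewrite oppr_le0 (divr_ge0 (ltW Kp) (ltW x0)) => /(_ isT).
rewrite mulrN expRN ler_pdivlMr ?expR_gt0// => hh.
have := expR_ge1Dx (2 * (K / x)); rewrite -(ler_pM2l x0) => h2.
have := le_trans h2 hh; rewrite mulrDr mulr1.
have -> : x * (2 * (K / x)) = 2 * K by field; rewrite gt_eqF.
lra.
Qed.

(* Only the diagonal of A contributes to the derivative of the weighted energy, so the energy decays at
   least like exp(-2 t); being bounded near -oo, it vanishes. *)
Lemma bounded_solution_eq0 {R : realType} (n : nat) (mu : R -> R) (D D' : R -> 'cV[R[i]]_n) (K : R) :
  (forall (t : R) k, is_derive t 1 (fun u => complex.Re (D u k 0)) (complex.Re (D' t k 0))) ->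
  (forall (t : R) k, is_derive t 1 (fun u => complex.Im (D u k 0)) (complex.Im (D' t k 0))) ->
  (forall t : R, D' t = (0 +i* mu t) *: (matB n *m D t) + matA n *m D t) ->
  (forall t : R, t <= 0 -> wdot (D t) (D t) <= K) -> D 0 = 0.
Proof.
move=> dR dI DE DK; apply: wdot_eq0.
pose phi t := expR (2 * t) * wdot (D t) (D t).
have dphi (t : R) : is_derive t 1 phi (expR (2 * t) * (2 * wdot (D t) (D t) + 2 * wdot (D t) (D' t))).
  have dw (k : 'I_n) : is_derive t 1 (fun u => wgt R n k.+1 * (complex.Re (D u k 0) * complex.Re (D u k 0) +
      complex.Im (D u k 0) * complex.Im (D u k 0))) (wgt R n k.+1 *
      (2 * (complex.Re (D t k 0) * complex.Re (D' t k 0) + complex.Im (D t k 0) * complex.Im (D' t k 0)))).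
    have h1 := dR t k; have h2 := dI t k.
    have h := is_deriveZ (wgt R n k.+1) (is_deriveD (is_deriveM h1 h1) (is_deriveM h2 h2)).
    apply: is_derive_eq; rewrite /GRing.scale /=; ring.
  have dsum := is_derive_sum dw.
  have dexp : is_derive t 1 (fun u : R => expR (2 * u)) (2 * expR (2 * t)).
    have h := is_derive1_comp (is_derive_expR (2 * t)) (is_deriveZ 2 (is_derive_id t (1 : R))).
    apply: is_derive_eq; rewrite /GRing.scale /= mulr1 mulrC //.
  have phiE : phi = (fun u : R => expR (2 * u)) * \sum_(i < n) (fun u : R =>
      wgt R n i.+1 * (complex.Re (D u i 0) * complex.Re (D u i 0) + complex.Im (D u i 0) * complex.Im (D u i 0))).
    apply/funext => u; by rewrite /phi /wdot fct_sumE.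
  rewrite phiE; apply: (is_derive_eq (is_deriveM dexp dsum)).
  rewrite fct_sumE /GRing.scale /= -/(wdot (D t) (D t)).
  have -> : \sum_(i < n) wgt R n i.+1 * (2 * (complex.Re (D t i 0) * complex.Re (D' t i 0) +
      complex.Im (D t i 0) * complex.Im (D' t i 0))) = 2 * wdot (D t) (D' t).
    by rewrite mulr_sumr; apply: eq_bigr => i _; ring.
  by ring.
have phi_le t : t <= 0 -> phi 0 <= phi t.
  move=> t0; apply: (@ler0_derive1_nincrNy R phi 0) => //.
  - move=> u _; rewrite derive1E (@derive_val _ _ _ _ _ _ _ (dphi u)).
    rewrite DE wdotDr wdot_imatB add0r mulr_ge0_le0 ?expR_ge0//.
    have := wdot_matA (D u); lra.
  - by apply: continuous_subspaceT => u; apply: differentiable_continuous; apply/derivable1_diffP; have [] := dphi u.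
apply: (@nonpos_of_expR_decay _ _ K) => t t0.
have := phi_le t t0; rewrite /phi mulr0 expR0 mul1r => /le_trans; apply.
by rewrite mulrC ler_wpM2r ?expR_ge0// DK.
Qed.

(** * The series as a function of time *)

Section SeriesAlongExponential.
Context {R : realType}.
Variables (beta : R) (n : nat) (lambda : R).
Hypothesis beta_gt0 : 0 < beta.

Let b := beta / 4.
Let x (t : R) := lambda * expR (b * t).

Lemma series_along_exp (f : R[i] -> R) (k : 'I_n) (t : R) :
  {morph f : u v / u - v} -> (forall (t : R) u, f (t%:C * u) = t * f u) -> (forall u, `|f u|%:C <= `|u|) ->
  is_derive t 1 (fun u => f (series_solution beta n (x u)%:C k 0))
    (f (((b * x t)%:C *: series_derivative beta n (x t)%:C) k 0)).
Proof.
move=> fB fZ fb; have [C C0 hC] := svec_exp_bounded n beta_gt0.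
have d1 := power_series_real_derive (x t) fB fZ fb C0 (ler0n R n) (hC k).
have dx : is_derive t 1 x (b * x t).
  have h := is_derive1_comp (is_derive_expR (b * t)) (is_deriveZ b (is_derive_id t (1 : R))).
  by apply: is_derive_eq; rewrite /x /GRing.scale /= mulr1; ring.
have h := is_derive1_comp d1 dx.
have E (c : R[i]) (M : 'cV[R[i]]_n) : (c *: M) k 0 = c * M k 0 by rewrite mxE.
have fE : (fun u => f (series_solution beta n (x u)%:C k 0)) =
    (fun t => f (power_series (fun j => svec beta n j k 0) t%:C)) \o x.
  by apply/funext => u; rewrite /= series_solutionE.
rewrite fE; apply: (is_derive_eq h).
by rewrite E fZ series_derivativeE mulrC.
Qed.

Lemma series_along_exp_ode (t : R) : (b * x t)%:C *: series_derivative beta n (x t)%:C =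
  (0 +i* (b * x t)) *: (matB n *m series_solution beta n (x t)%:C) +
  matA n *m series_solution beta n (x t)%:C + (n.+1%:R / 2) *: vece n.
Proof.
have E : (0 +i* 1) * (beta / 4)%:C * (x t)%:C = 0 +i* (b * x t).
  rewrite -mulrA -rmorphM.
  by apply/eqP; rewrite eq_complex /=; apply/andP; split; apply/eqP; rewrite /b; ring.
have := series_solution_ode n beta_gt0 (x t)%:C; rewrite -rmorphM mulmxDl -scalemxAl => ->.
by rewrite E.
Qed.

Lemma series_along_exp_bound : exists K : R, forall t : R, t <= 0 -> forall k,
  `|series_solution beta n (x t)%:C k 0| <= K%:C.
Proof.
have [C C0 hC] := svec_exp_bounded n beta_gt0; exists (C * expR (n%:R * `|lambda|)) => t t0 k.
rewrite series_solutionE; apply: (@power_series_bound R _ _ _ _ _ C0 (ler0n R n) (hC k) (normr_ge0 _)).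
rewrite normc_def /= expr0n addr0 sqrtr_sqr lecR normrM ler_piMr// ger0_norm ?expR_ge0//.
by rewrite -[leRHS]expR0 ler_expR mulr_ge0_le0// divr_ge0// ltW.
Qed.

End SeriesAlongExponential.

(** * The moments as solution of the linear equation *)

Section Moments.
Context {R : realType} {d : measure_display} {T : measurableType d}.
Variables (P : probability T R) (Z : R -> T -> R[i]).
Hypothesis ZBM : two_sided_complex_BM P Z.
Variables (beta : R) (n : nat) (lambda : R) (a : R -> T -> R).
Hypothesis beta_gt0 : 0 < beta.
Hypothesis sol : is_strong_solution P Z beta n lambda a.

Let mu := det_drift beta lambda.

(* The phase th covers the cosine (th = 0) and the sine (th = - pi / 2) at once. *)
Definition wave (k th t : R) : R := Ex P (fun w => cos (k * a t w + th)).

(** The phase - pi/2 turns the sine from the derivative into a cosine. The products with cos a and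
    sin a become waves of frequency k - 1 and k + 1, whose coefficients are those of row k of A. *)
Definition wave_generator (k th t : R) : R :=
  - k * mu t * wave k (th - pi / 2) t +
  (- k ^+ 2 * wave k th t + 2^-1 * k * (k + n%:R) * wave (k - 1) th t + 2^-1 * k * (k - n%:R) * wave (k + 1) th t).

Let wL1 k th t : L1 P (fun w => cos (k * a t w + th)).
Proof. exact: (wave_L1 ZBM sol). Qed.

Lemma wave_le1 k th t : `|wave k th t| <= 1.
Proof.
apply: (le_trans (Ex_abs (wL1 k th t))); rewrite -[leRHS](Ex_cst P).
by apply: Ex_le => [||w]; [exact/L1_abs|exact: L1_cst|exact: cos_max].
Qed.

Lemma wave_expansion (k th : R) : 0 <= k -> expansion_3_2 (wave k th) (wave_generator k th).
Proof.
move=> k0 T0; have [C C0 hC] := weak_step ZBM beta_gt0 sol th T0 k0; exists C => // s e e0 e1 sT.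
have := hC s e e0 e1 sT; congr (`|_ - _ - _ * _| <= _).
have E w : - k * sin (k * a s w + th) * drift beta n lambda a s w +
    - k ^+ 2 * cos (k * a s w + th) * (1 - cos (a s w)) =
    (- k * mu s) * cos (k * a s w + (th - pi / 2)) +
    (- k ^+ 2 * cos (k * a s w + th) + 2^-1 * k * (k + n%:R) * cos ((k - 1) * a s w + th) +
      2^-1 * k * (k - n%:R) * cos ((k + 1) * a s w + th)).
  have -> : k * a s w + (th - pi / 2) = (k * a s w + th) - pi / 2 by ring.
  have -> : (k - 1) * a s w + th = (k * a s w + th) - a s w by ring.
  have -> : (k + 1) * a s w + th = (k * a s w + th) + a s w by ring.
  rewrite /drift -/mu; move: (k * a s w + th) => x; move: (a s w) (mu s) => y m.
  by rewrite cosBpihalf cosB cosD; field.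
transitivity (Ex P (fun w => (- k * mu s) * cos (k * a s w + (th - pi / 2)) +
    (- k ^+ 2 * cos (k * a s w + th) + 2^-1 * k * (k + n%:R) * cos ((k - 1) * a s w + th) +
      2^-1 * k * (k - n%:R) * cos ((k + 1) * a s w + th)))).
  by congr (Ex P _); apply/funext => w.
rewrite ExD; [|exact: L1Z|by apply: L1D; [apply: L1D; exact: L1Z|exact: L1Z]].
rewrite ExD; [|by apply: L1D; exact: L1Z|exact: L1Z].
by rewrite ExD; [|exact: L1Z|exact: L1Z]; rewrite !ExZ.
Qed.

Lemma wave_continuous (k th : R) : 0 <= k -> continuous (wave k th).
Proof.
move=> k0; apply: (expansion_continuous (wave_expansion th k0)) => T0.
exists (k * `|mu T0| + (k ^+ 2 + `|2^-1 * k * (k + n%:R)| + `|2^-1 * k * (k - n%:R)|)) => s sT.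
have M (c y x : R) : `|c| <= y -> `|x| <= 1 -> `|c * x| <= y.
  by move=> cy x1; rewrite normrM -[leRHS]mulr1 ler_pM.
apply: (le_trans (ler_normD _ _)); apply: lerD.
  apply: M; last exact: wave_le1.
  by rewrite normrM normrN (ger0_norm k0) ler_wpM2l// det_drift_le.
apply: (le_trans (ler_normD _ _)); apply: lerD; last by apply: M; [|exact: wave_le1].
apply: (le_trans (ler_normD _ _)); apply: lerD; last by apply: M; [|exact: wave_le1].
by apply: M; [rewrite normrN ger0_norm ?sqr_ge0|exact: wave_le1].
Qed.

Lemma wave_is_derive (k th t : R) : 1 <= k -> is_derive t 1 (wave k th) (wave_generator k th t).
Proof.
move=> k1; have k0 : 0 <= k by apply: le_trans k1.
apply: (expansion_is_derive (wave_expansion th k0)).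
have cmu : continuous mu.
  move=> s; apply: (@continuousM _ _ (fun=> lambda * (beta / 4)) (fun u : R => expR (beta / 4 * u))).
    exact: cst_continuous.
  apply: (@continuous_comp _ _ _ (fun u => beta / 4 * u) expR); last exact: continuous_expR.
  by apply: continuousM; [exact: cst_continuous|exact: cvg_id].
have cw k' th' : 0 <= k' -> {for t, continuous (wave k' th')} by move=> k'0; exact: wave_continuous.
have cZ (c : R) (f : R -> R) : {for t, continuous f} -> {for t, continuous (fun u : R => c * f u : R)}.
  by move=> cf; apply: continuousM => //; exact: cst_continuous.
apply: continuousD.
  apply: continuousM; first by apply: cZ; exact: cmu.
  exact: cw.
apply: continuousD; last by apply: cZ; apply: cw; rewrite addr_ge0.
by apply: continuousD; apply: cZ; apply: cw => //; rewrite subr_ge0.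
Qed.

(** The imaginary part uses cos (x - pi/2) = sin x. *)
Definition moments (t : R) : 'cV[R[i]]_n := \col_i (wave i.+1%:R 0 t +i* wave i.+1%:R (- (pi / 2)) t).

Definition moments_rhs (t : R) : 'cV[R[i]]_n :=
  (0 +i* mu t) *: (matB n *m moments t) + matA n *m moments t + (n.+1%:R / 2) *: vece n.

Let wave_matA (th t : R) (i : 'I_n) :
  - i.+1%:R ^+ 2 * wave i.+1%:R th t + 2^-1 * i.+1%:R * (i.+1%:R + n%:R) * wave (i.+1%:R - 1) th t +
    2^-1 * i.+1%:R * (i.+1%:R - n%:R) * wave (i.+1%:R + 1) th t =
  (matA n *m \col_j wave j.+1%:R th t) i 0 + n.+1%:R / 2 * cos th * vece n i 0.
Proof.
have := matA_col (fun j => wave j%:R th t) i => /= h.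
rewrite -natr1 addrK natr1 [i.+1%:R + 1]natr1 -h; congr (_ + _).
have -> : wave 0 th t = cos th.
  rewrite /wave (_ : (fun w => _) = fun=> cos th) ?Ex_cst//.
  by apply/funext => w; rewrite mul0r add0r.
by rewrite mxE; case: (nat_of_ord i) => [|m]; rewrite /= ?mulr0// -[in RHS]nat1r; field.
Qed.

Let momentsE (t : R) k : moments t k 0 = wave k.+1%:R 0 t +i* wave k.+1%:R (- (pi / 2)) t.
Proof. by rewrite mxE. Qed.

Let moments_rhsE (t : R) k : moments_rhs t k 0 = ((0 +i* mu t) *: (matB n *m moments t)) k 0 +
  (matA n *m moments t) k 0 + (n.+1%:R / 2 * vece n k 0)%:C.
Proof. by rewrite /moments_rhs mxE [X in X + _]mxE [X in _ + X]mxE !mxE rmorphM fmorph_div !rmorph_nat. Qed.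

Lemma moments_Re_derive (t : R) k :
  is_derive t 1 (fun u => complex.Re (moments u k 0)) (complex.Re (moments_rhs t k 0)).
Proof.
have -> : (fun u => complex.Re (moments u k 0)) = wave k.+1%:R 0 by apply/funext => u; rewrite mxE.
apply: (is_derive_eq (wave_is_derive 0 t _)); first by rewrite ler1n.
rewrite /wave_generator wave_matA.
rewrite moments_rhsE !raddfD /= matA_Re matB_scale.
have -> : map_mx (@complex.Re R) (moments t) = \col_j wave j.+1%:R 0 t by apply/colP => i; rewrite !mxE.
rewrite momentsE /= sub0r cos0; ring.
Qed.

Lemma moments_Im_derive (t : R) k :
  is_derive t 1 (fun u => complex.Im (moments u k 0)) (complex.Im (moments_rhs t k 0)).
Proof.
have -> : (fun u => complex.Im (moments u k 0)) = wave k.+1%:R (- (pi / 2)) by apply/funext => u; rewrite mxE.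
apply: (is_derive_eq (wave_is_derive _ t _)); first by rewrite ler1n.
rewrite /wave_generator wave_matA.
rewrite moments_rhsE !raddfD /= matA_Im matB_scale.
have -> : map_mx (@complex.Im R) (moments t) = \col_j wave j.+1%:R (- (pi / 2)) t by apply/colP => i; rewrite !mxE.
rewrite momentsE /= cosN cos_pihalf.
(* Two quarter turns change the sign; this is the minus sign in i^2 = -1 for the term i mu B. *)
have -> : wave k.+1%:R (- (pi / 2) - pi / 2) t = - wave k.+1%:R 0 t.
  rewrite -[RHS]mulN1r; apply: etrans (ExZ (-1) (wL1 _ _ _)).
  congr (Ex P _); apply/funext => w.
  by rewrite addrA cosBpihalf sinBpihalf addr0 mulN1r.
ring.
Qed.

Lemma moments_bound (t : R) k : `|moments t k 0| <= 2%:C.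
Proof.
apply: (le_trans (norm_le_ReIm _)); rewrite mxE lecR /=.
have -> : 2 = 1 + 1 :> R by [].
by apply: lerD; exact: wave_le1.
Qed.

Lemma moments_eq_series : moments 0 = series_solution beta n lambda%:C.
Proof.
have [K hK] := series_along_exp_bound n lambda beta_gt0.
pose x t := lambda * expR (beta / 4 * t).
have x0 : x 0 = lambda by rewrite /x mulr0 expR0 mulr1.
have mux t : mu t = beta / 4 * x t by rewrite /mu /det_drift /x; ring.
have fE : lambda%:C = (x 0)%:C by rewrite x0.
apply/eqP; rewrite -subr_eq0 fE; apply/eqP.
pose D t := moments t - series_solution beta n (x t)%:C.
pose D' t := moments_rhs t - (beta / 4 * x t)%:C *: series_derivative beta n (x t)%:C.
have DE t k : D t k 0 = moments t k 0 - series_solution beta n (x t)%:C k 0.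
  by rewrite /D mxE [X in _ + X]mxE.
have D'E t k : D' t k 0 = moments_rhs t k 0 - ((beta / 4 * x t)%:C *: series_derivative beta n (x t)%:C) k 0.
  by rewrite /D' mxE [X in _ + X]mxE.
(* The inhomogeneous terms cancel in the difference. For t <= 0 its coordinates are bounded by 2 for
   the moments plus K for the series. *)
apply: (@bounded_solution_eq0 _ n mu D D' (\sum_(i < n) wgt R n i.+1 * (2 + K) ^+ 2)).
- move=> t k; rewrite D'E raddfB.
  have -> : (fun u => complex.Re (D u k 0)) = (fun u => complex.Re (moments u k 0)) -
      (fun u => complex.Re (series_solution beta n (x u)%:C k 0)).
    by apply/funext => u; rewrite DE raddfB.
  apply: is_deriveB; first exact: moments_Re_derive.
  apply: series_along_exp => //; [exact: raddfB|exact: Re_realM|exact: normc_ge_Re].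
- move=> t k; rewrite D'E raddfB.
  have -> : (fun u => complex.Im (D u k 0)) = (fun u => complex.Im (moments u k 0)) -
      (fun u => complex.Im (series_solution beta n (x u)%:C k 0)).
    by apply/funext => u; rewrite DE raddfB.
  apply: is_deriveB; first exact: moments_Im_derive.
  apply: series_along_exp => //; [exact: raddfB|exact: Im_realM|exact: norm_ge_Im].
- move=> t; rewrite /D' /moments_rhs series_along_exp_ode// -mux.
  rewrite /D !mulmxBr scalerBr.
  have E (u v u' v' e : 'cV[R[i]]_n) : u + v + e - (u' + v' + e) = u - u' + (v - v').
    by rewrite opprD addrACA subrr addr0 opprD addrACA.
  exact: E.
- move=> t t0; apply: ler_sum => k _; rewrite ler_wpM2l//; first exact/ltW/wgt_ord_gt0.
  have : `|D t k 0| <= (2 + K)%:C.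
    by rewrite DE rmorphD; apply: (le_trans (ler_normB _ _)); rewrite lerD ?moments_bound// hK.
  rewrite normc_def lecR => h; rewrite -!expr2.
  rewrite -[leLHS]sqr_sqrtr ?addr_ge0 ?sqr_ge0// lerXn2r ?nnegrE ?sqrtr_ge0//.
  by apply: le_trans h; exact: sqrtr_ge0.
Qed.

End Moments.

Lemma qvec_series {R : realType} {d : measure_display} {T : measurableType d} (P : probability T R)
    (Z : R -> T -> R[i]) (beta : R) (n : nat) (alpha : R -> R -> T -> R) (lambda : R) :
  0 < beta -> two_sided_complex_BM P Z -> is_strong_solution P Z beta n lambda (alpha lambda) ->
  qvec P n alpha lambda = series_solution beta n lambda%:C.
Proof.
move=> beta_gt0 ZBM sol; rewrite -(moments_eq_series ZBM beta_gt0 sol); apply/colP => k.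
rewrite [LHS]mxE [RHS]mxE /cexpectation unlock /= /wave /Ex /Rintegral; congr (fine _ +i* fine _).
  by apply: eq_integral => w _; rewrite addr0.
by apply: eq_integral => w _; rewrite cosBpihalf.
Qed.

Theorem theorem14 (R : realType) (d : measure_display) (T : measurableType d)
    (P : probability T R) (Z : R -> T -> R[i]) (beta : R) (n : nat)
    (alpha : R -> R -> T -> R)
    (beta_gt0 : 0 < beta) (n_ge1 : (1 <= n)%N)
    (Z_BM : two_sided_complex_BM P Z)
    (alpha_sol : forall lambda : R,
       is_strong_solution P Z beta n lambda (alpha lambda)) :
  let q := qvec P n alpha in
  [/\ forall lambda : R,
        (forall k : 'I_n, cderivable (fun x => q x k 0) lambda) /\
        (beta / 4 * lambda)%:C *: (\col_k cderive (fun x => q x k 0) lambda)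
        = (((0 +i* 1) * (beta / 4 * lambda)%:C) *: matB n + matA n) *m q lambda
          + (n.+1%:R / 2) *: vece n,
      q 0 = vecf n,
      matA n \in @unitmx R[i] n /\
      (forall j : nat, (1 <= j)%N ->
        (j%:R)%:M - (4 / beta)%:C *: matA n \in @unitmx R[i] n)
    & exists Q : R[i] -> 'cV[R[i]]_n,
        [/\ forall lambda : R, Q lambda%:C = q lambda,
            forall k : 'I_n, entire (fun z => Q z k 0),
            forall z : R[i],
              ((beta / 4)%:C * z) *: (\col_k holo_derive (fun x => Q x k 0) z)
              = (((0 +i* 1) * (beta / 4)%:C * z) *: matB n + matA n) *m Q z
                + (n.+1%:R / 2) *: vece n
          & forall (z : R[i]) (k : 'I_n),
              ((fun N : nat => \sum_(0 <= j < N) svec beta n j k 0 * z ^+ j)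
                 : nat -> R[i]^o) @ \oo --> (Q z k 0 : R[i]^o) ] ].
Proof.
move=> q.
have qE lambda : q lambda = series_solution beta n lambda%:C by exact: (qvec_series beta_gt0 Z_BM (alpha_sol lambda)).
have [C C0 hC] := svec_exp_bounded n beta_gt0.
have b4 : 0 <= 4 / beta by rewrite divr_ge0// ltW.
(* Differentiability in lambda comes from the series, not from the dependence of the random solution
   on lambda. *)
have dq (f : R[i] -> R) (k : 'I_n) (lambda : R) : {morph f : u v / u - v} ->
    (forall (t : R) u, f (t%:C * u) = t * f u) -> (forall u, `|f u|%:C <= `|u|) ->
    is_derive lambda 1 (fun x : R => f (q x k 0)) (f (series_derivative beta n lambda%:C k 0)).
  move=> fB fZ fb; rewrite series_derivativeE.
  have -> : (fun x => f (q x k 0)) = (fun t => f (power_series (fun j => svec beta n j k 0) t%:C)).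
    by apply/funext => x; rewrite qE series_solutionE.
  exact: (power_series_real_derive lambda fB fZ fb C0 (ler0n R n) (hC k)).
have dqR (lambda : R) k : is_derive lambda 1 (fun x : R => complex.Re (q x k 0))
    (complex.Re (series_derivative beta n lambda%:C k 0)).
  by apply: dq; [exact: raddfB|exact: Re_realM|exact: normc_ge_Re].
have dqI (lambda : R) k : is_derive lambda 1 (fun x : R => complex.Im (q x k 0))
    (complex.Im (series_derivative beta n lambda%:C k 0)).
  by apply: dq; [exact: raddfB|exact: Im_realM|exact: norm_ge_Im].
split.
- move=> lambda; split=> [k|].
    by split; [have [] := dqR lambda k|have [] := dqI lambda k].
  have -> : \col_k cderive (fun x => q x k 0) lambda = series_derivative beta n lambda%:C.
    apply/colP => k; rewrite [LHS]mxE /cderive !derive1E.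
    rewrite (@derive_val _ _ _ _ _ _ _ (dqR lambda k)) (@derive_val _ _ _ _ _ _ _ (dqI lambda k)).
    by case: (series_derivative _ _ _ _ _).
  by rewrite qE (rmorphM _ (beta / 4)) mulrA series_solution_ode.
- by rewrite qE series_solution0.
- by split=> [|j j1]; [exact: matA_unit|exact: resolvent_unit].
exists (series_solution beta n); split.
- by move=> lambda; rewrite qE.
- by move=> k z; have [] := series_solution_derive beta_gt0 z k.
- move=> z; rewrite -series_solution_ode//; congr (_ *: _); apply/colP => k.
  rewrite [LHS]mxE /holo_derive.
  exact: (@derive_val _ _ _ _ _ _ _ (series_solution_derive beta_gt0 z k)).
- by move=> z k; exact: series_solution_cvg.
Qed.
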